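(* Let $k\ge 4$ and let $\sigma=((m_1,n_1),\dots,(m_k,n_k))$ be a $k$-tuple of pairs of non-zero integers with $|m_i|<|n_i|$ for every $i$. Let $X_\sigma$ be the developed complex of $\mathrm{Hig}_\sigma$ and $\Theta_\sigma$ its intersection graph. Then the natural homomorphisms $\widehat{\mathrm{Hig}}_\sigma\to\mathrm{Aut}(X_\sigma)$ and $\widehat{\mathrm{Hig}}_\sigma\to\mathrm{Aut}(\Theta_\sigma)$ are isomorphisms.
   Context: $G=\mathrm{Hig}_\sigma=\langle a_i\ (i\in\mathbb{Z}/k\mathbb{Z})\mid \{a_ia_{i+1}^{m_i}a_i^{-1}=a_{i+1}^{n_i}\}_{i}\rangle$. Let $F_\sigma$ be the finite group of translations $\tau$ of $\mathbb{Z}/k\mathbb{Z}$ such that for every $i$, either $(m_{\tau(i)},n_{\tau(i)})=(m_i,n_i)$ or $(m_{\tau(i)},n_{\tau(i)})=(-m_i,-n_i)$; it acts on $G$ by $\tau(a_i)=a_{\tau(i)}$, and $\widehat{\mathrm{Hig}}_\sigma=G\rtimes F_\sigma$. For $i\in\mathbb{Z}/k\mathbb{Z}$ let $G_i=\langle a_{i-1},a_i\rangle$ and $E_i=\langle a_i\rangle$. The developed complex $X_\sigma$ is the 2-dimensional polygonal complex whose vertices are the pairs $(i,gG_i)$ (left cosets of $G_i$, $g\in G$, $i\in\mathbb{Z}/k\mathbb{Z}$), whose edges are the left cosets $gE_i$, the edge $gE_i$ joining the vertices $gG_i$ and $gG_{i+1}$, and whose 2-cells are indexed by the elements $g\in G$,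 the 2-cell $g$ being a $k$-gon glued along the closed edge path $gE_1,gE_2,\dots,gE_k$ (through the vertices $gG_1,\dots,gG_k$). $G$ acts on $X_\sigma$ by left multiplication, and $F_\sigma$ acts by $\tau(gG_i)=\tau(g)G_{\tau(i)}$, $\tau(gE_i)=\tau(g)E_{\tau(i)}$, $\tau(\text{cell } g)=\text{cell }\tau(g)$; together these give an action of $\widehat{\mathrm{Hig}}_\sigma$. The intersection graph $\Theta_\sigma$ has vertex set the vertex set of $X_\sigma$, two vertices being adjacent if their $G$-stabilizers have nontrivial intersection; $\widehat{\mathrm{Hig}}_\sigma$ acts on it. $\mathrm{Aut}(X_\sigma)$ is the group of cellular automorphisms and $\mathrm{Aut}(\Theta_\sigma)$ the group of graph automorphisms. *)

(* Defs.v *)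
From mathcomp Require Import all_boot ssralg ssrnum ssrint.
Set Implicit Arguments. Unset Strict Implicit. Unset Printing Implicit Defensive.

Record group := Group {
  gcar :> Type;
  gmul : gcar -> gcar -> gcar;
  gone : gcar;
  ginv : gcar -> gcar;
  gmulA : forall x y z, gmul x (gmul y z) = gmul (gmul x y) z;
  gmul1 : forall x, gmul gone x = x;
  gmulV : forall x, gmul (ginv x) x = gone }.

Arguments gmul {g}. Arguments gone {g}. Arguments ginv {g}.

Definition gpow (G : group) (g : G) (z : int) : G :=
  match z with
  | Posz p => iter p (gmul g) gone
  | Negz p => ginv (iter p.+1 (gmul g) gone)
  end.

Definition is_hom (G H : group) (f : G -> H) : Prop :=
  forall x y, f (gmul x y) = gmul (f x) (f y).

Inductive gen (G : group) (S : G -> Prop) : G -> Prop :=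
| gen_in x : S x -> gen S x
| gen_one : gen S gone
| gen_mul x y : gen S x -> gen S y -> gen S (gmul x y)
| gen_inv x : gen S x -> gen S (ginv x).

Definition oadd (k : nat) (i t : 'I_k) : 'I_k :=
  Ordinal (ltn_pmod (i + t) (leq_ltn_trans (leq0n i) (ltn_ord i))).

Section Higman.
Variables (k : nat) (m n : 'I_k -> int).

Definition hig_rels (H : group) (b : 'I_k -> H) : Prop :=
  forall i : 'I_k,
    gmul (gmul (b i) (gpow (b (ordS i)) (m i))) (ginv (b i))
    = gpow (b (ordS i)) (n i).

Definition is_Hig (G : group) (a : 'I_k -> G) : Prop :=
  hig_rels a /\
  forall (H : group) (b : 'I_k -> H), hig_rels b ->
    exists f : G -> H, [/\ is_hom f, (forall i, f (a i) = b i) &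
      forall f' : G -> H, is_hom f' -> (forall i, f' (a i) = b i) ->
        forall x, f' x = f x].

Definition in_Fsigma (t : 'I_k) : Prop :=
  forall i : 'I_k,
    (m (oadd i t) = m i /\ n (oadd i t) = n i) \/
    (m (oadd i t) = (- m i)%R /\ n (oadd i t) = (- n i)%R).

Variables (G : group) (a : 'I_k -> G).

Definition Gi (i : 'I_k) : G -> Prop :=
  gen (fun x => x = a (ord_pred i) \/ x = a i).
Definition Ei (i : 'I_k) : G -> Prop := gen (fun x => x = a i).

(** Cells of X_sigma: a vertex (i, g) stands for (i, gG_i), an edge (i, g)
    for gE_i, a face g for the 2-cell g. Equality of cells is coset equality. *)
Definition vert := ('I_k * G)%type.
Definition edge := ('I_k * G)%type.
Definition face := G.

Definition veq (v w : vert) : Prop :=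
  v.1 = w.1 /\ Gi v.1 (gmul (ginv v.2) w.2).
Definition eeq (e f : edge) : Prop :=
  e.1 = f.1 /\ Ei e.1 (gmul (ginv e.2) f.2).
Definition feq (c d : face) : Prop := c = d.

Definition edge_vert (e : edge) (v : vert) : Prop :=
  veq v (e.1, e.2) \/ veq v (ordS e.1, e.2).
Definition face_edge (c : face) (e : edge) : Prop :=
  exists i : 'I_k, eeq e (i, c).

Definition setoid_bij (T : Type) (eqT : T -> T -> Prop) (f : T -> T) : Prop :=
  (forall x y, eqT x y -> eqT (f x) (f y)) /\
  exists g : T -> T,
    [/\ forall x y, eqT x y -> eqT (g x) (g y),
        forall x, eqT (g (f x)) x & forall x, eqT (f (g x)) x].

Definition is_autX (fV : vert -> vert) (fE : edge -> edge) (fF : face -> face)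
  : Prop :=
  [/\ setoid_bij veq fV, setoid_bij eeq fE, setoid_bij feq fF,
      forall e v, edge_vert e v <-> edge_vert (fE e) (fV v) &
      forall c e, face_edge c e <-> face_edge (fF c) (fE e)].

Definition stab (v : vert) (x : G) : Prop :=
  Gi v.1 (gmul (gmul (ginv v.2) x) v.2).
Definition adj (v w : vert) : Prop :=
  ~ veq v w /\ exists x : G, [/\ x <> gone, stab v x & stab w x].

Definition is_autTheta (fV : vert -> vert) : Prop :=
  setoid_bij veq fV /\ forall v w, adj v w <-> adj (fV v) (fV w).

(** action of (g, tau_t) in Hig_hat = G x| F_sigma, where alpha t is the
    automorphism of G induced by tau_t (a_i |-> a_{i+t}) *)
Variable alpha : 'I_k -> G -> G.
Definition actV (g : G) (t : 'I_k) (v : vert) : vert :=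
  (oadd v.1 t, gmul g (alpha t v.2)).
Definition actE (g : G) (t : 'I_k) (e : edge) : edge :=
  (oadd e.1 t, gmul g (alpha t e.2)).
Definition actF (g : G) (t : 'I_k) (c : face) : face := gmul g (alpha t c).

End Higman.

(* Main.v *)
(** Write S(u,v) for the subgroup generated by a_u, ..., a_v.  Each S(u,v) with
   v - u <= k - 2 is an iterated amalgam of Baumslag-Solitar groups along the
   cyclic groups <a_j>, and G is the amalgam of S(x,y) and S(y,x+k), y = x+k-2,
   along the free group on a_x and a_y.

   Any bijection f of G that maps cosets of <a_j> to cosets of <a_(j+t)> for
   all j is f(1) times the automorphism a_i |-> a_(i+t), with t in F_sigma: on a
   coset g<a_j> f induces a bijection of Z, and whether every <a_j>-coset
   meeting two of the cosets g a_j^p <a_(j+1)> also meets a third recovers the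
   order of Z, because |m_j| < |n_j| makes a_j expanding on <a_(j+1)>.  Automorphisms
   of X_sigma permute the 2-cells by such a bijection; reversing the orientation
   would exchange the stable letter and the base of a Baumslag-Solitar group.

   For Theta_sigma, draw an arrow from u to v when an edge joins them and the
   type of v is one more than that of u, and let K_u consist of u and the heads
   of the arrows from u.  Bass-Serre theory shows that v and w are adjacent iff
   they lie in a common K_u.  A closed chain of at most k stars, consecutive
   ones sharing a vertex, must go once around Z/k: otherwise its types lift to
   integer heights, and the product around the chain is an alternating word in
   the amalgam above.  Hence triangles lie in stars, f sends stars to stars, and
   the boundary of a 2-cell goes to the boundary of a 2-cell. *)
Require Import Defs.
From mathcomp Require Import all_boot ssralg ssrnum ssrint.
From mathcomp Require Import order intdiv zify ring.
From Stdlib Require Import Classical ClassicalEpsilon FunctionalExtensionality.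
From Stdlib Require Import PropExtensionality.
Set Implicit Arguments. Unset Strict Implicit. Unset Printing Implicit Defensive.
Import Order.TTheory GRing.Theory Num.Theory.

(* No tree is constructed. An amalgam is handled internally, as two subgroups such that no nonempty
   alternating word has its product in both ([amalg]), and each Bass-Serre fact becomes a statement
   about such words. The condition k >= 4 makes both chains x..y and y..x+k at least two steps long,
   so a_x and a_y sit on opposite sides of a splitting of each chain. That is why they generate a
   free group, the same one in both. Generators are indexed periodically by natural numbers, so that
   a chain is an honest interval, and a single splitting, taken at every x, serves all types. The
   obstacle for Theta_sigma is that an automorphism knows neither types nor arrows. It permutes
   stars, but a priori the centre of the image of K_u need not be the image of u. On the boundary of
   a 2-cell this centre is the image of u or that of the next vertex, with the same choice all
   around; the second choice is refuted by comparing two cells that share an edge. *)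
Declare Scope hig_scope.
Local Open Scope hig_scope.
Local Notation "x * y" := (gmul x y) : hig_scope.
Local Notation "x ^-1" := (ginv x) : hig_scope.
Local Notation "x ^ z" := (gpow x z) : hig_scope.

(** * Groups *)

Section GroupTheory.
Variable G : group.
Implicit Types x y z : G.

Lemma mulIl x y z : x * y = x * z -> y = z.
Proof.
move=> e; rewrite -(gmul1 y) -(gmul1 z) -(gmulV x) -!gmulA.
by rewrite e.
Qed.

Lemma mulgV x : x * x^-1 = gone.
Proof.
have e : x * x^-1 * (x * x^-1) = x * x^-1.
  by rewrite -gmulA (gmulA x^-1) gmulV gmul1.
by rewrite -{1}(gmul1 (x * x^-1)) -(gmulV (x * x^-1)) -gmulA e.
Qed.

Lemma mulg1 x : x * gone = x.
Proof. by rewrite -(gmulV x) gmulA mulgV gmul1. Qed.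

Lemma mulgK x y : x * y * y^-1 = x.
Proof. by rewrite -gmulA mulgV mulg1. Qed.

Lemma mulgKV x y : x * y^-1 * y = x.
Proof. by rewrite -gmulA gmulV mulg1. Qed.

Lemma mulIr x y z : y * x = z * x -> y = z.
Proof. by move=> e; rewrite -(mulgK y x) e mulgK. Qed.

Lemma invgK x : x^-1^-1 = x.
Proof. by apply: (@mulIr x^-1); rewrite gmulV mulgV. Qed.

Lemma invMg x y : (x * y)^-1 = y^-1 * x^-1.
Proof. by apply: (@mulIr (x * y)); rewrite gmulV !gmulA mulgKV gmulV. Qed.

Lemma invg1 : (gone : G)^-1 = gone.
Proof. by rewrite -[LHS]mulg1 gmulV. Qed.

Lemma invg_inj x y : x^-1 = y^-1 -> x = y.
Proof. by move=> e; rewrite -(invgK x) e invgK. Qed.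

Lemma eq_mulVg1 x y : x = y <-> x^-1 * y = gone.
Proof.
split=> [->|e]; first by rewrite gmulV.
by apply: (@mulIl x^-1); rewrite gmulV.
Qed.

End GroupTheory.

Ltac gsimp := rewrite ?(gmulA, gmul1, mulg1, gmulV, mulgV, mulgK, mulgKV, invMg, invgK, invg1).

Section Powers.
Variable G : group.
Implicit Types (x y : G) (i j : int).

Lemma gpow0 x : x ^ 0%R = gone. Proof. by []. Qed.

Lemma gpow_nat1 x (p : nat) : x ^ (p.+1)%:Z%R = x * x ^ p%:Z%R.
Proof. by []. Qed.

Lemma gpow_natr x (p : nat) : x ^ (p.+1)%:Z%R = x ^ p%:Z%R * x.
Proof.
elim: p => [|p IH]; first by rewrite gpow_nat1 gpow0 gmul1 mulg1.
by rewrite gpow_nat1 {1}IH gmulA -gpow_nat1.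
Qed.

Lemma gpow1 x : x ^ 1%R = x. Proof. by rewrite (gpow_nat1 x 0) gpow0 mulg1. Qed.

Lemma gpowN x i : x ^ (- i)%R = (x ^ i)^-1.
Proof.
case: i => [[|p]|p].
- by rewrite (_ : - 0%:Z = 0)%R // gpow0 invg1.
- by rewrite -NegzE.
- by rewrite [in LHS]NegzE opprK /= invgK.
Qed.

Lemma gpowS x i : x ^ (i + 1)%R = x ^ i * x.
Proof.
case: i => [p|p].
  by rewrite -gpow_natr; congr (x ^ _); lia.
rewrite NegzE gpowN gpow_nat1 invMg.
have -> : (- p.+1%:Z + 1 = - p%:Z)%R by lia.
by rewrite gpowN mulgKV.
Qed.

Lemma gpowD x i j : x ^ (i + j)%R = x ^ i * x ^ j.
Proof.
elim: j => [|p IH|p IH]; first by rewrite addr0 gpow0 mulg1.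
  have -> : (i + p.+1%:Z = (i + p%:Z) + 1)%R by lia.
  have -> : (p.+1%:Z = p%:Z + 1 :> int)%R by lia.
  by rewrite !gpowS IH gmulA.
apply: (@mulIr _ x); rewrite -gpowS.
have -> : (i - p.+1%:Z + 1 = i - p%:Z)%R by lia.
rewrite IH -gmulA -gpowS; congr (_ * x ^ _); lia.
Qed.

Lemma gpowM x i j : x ^ (i * j)%R = (x ^ i) ^ j.
Proof.
elim: j => [|p IH|p IH]; first by rewrite mulr0.
  have -> : (p.+1%:Z = p%:Z + 1 :> int)%R by lia.
  by rewrite gpowS mulrDr mulr1 gpowD IH.
rewrite !mulrN !gpowN; congr ginv; move: IH.
rewrite !mulrN !gpowN => /invg_inj IH.
have -> : (p.+1%:Z = p%:Z + 1 :> int)%R by lia.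
by rewrite gpowS mulrDr mulr1 gpowD IH.
Qed.

Lemma gpow_comm x i j : x ^ i * x ^ j = x ^ j * x ^ i.
Proof. by rewrite -!gpowD addrC. Qed.

Lemma conj_pow x y i : (x * y * x^-1) ^ i = x * y ^ i * x^-1.
Proof.
have H (p : nat) : (x * y * x^-1) ^ p%:Z%R = x * y ^ p%:Z%R * x^-1.
  elim: p => [|p IH]; first by rewrite !gpow0 mulg1 mulgV.
  by rewrite !gpow_nat1 IH; gsimp.
by case: i => p; rewrite ?NegzE ?gpowN H //; gsimp.
Qed.

End Powers.

Section Hom.
Variables (G H : group) (f : G -> H).
Hypothesis fM : is_hom f.

Lemma hom1 : f gone = gone.
Proof. by apply: (@mulIl _ (f gone)); rewrite -fM !mulg1. Qed.

Lemma homV x : f x^-1 = (f x)^-1.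
Proof. by apply: (@mulIr _ (f x)); rewrite -fM !gmulV hom1. Qed.

Lemma hom_pow x i : f (x ^ i) = f x ^ i.
Proof.
have K (p : nat) : f (x ^ p%:Z%R) = f x ^ p%:Z%R.
  by elim: p => [|p IH]; rewrite ?hom1 // !gpow_nat1 fM IH.
by case: i => p; rewrite ?NegzE ?gpowN ?homV K.
Qed.

Lemma hom_inj : (forall x, f x = gone -> x = gone) -> injective f.
Proof.
move=> K x y e; apply/eq_mulVg1/K; rewrite fM homV e; exact: gmulV.
Qed.

End Hom.

Section Generated.
Variable G : group.
Implicit Types (S T : G -> Prop) (x y : G).

Definition subgrp S := [/\ S gone, forall x y, S x -> S y -> S (x * y)
  & forall x, S x -> S x^-1].

Lemma gen_subgrp S : subgrp (gen S).
Proof. split; [exact: gen_one | exact: gen_mul | exact: gen_inv]. Qed.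

Lemma gen_min S T : subgrp T -> (forall x, S x -> T x) -> forall x, gen S x -> T x.
Proof. by case=> T1 TM TV ST x; elim => {x}; auto. Qed.

Lemma gen_sub S T : (forall x, S x -> T x) -> forall x, gen S x -> gen T x.
Proof. by move=> ST; apply: gen_min (gen_subgrp T) _ => x /ST; apply: gen_in. Qed.

Section Subgrp.
Variable S : G -> Prop.
Hypothesis sS : subgrp S.

Lemma sg1 : S gone. Proof. by case: sS. Qed.
Lemma sgM x y : S x -> S y -> S (x * y). Proof. by case: sS => _ + _; apply. Qed.
Lemma sgV x : S x -> S x^-1. Proof. by case: sS => _ _; apply. Qed.
Lemma sgVE x : S x^-1 <-> S x.
Proof. by split=> [/sgV|/sgV //]; rewrite invgK. Qed.
Lemma sgX x i : S x -> S (x ^ i).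
Proof.
move=> Sx; have K (p : nat) : S (x ^ p%:Z%R).
  by elim: p => [|p IH]; [exact: sg1 | rewrite gpow_nat1; apply: sgM].
by case: i => p; rewrite ?NegzE ?gpowN; [|apply: sgV]; apply: K.
Qed.
Lemma sgMl x y : S x -> S (x * y) <-> S y.
Proof.
move=> Sx; split=> [Sxy|]; last exact: sgM.
by have := sgM (sgV Sx) Sxy; gsimp.
Qed.
Lemma sgMr x y : S x -> S (y * x) <-> S y.
Proof.
move=> Sx; split=> [Sxy|Sy]; last exact: sgM.
by have := sgM Sxy (sgV Sx); gsimp.
Qed.
End Subgrp.

Lemma gen_cyc x y : gen (fun z => z = x) y <-> exists i, y = x ^ i.
Proof.
split; last by case=> i ->; apply: (sgX (gen_subgrp _)); apply: gen_in.
apply: (@gen_min _ (fun y => exists i, y = x ^ i)) => [|z ->]; last by exists 1%R; rewrite gpow1.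
split; first by exists 0%R.
  by move=> _ _ [i ->] [j ->]; exists (i + j)%R; rewrite gpowD.
by move=> _ [i ->]; exists (- i)%R; rewrite gpowN.
Qed.

End Generated.

Lemma gen_map (G H : group) (f : G -> H) (S : G -> Prop) : is_hom f ->
  forall y, gen (fun z => exists x, S x /\ z = f x) y <-> exists x, gen S x /\ y = f x.
Proof.
move=> fM y; split.
  have K : subgrp (fun z => exists x, gen S x /\ z = f x).
    split; first by exists gone; rewrite hom1 //; split => //; apply: gen_one.
      move=> _ _ [u [Su ->]] [v [Sv ->]]; exists (u * v); rewrite fM; split => //.
      exact: gen_mul.
    move=> _ [u [Su ->]]; exists u^-1; rewrite homV //; split => //; exact: gen_inv.
  by apply: (gen_min K) => _ [x [Sx ->]]; exists x; split => //; apply: gen_in.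
case=> x [Sx ->]; elim: Sx => {x}.
- by move=> x Sx; apply: gen_in; exists x.
- by rewrite hom1 //; apply: gen_one.
- by move=> u v _ IH _ IH'; rewrite fM; apply: gen_mul.
- by move=> u _ IH; rewrite homV //; apply: gen_inv.
Qed.

Lemma hom_gen_ext (G H : group) (f f' : G -> H) (S : G -> Prop) :
  is_hom f -> is_hom f' -> (forall x, S x -> f x = f' x) ->
  forall x, gen S x -> f x = f' x.
Proof.
move=> fM fM' ff; suff K : subgrp (fun x => f x = f' x) by apply: (gen_min K).
split; first by rewrite !hom1.
  by move=> x y Ex Ey; rewrite fM fM' Ex Ey.
by move=> x Ex; rewrite !homV // Ex.
Qed.

Lemma gpowV (G : group) (x : G) i : x^-1 ^ i = (x ^ i)^-1.
Proof. by rewrite -[in LHS](gpow1 x) -gpowN -gpowM mulN1r gpowN. Qed.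

Local Opaque gpow.

Lemma sub_eq (T : Type) (S : T -> Prop) (u v : {x | S x}) : sval u = sval v -> u = v.
Proof.
by case: u v => [x Sx] [y Sy] /= e; move: Sx; rewrite e => Sx; congr exist;
  apply: proof_irrelevance.
Qed.

(** * Permutation groups, the integers, products and subgroups *)

Section SymmetricGroup.
Variable T : Type.

(** The inverse is carried as data, so that inversion in [Sym] needs no choice; [bij_eq] shows that
    it is determined by the map. *)
Definition bij := {p : (T -> T) * (T -> T) | cancel p.1 p.2 /\ cancel p.2 p.1}.

Lemma bij_eq (p q : bij) : (sval p).1 =1 (sval q).1 -> p = q.
Proof.
case: p q => [[f f'] [/= fK f'K]] [[g g'] [/= gK g'K]] fg.
have Ef : f = g by apply: functional_extensionality.
have Eg : f' = g'.
  by apply: functional_extensionality => x; rewrite -{1}(g'K x) -fg fK.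
by move: fK f'K; rewrite Ef Eg => *; congr exist; apply: proof_irrelevance.
Qed.

Definition bij_mul (p q : bij) : bij.
Proof.
exists ((sval p).1 \o (sval q).1, (sval q).2 \o (sval p).2).
by case: p q => [? [? ?]] [? [? ?]]; split; apply: can_comp.
Defined.

Definition bij_one : bij. Proof. by exists (id, id). Defined.

Definition bij_inv (p : bij) : bij.
Proof. by exists ((sval p).2, (sval p).1); case: p => [? []]. Defined.

Definition Sym : group.
Proof.
apply: (@Defs.Group bij bij_mul bij_one bij_inv) => [p q r|p|p];
  apply: bij_eq => //= x.
by case: (svalP p) => /= + _; apply.
Defined.

Definition app (p : Sym) (x : T) : T := (sval p).1 x.

Lemma appM (p q : Sym) x : app (p * q) x = app p (app q x). Proof. by []. Qed.
Lemma app1 x : app (gone : Sym) x = x. Proof. by []. Qed.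
Lemma Sym_eq (p q : Sym) : app p =1 app q -> p = q. Proof. exact: bij_eq. Qed.

Definition mkSym (f g : T -> T) (fK : cancel f g) (gK : cancel g f) : Sym :=
  exist _ (f, g) (conj fK gK).

Lemma app_mkSym f g (fK : cancel f g) (gK : cancel g f) x :
  app (mkSym fK gK) x = f x.
Proof. by []. Qed.

Lemma appVK (p : Sym) x : app p^-1 (app p x) = x.
Proof. by rewrite -appM gmulV. Qed.

End SymmetricGroup.

Definition intG : group.
Proof.
apply: (@Defs.Group int (fun x y => (x + y)%R) 0%R (fun x => (- x)%R)).
- by move=> *; rewrite addrA.
- by move=> *; rewrite add0r.
- by move=> *; rewrite addNr.
Defined.

Lemma intG_pow (x : intG) (z : int) : x ^ z = (z * (x : int))%R.
Proof.
have H (p : nat) : x ^ p%:Z%R = (p%:Z * (x : int))%R.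
  elim: p => [|p IH]; first by rewrite gpow0 mul0r.
  by rewrite gpow_nat1 IH /= intS mulrDl mul1r.
case: z => p; first exact: H.
by rewrite NegzE gpowN H mulNr.
Qed.

Definition prodG (A B : group) : group.
Proof.
apply: (@Defs.Group (A * B)%type (fun x y => (x.1 * y.1, x.2 * y.2)) (gone, gone)
  (fun x => (x.1^-1, x.2^-1))).
- by move=> *; rewrite !gmulA.
- by move=> [x y] /=; rewrite !gmul1.
- by move=> [x y] /=; rewrite !gmulV.
Defined.

Section SubGroup.
Variables (G : group) (S : G -> Prop).
Hypothesis sS : subgrp S.

Definition subG : group.
Proof.
apply: (@Defs.Group {x | S x}
  (fun u v => exist S _ (sgM sS (svalP u) (svalP v)))
  (exist S _ (sg1 sS)) (fun u => exist S _ (sgV sS (svalP u)))) => *;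
  apply: sub_eq => /=; by gsimp.
Defined.

End SubGroup.

(** * Groups given by generators and relations *)

Section Presentation.
Variable I : Type.

Definition word := seq (I * bool).

Definition letter (H : group) (b : I -> H) (l : I * bool) : H :=
  if l.2 then b l.1 else (b l.1)^-1.

Definition weval (H : group) (b : I -> H) (w : word) : H :=
  foldr (fun l x => letter b l * x) gone w.

Definition winv (w : word) : word := rev [seq (l.1, ~~ l.2) | l <- w].

Lemma weval_cat (H : group) (b : I -> H) u v :
  weval b (u ++ v) = weval b u * weval b v.
Proof. by elim: u => [|l u IH] /=; rewrite ?gmul1 // IH gmulA. Qed.

Lemma weval_inv (H : group) (b : I -> H) w : weval b (winv w) = (weval b w)^-1.
Proof.
elim: w => [|[i s] w IH]; first by rewrite /= invg1.
rewrite /winv /= rev_cons -cats1 weval_cat -/(winv w) IH /= mulg1 invMg.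
by congr (_ * _); case: s => //=; rewrite /letter /= invgK.
Qed.

Variable rel : word -> word -> Prop.

Definition sat (H : group) (b : I -> H) :=
  forall u v, rel u v -> weval b u = weval b v.

(* Equality in every model of the relations, instead of the congruence they
   generate. *)
Definition weq (u v : word) :=
  forall (H : group) (b : I -> H), sat b -> weval b u = weval b v.

(** Classes are predicates on words, which gives [presG] the Leibniz equality that [group]
    requires. *)
Definition pcar := {Q : word -> Prop | exists w, Q = weq w}.

Definition pcls (w : word) : pcar := exist _ (weq w) (ex_intro _ w erefl).

Definition prepr (x : pcar) : word :=
  sval (constructive_indefinite_description _ (svalP x)).

Lemma pcls_eq u v : weq u v <-> pcls u = pcls v.
Proof.
split=> [e|[e] H b sb]; last first.
  have : weq v v by [].
  by rewrite -e; apply.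
have E : weq u = weq v.
  apply: functional_extensionality => w; apply: propositional_extensionality.
  by split=> e' H b sb; rewrite -e' // e.
by apply: sub_eq.
Qed.

Lemma preprK x : pcls (prepr x) = x.
Proof.
apply: sub_eq => /=; rewrite /prepr; by case: constructive_indefinite_description.
Qed.

Lemma prepr_cls w : weq (prepr (pcls w)) w.
Proof. by apply/pcls_eq; rewrite preprK. Qed.

Definition presG : group.
Proof.
apply: (@Defs.Group pcar (fun x y => pcls (prepr x ++ prepr y)) (pcls [::])
  (fun x => pcls (winv (prepr x)))).
- move=> x y z; apply/pcls_eq => H b sb.
  by rewrite !weval_cat !(prepr_cls _ sb) !weval_cat gmulA.
- move=> x; rewrite -[RHS]preprK; apply/pcls_eq => H b sb.
  by rewrite !weval_cat !(prepr_cls _ sb) /= gmul1.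
- move=> x; apply/pcls_eq => H b sb.
  by rewrite !weval_cat !(prepr_cls _ sb) weval_inv gmulV.
Defined.

Definition pgen (i : I) : presG := pcls [:: (i, true)].

Definition plift (H : group) (b : I -> H) (x : presG) : H := weval b (prepr x).

Section Lift.
Variables (H : group) (b : I -> H).
Hypothesis sb : sat b.

Lemma plift_hom : is_hom (plift b).
Proof. by move=> x y; rewrite /plift (prepr_cls _ sb) weval_cat. Qed.

Lemma plift_gen i : plift b (pgen i) = b i.
Proof. by rewrite /plift (prepr_cls _ sb) /= mulg1. Qed.

End Lift.

Lemma weval_pgen w : weval pgen w = pcls w.
Proof.
elim: w => [|[i s] w IH] //=.
rewrite IH; apply/pcls_eq => H b sb; rewrite weval_cat (prepr_cls _ sb).
rewrite -/(cat [:: (i, s)] w) weval_cat; congr (_ * _) => /=.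
case: s; rewrite /letter /= ?mulg1 (prepr_cls _ sb) /= ?mulg1 //.
by rewrite weval_inv (prepr_cls _ sb) /= mulg1.
Qed.

Lemma sat_pgen : sat pgen.
Proof. by move=> u v uv; rewrite !weval_pgen; apply/pcls_eq => H b; apply. Qed.

Lemma pres_gen x : gen (fun y => exists i, y = pgen i) x.
Proof.
rewrite -(preprK x) -weval_pgen; elim: (prepr x) => [|[i s] w IH] /=.
  exact: gen_one.
apply: gen_mul => //; rewrite /letter /=.
by case: s; [|apply: gen_inv]; apply: gen_in; exists i.
Qed.

End Presentation.

(** * Baumslag-Solitar groups *)

Section BaumslagSolitarStates.
Variables m n : int.
Hypotheses (m0 : m != 0%R) (n0 : n != 0%R).

(** The step in the exponent of a that a letter lets through: t a^m = a^n t and t^-1 a^n = a^m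
    t^-1. *)
Definition mo (e : bool) := if e then m else n.

Lemma mo0 e : mo e != 0%R. Proof. by case: e. Qed.

Definition bsletter := (bool * int)%type.

Definition headis (e : bool) (L : seq bsletter) : bool :=
  if L is (e', _) :: _ then e' == e else true.

(* A state (y, [:: (e1, r1); ...]) is the Britton normal form
   a^y t^(+-1) a^r1 t^(+-1) ..., with e = true for t and e = false for t^-1. *)
Fixpoint bsvalid (L : seq bsletter) : bool :=
  if L is (e, r) :: L' then
    [&& r == (r %% mo e)%Z,
        (if L' is (e', _) :: _ then (r != 0%R) || (e' == e) else true) & bsvalid L']
  else true.

(** Left multiplication by t^(+-1) on normal forms. The letter passes the multiple of [mo e]
    contained in y and keeps the remainder r behind it; if r = 0 and the next letter is the opposite
    one, the two cancel and the exponents of a merge. *)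
Definition bspush (e : bool) (s : int * seq bsletter) : int * seq bsletter :=
  let: (y, L) := s in
  let q := (mo (~~ e) * (y %/ mo e)%Z)%R in
  let r := (y %% mo e)%Z in
  if L is (e', r') :: L' then
    if (e' == ~~ e) && (r == 0%R) then ((q + r')%R, L') else (q, (e, r) :: L)
  else (q, (e, r) :: L).

Lemma bspush_valid e s : bsvalid s.2 -> bsvalid (bspush e s).2.
Proof.
case: s => y [|[e' r'] L] /=; first by rewrite modz_mod eqxx.
case/and3P=> r'E h vL; case: ifP => //= he.
rewrite modz_mod eqxx r'E h vL !andbT /=.
by move/negbT: he; rewrite negb_and orbC; case: e e' {r'E h} => [] [].
Qed.

Lemma bspushK e s : bsvalid s.2 -> bspush (~~ e) (bspush e s) = s.
Proof.
have D q : ((mo (~~ e) * q)%R %% mo (~~ e))%Z = 0%R by rewrite modzMr.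
have Q q : ((mo (~~ e) * q)%R %/ mo (~~ e))%Z = q by rewrite mulKz ?mo0.
case: s => y [|[e' r'] L] /=.
  by rewrite D Q !negbK !eqxx /= mulrC -divz_eq.
case/and3P=> /eqP r'E h vL; case: ifP => [/andP[/eqP e'E /eqP yE]|he] /=; last first.
  by rewrite D Q !negbK !eqxx /= mulrC -divz_eq.
subst e'; set q := (y %/ mo e)%Z.
have D' : ((mo (~~ e) * q + r')%R %% mo (~~ e))%Z = r' by rewrite mulrC modzMDl -r'E.
have Q' : ((mo (~~ e) * q + r')%R %/ mo (~~ e))%Z = q.
  rewrite mulrC divzMDl ?mo0 // divz_small ?addr0 // r'E modz_ge0 ?mo0 //=.
  by rewrite ltz_mod ?mo0.
rewrite D' Q' negbK /q {D' Q' q}.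
have -> : (mo e * (y %/ mo e)%Z)%R = y.
  by rewrite {2}(divz_eq y (mo e)) yE addr0 mulrC.
case: L h vL => [|[e'' r''] L] //= h vL.
case: ifP => // /andP[/eqP e''E /eqP r0]; move: h; rewrite r0 eqxx /= e''E.
by case: e {D Q r'E yE e''E}.
Qed.

(** The defining relation read on states; [bs_rel] is the case [e = true], [z = 1]. *)
Lemma bspush_shift e y z L :
  bspush e ((y + mo e * z)%R, L) = (((bspush e (y, L)).1 + mo (~~ e) * z)%R, (bspush e (y, L)).2).
Proof.
have E1 : (((y + mo e * z)%R %/ mo e)%Z = (y %/ mo e)%Z + z)%R.
  by rewrite mulrC addrC divzMDl ?mo0 // addrC.
have E2 : ((y + mo e * z)%R %% mo e)%Z = (y %% mo e)%Z by rewrite mulrC addrC modzMDl.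
rewrite /= E1 E2; case: L => [|[e' r'] L]; rewrite /= ?mulrDr //.
by case: ifP => //=; rewrite addrAC.
Qed.

Definition bsstate := {s : int * seq bsletter | bsvalid s.2}.

Definition bsst y L (vL : bsvalid L) : bsstate :=
  exist (fun s : int * seq bsletter => bsvalid s.2) (y, L) vL.

Definition bsP e (s : bsstate) : bsstate :=
  exist (fun s : int * seq bsletter => bsvalid s.2) _ (bspush_valid e (svalP s)).

Lemma bsPK e : cancel (bsP e) (bsP (~~ e)).
Proof. by move=> s; apply: val_inj; rewrite /= bspushK //; case: s. Qed.

Definition bsT : Sym bsstate := mkSym (bsPK true) (bsPK false).

Definition bsA_fun z (s : bsstate) : bsstate := bsst ((sval s).1 + z)%R (svalP s).

Lemma bsA_funK z : cancel (bsA_fun z) (bsA_fun (- z)%R).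
Proof. by case=> [[y L] vL]; apply: val_inj; rewrite /= addrK. Qed.

Lemma bsA_funVK z : cancel (bsA_fun (- z)%R) (bsA_fun z).
Proof. by case=> [[y L] vL]; apply: val_inj; rewrite /= addrNK. Qed.

Definition bsA : Sym bsstate := mkSym (bsA_funK 1%R) (bsA_funVK 1%R).

Lemma bsA_pow z s : app (bsA ^ z) s = bsA_fun z s.
Proof.
have H p s' : app (bsA ^ p%:Z%R) s' = bsA_fun p%:Z s'.
  elim: p s' => [|p IH] s'; apply: val_inj.
    by rewrite /= addr0; case: s' => [[]].
  rewrite gpow_nat1 appM IH app_mkSym /=; congr pair; lia.
case: z => p; first exact: H.
rewrite NegzE gpowN; rewrite -[in LHS](bsA_funVK p.+1%:Z s) -H appVK.
by [].
Qed.

Lemma bs_rel : bsT * bsA ^ m * bsT^-1 = bsA ^ n.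
Proof.
apply: (@mulIr _ bsT); rewrite mulgKV; apply: Sym_eq => s.
rewrite !appM !bsA_pow; apply: val_inj; case: s => [[y L] vL].
have := bspush_shift true y 1 L; rewrite !mulr1 => E.
exact: E.
Qed.

End BaumslagSolitarStates.

Definition is_BS (m n : int) (P : group) (t a : P) :=
  [/\ t * a ^ m * t^-1 = a ^ n,
      forall x, gen (fun y => y = t \/ y = a) x &
      forall (H : group) (t' a' : H), t' * a' ^ m * t'^-1 = a' ^ n ->
        exists f : P -> H, [/\ is_hom f, f t = t' & f a = a']].

(** Comparing prefixes, M begins with p copies of z, and removing them leaves the same equation for
    a shorter M. Applied to reversed normal forms in [bs_centraliser]. *)
Lemma nseq_cat_periodic (T : eqType) (z : T) p (M R : seq T) : 0 < p ->
  nseq p z ++ M = M ++ R -> all (pred1 z) M.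
Proof.
move=> p0; have [N] := ubnP (size M); elim: N M => // N IH M lM E.
have [sM|sM] := leqP (size M) p.
  have : take (size M) (nseq p z ++ M) = M by rewrite E take_size_cat.
  rewrite takel_cat ?size_nseq // take_nseq // => <-.
  by apply/all_pred1P; rewrite size_nseq.
have EM : M = nseq p z ++ drop p M.
  rewrite -{1}(cat_take_drop p M); congr (_ ++ _).
  have : take p (nseq p z ++ M) = take p (M ++ R) by rewrite E.
  by rewrite take_size_cat ?size_nseq // takel_cat // ltnW.
rewrite EM all_cat; apply/andP; split; first by apply/all_pred1P; rewrite size_nseq.
apply: IH; first by rewrite size_drop; lia.
by move: E; rewrite {1 2}EM -!catA => /(congr1 (drop p)); rewrite !drop_size_cat ?size_nseq // {1}EM.
Qed.

Section BaumslagSolitar.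
Variables (m n : int) (P : group) (t a : P).
Hypotheses (m0 : m != 0%R) (n0 : n != 0%R).
Hypothesis bsP : is_BS m n t a.
Local Notation mo := (mo m n).

Definition te (e : bool) := if e then t else t^-1.

Lemma teV e : te (~~ e) = (te e)^-1.
Proof. by case: e; rewrite //= invgK. Qed.

Lemma te_rel e z : te e * a ^ (mo e * z)%R = a ^ (mo (~~ e) * z)%R * te e.
Proof.
case: bsP => R _ _; have R' : t * a ^ (m * z)%R * t^-1 = a ^ (n * z)%R.
  by rewrite !gpowM -R conj_pow.
case: e => /=; first by rewrite -R'; gsimp.
by rewrite -R'; gsimp.
Qed.

Lemma te_conj e z : te e * a ^ (mo e * z)%R * (te e)^-1 = a ^ (mo (~~ e) * z)%R.
Proof. by rewrite te_rel mulgK. Qed.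

Lemma bs_exponent : exists f : P -> intG, [/\ is_hom f, f t = 1%R & f a = 0%R].
Proof.
case: bsP => _ _; apply; rewrite !intG_pow; change ((1 + (m * 0)%R + - 1)%R = (n * 0)%R); lia.
Qed.

Lemma bs_action : exists f : P -> Sym (bsstate m n),
  [/\ is_hom f, f t = bsT m0 n0 & f a = bsA m n].
Proof. by case: bsP => _ _; apply; apply: bs_rel. Qed.

Definition bsnf (s : int * seq bsletter) : P :=
  a ^ s.1 * foldr (fun l x => te l.1 * a ^ l.2 * x) gone s.2.

Lemma bsnf_push e s : bsnf (bspush m n e s) = te e * bsnf s.
Proof.
have H y : te e * a ^ y = a ^ (mo (~~ e) * (y %/ mo e)%Z)%R * te e * a ^ (y %% mo e)%Z.
  by rewrite -te_rel -gmulA -gpowD; congr (_ * _ ^ _); rewrite mulrC -divz_eq.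
case: s => y [|[e' r'] L]; rewrite /bsnf /= !gmulA ?H //.
case: ifP => [/andP[/eqP -> /eqP r0]|_] /=; rewrite ?gmulA ?H //.
by rewrite r0 gpow0 mulg1 teV mulgK gpowD.
Qed.

Lemma bsnf_ex x : exists y L, bsvalid m n L /\ x = bsnf (y, L).
Proof.
pose Q x := exists y L, bsvalid m n L /\ x = bsnf (y, L).
suff K g : gen (fun y => y = t \/ y = a) g ->
    forall x, (Q x -> Q (g * x)) /\ (Q x -> Q (g^-1 * x)).
  case: bsP => _ /(_ x) Gx _; have [+ _] := K _ Gx gone; rewrite mulg1; apply.
  by exists 0%R, [::]; split => //; rewrite /bsnf /= gmul1.
have Qt e z : Q z -> Q (te e * z).
  case=> y [L [vL ->]]; rewrite -bsnf_push.
  have := @bspush_valid m n e (y, L) vL; case: (bspush _ _ _ _) => y' L' vL'.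
  by exists y', L'.
have Qa i z : Q z -> Q (a ^ i * z).
  by case=> y [L [vL ->]]; exists (i + y)%R, L; split=> //; rewrite /bsnf /= gpowD !gmulA.
elim=> {g} [g [] ->| |g h _ IHg _ IHh|g _ IHg] z.
- by split; [apply: (Qt true)|apply: (Qt false)].
- by split; [have := Qa 1%R z | have := Qa (- 1)%R z]; rewrite ?gpowN gpow1.
- by rewrite invg1 gmul1.
- split=> Qz; rewrite ?invMg -gmulA.
    by apply: (IHg _).1; apply: (IHh _).1.
  by apply: (IHh _).2; apply: (IHg _).2.
- by rewrite invgK; have [] := IHg z.
Qed.

Lemma bs_torsionfree y : a ^ y = gone -> y = 0%R.
Proof.
have [f [fM ft fa]] := bs_action => /(congr1 f); rewrite (hom_pow fM) (hom1 fM) fa.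
move/(congr1 (fun p => app p (@bsst m n 0%R [::] isT))).
by rewrite bsA_pow // => /(congr1 (fun s => (sval s).1)) /=; rewrite add0r.
Qed.

Lemma bs_pow_inj y w : a ^ y = a ^ w -> y = w.
Proof.
move=> E; apply/eqP; rewrite -subr_eq0; apply/eqP/bs_torsionfree.
by rewrite gpowD gpowN E mulgV.
Qed.

Lemma te_action (f : P -> Sym (bsstate m n)) e s : is_hom f -> f t = bsT m0 n0 ->
  sval (app (f (te e)) s) = bspush m n e (sval s).
Proof. by move=> fM ft; case: e; rewrite /= ?(homV fM) ft. Qed.

Lemma te_pow_action (f : P -> Sym (bsstate m n)) (e : bool) p L (vL : bsvalid m n L) :
  is_hom f -> f t = bsT m0 n0 ->
  headis e L ->
  sval (app (f (te e ^ p%:Z%R)) (bsst 0%R vL)) = (0%R, nseq p (e, 0%R) ++ L).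
Proof.
move=> fM ft hL; elim: p => [|p IH]; first by rewrite gpow0 (hom1 fM) app1.
rewrite gpow_nat1 fM appM te_action // IH.
case: p {IH} => [|p] /=; rewrite ?div0z ?mod0z ?mulr0; last first.
  by case: e {hL} => /=.
by case: L vL hL => [|[e' r'] L] //= _ /eqP ->; case: e.
Qed.

Lemma te_pow_push (f : P -> Sym (bsstate m n)) (e : bool) p (s : bsstate m n) : is_hom f -> f t = bsT m0 n0 ->
  headis e (sval s).2 ->
  size (sval (app (f (te e ^ p%:Z%R)) s)).2 = p + size (sval s).2 /\
  headis e (sval (app (f (te e ^ p%:Z%R)) s)).2.
Proof.
move=> fM ft hs; elim: p => [|p [sz hd]]; first by rewrite gpow0 (hom1 fM) app1.
rewrite gpow_nat1 fM appM te_action //.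
move: sz hd; case: (sval _) => y [|[e' r'] L] /= sz hd.
  by rewrite eqxx addSn -sz.
rewrite (eqP hd) (_ : (e == ~~ e) = false) /=; last by case: (e).
by rewrite /= eqxx addSn -sz.
Qed.

Lemma te_powV e p : (te e ^ p)^-1 = te (~~ e) ^ p.
Proof. by rewrite teV gpowV. Qed.

(** Acting on the base state, the inverse power creates p+1 letters. The remainder of y modulo
    [mo e] is nonzero, so the next letter cannot cancel and all later ones pile up on it, whereas a
    power of a leaves the list empty. *)
Lemma bs_no_return e p y w : ~~ (mo e %| y)%Z ->
  te e ^ p.+1%:Z%R * a ^ y * (te e ^ p.+1%:Z%R)^-1 <> a ^ w.
Proof.
move=> ndvd; have [f [fM ft fa]] := bs_action.
pose o := @bsst m n 0%R [::] isT.
move/(congr1 (fun x => size (sval (app (f x) o)).2)).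
rewrite te_powV (gpow_natr (te e)) fM (fM (_ * _)) (fM (_ ^ p)) 3!appM [in RHS](hom_pow fM) fa bsA_pow //=.
set s := app (f (a ^ y)) _.
have r0 : ((y %% mo e)%Z == 0%R) = false.
  by apply/eqP => /dvdz_mod0P; rewrite (negPf ndvd).
have [L sE] : exists L, sval s = (y, (~~ e, 0%R) :: L).
  exists (nseq p (~~ e, 0%R)); rewrite /s [f (a ^ y)](hom_pow fM) fa bsA_pow //=.
  by rewrite (@te_pow_action f (~~ e) p.+1 [::] isT) //= add0r cats0.
have [] := @te_pow_push f e p (app (f (te e)) s) fM ft.
  by rewrite te_action // sE /= r0 andbF /=.
rewrite te_action // sE /= => -> _.
by rewrite r0 andbF /= addnS.
Qed.

Lemma bs_step e p y w :
  te e ^ p.+1%:Z%R * a ^ y * (te e ^ p.+1%:Z%R)^-1 = a ^ w ->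
  exists q, y = (mo e * q)%R /\
    te e ^ p%:Z%R * a ^ (mo (~~ e) * q)%R * (te e ^ p%:Z%R)^-1 = a ^ w.
Proof.
move=> E; have [|/bs_no_return/(_ E)//] := boolP (mo e %| y)%Z.
case/dvdzP=> q yE; exists q; split; first by rewrite yE mulrC.
by rewrite -te_conj -E yE (mulrC q) gpow_natr; gsimp.
Qed.

Definition bscommens (e : bool) (p : nat) (y : int) :=
  exists w, te e ^ p%:Z%R * a ^ y * (te e ^ p%:Z%R)^-1 = a ^ w.

Lemma bscommens_le e p q y : q <= p -> bscommens e p y -> bscommens e q y.
Proof.
elim: q p y => [|q IH] [|p] y //; first by exists y; rewrite gpow0 gmul1 invg1 mulg1.
rewrite ltnS => qp [w /bs_step[z [-> E]]].
have [|w' E'] := IH p (mo (~~ e) * z)%R qp; first by exists w.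
by exists w'; rewrite gpow_natr -E' -te_conj; gsimp.
Qed.

Lemma bscommens_dvd e y : bscommens e 1 y <-> (mo e %| y)%Z.
Proof.
split=> [[w /(@bs_step e 0)[q [-> _]]]|/dvdzP[q ->]]; first by rewrite dvdz_mulr.
by exists (mo (~~ e) * q)%R; rewrite gpow1 mulrC te_conj.
Qed.

(** The cyclic group of a is commensurated by the whole group: this holds for t and passes to
    products and inverses. *)
Lemma bs_commens_conj g : exists y w,
  [/\ y != 0%R, w != 0%R & g * a ^ y * g^-1 = a ^ w].
Proof.
case: bsP => _ /(_ g) Gg _; elim: Gg => {g} [g [] ->| |g h _ IHg _ IHh|g _ IHg].
- by exists m, n; split=> //; have := @te_conj true 1%R; rewrite !mulr1.
- by exists 1%R, 1%R; split => //; rewrite gpow1 mulgK.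
- by exists 1%R, 1%R; split => //; rewrite invg1 gmul1 mulg1.
- have [y [w [y0 w0 E]]] := IHg; have [z [x [z0 x0 F]]] := IHh.
  (* h carries a^z to a^x and g carries a^y to a^w, so g h carries a^(zy) through a^(xy) to
     a^(wx). *)
  exists (z * y)%R, (w * x)%R; rewrite !mulf_neq0 //; split => //.
  have -> : g * h * a ^ (z * y)%R * (g * h)^-1 = g * (h * a ^ z * h^-1) ^ y * g^-1.
    by rewrite conj_pow gpowM; gsimp.
  by rewrite F -gpowM (mulrC x) [in RHS]gpowM -E conj_pow -gpowM.
- have [y [w [y0 w0 E]]] := IHg; exists w, y; split => //.
  by rewrite -E; gsimp.
Qed.

Lemma bs_pow_exponents i j y w : t ^ i * a ^ y * t ^ j = a ^ w -> j = (- i)%R.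
Proof.
have [f [fM ft fa]] := bs_exponent => /(congr1 f).
rewrite fM (fM (t ^ i)) !(hom_pow fM) ft fa !intG_pow.
change ((i * 1 + y * 0 + j * 1 = w * 0)%R -> j = (- i)%R); lia.
Qed.

Lemma bs_conj_pow g i y : g * t ^ i * g^-1 = a ^ y -> i = 0%R.
Proof.
have [f [fM ft fa]] := bs_exponent => /(congr1 f).
rewrite fM (fM g) (homV fM) !(hom_pow fM) ft fa !intG_pow.
change ((f g + i * 1 + - f g = y * 0)%R -> i = 0%R); lia.
Qed.

Lemma bs_pow_eq i y : t ^ i = a ^ y -> i = 0%R /\ y = 0%R.
Proof.
move=> E; have i0 : i = 0%R by apply: (@bs_conj_pow gone i y); rewrite gmul1 invg1 mulg1.
by split => //; apply: bs_torsionfree; rewrite -E i0.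
Qed.

Section Expanding.
Hypothesis mn : `|m| < `|n|.

(** Each conjugation by t turns an exponent m q into n q with q nonzero, and |n q| exceeds |m q| by
    at least one. *)
Lemma bs_growth p y w : te true ^ p%:Z%R * a ^ y * (te true ^ p%:Z%R)^-1 = a ^ w ->
  y != 0%R -> `|y| + p <= `|w|.
Proof.
elim: p y => [|p IH] y.
  by rewrite gpow0 gmul1 invg1 mulg1 => /bs_pow_inj -> _; rewrite addn0.
case/bs_step=> q [-> /IH{}IH]; rewrite /mo mulf_eq0 negb_or => /andP[_ q0].
have nq : (n * q)%R != 0%R by rewrite mulf_neq0.
have := IH nq; rewrite !abszM; have : 0 < `|q| by rewrite absz_gt0.
move: mn; move: `|m| `|n| `|q| `|w| => m' n' q' w'; nia.
Qed.

Lemma bs_shrink p y w : te false ^ p%:Z%R * a ^ y * (te false ^ p%:Z%R)^-1 = a ^ w ->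
  y != 0%R -> p < `|y|.
Proof.
move=> E y0; have F : te true ^ p%:Z%R * a ^ w * (te true ^ p%:Z%R)^-1 = a ^ y.
  by rewrite -E -[te false]/(te (~~ true)) -te_powV; gsimp.
have w0 : w != 0%R.
  apply/eqP => w0; move: F; rewrite w0 gpow0 mulg1 mulgV => /esym/bs_torsionfree.
  by apply/eqP.
have := bs_growth F w0; have : 0 < `|w| by rewrite absz_gt0.
lia.
Qed.

(** Write m = m' d and n = n' d with d the gcd. The exponent m'^(p+1) d survives p+1 conjugations by
    t. A conjugation by t^-1 would need n' to divide m'^(p+1), hence |n'| = 1 by coprimality,
    against |m| < |n|. This asymmetry is what orients the powers of t. *)
Lemma bs_commens_pos p : exists y, bscommens true p.+1 y /\ ~ bscommens false 1 y.
Proof.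
pose d := gcdn `|m| `|n|; have d0 : 0 < d by rewrite gcdn_gt0 absz_gt0 m0.
have dvm : (d %| m)%Z by rewrite dvdzE /= /d dvdn_gcdl.
have dvn : (d %| n)%Z by rewrite dvdzE /= /d dvdn_gcdr.
case/dvdzP: dvm => m' mE; case/dvdzP: dvn => n' nE.
have cop : coprime `|m'| `|n'|.
  have : gcdn `|m| `|n| = d by [].
  rewrite mE nE !abszM /= -muln_gcdl -{2}(mul1n d) => /eqP.
  by rewrite eqn_pmul2r.
exists (m' ^+ p.+1 * d%:Z)%R; split.
  have H q z : te true ^ q%:Z%R * a ^ (m' ^+ q * d%:Z * z)%R * (te true ^ q%:Z%R)^-1
      = a ^ (n' ^+ q * d%:Z * z)%R.
    elim: q z => [|q IH] z; first by rewrite gpow0 gmul1 invg1 mulg1 !expr0.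
    rewrite gpow_natr invMg !gmulA -2!(gmulA (te true ^ q%:Z%R)).
    have -> : (m' ^+ q.+1 * d%:Z * z = m * (m' ^+ q * z))%R by rewrite mE exprS; ring.
    rewrite (te_conj true) /=.
    have -> : (n * (m' ^+ q * z) = m' ^+ q * d%:Z * (n' * z))%R by rewrite nE; ring.
    by rewrite IH; congr (a ^ _); rewrite exprS; ring.
  by exists (n' ^+ p.+1 * d%:Z)%R; have := H p.+1 1%R; rewrite !mulr1.
rewrite bscommens_dvd // /mo nE dvdzE !abszM /= dvdn_pmul2r // abszX.
rewrite -(mul1n (_ ^ _)%N) Gauss_dvdl ?coprimeXr 1?coprime_sym // dvdn1 => /eqP n1.
by move: mn; rewrite mE nE !abszM n1 /=; have : 0 < `|m'|; [move: m0; rewrite mE; lia|nia].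
Qed.

Lemma te_pow_prefix (f : P -> Sym (bsstate m n)) (e : bool) p (s : bsstate m n) :
  is_hom f -> f t = bsT m0 n0 ->
  let L' := (sval (app (f (te e ^ p%:Z%R)) s)).2 in
  size L' <= p + size (sval s).2 /\
  (size L' = p + size (sval s).2 -> exists R, size R = p /\ L' = R ++ (sval s).2).
Proof.
move=> fM ft /=; elim: p => [|p [sz IH]].
  by rewrite gpow0 (hom1 fM) app1; split => // _; exists [::].
rewrite gpow_nat1 fM appM te_action //.
move: sz IH; case: (sval (app _ _)) => y L sz IH.
have H : (exists l, (bspush m n e (y, L)).2 = l :: L) \/
    size (bspush m n e (y, L)).2 < size L.
  rewrite /=; case: L {sz IH} => [|[e' r'] L]; first by left; eexists.
  by case: ifP => _ /=; [right|left; eexists].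
case: H => [[l E]|lt].
  rewrite E addSn ltnS; split=> // -[/IH[R [sR LE]]].
  by exists (l :: R); rewrite /= sR; split; rewrite // -[L]/((y, L).2) LE.
rewrite /= in sz; split=> [|E]; [|exfalso]; lia.
Qed.

Lemma bsnf_cat y L M : bsnf (y, L ++ M) = bsnf (y, L) * bsnf (0%R, M).
Proof.
rewrite /bsnf /= gpow0 gmul1 -gmulA; congr (_ * _).
by elim: L => [|l L IH] /=; rewrite ?gmul1 // IH !gmulA.
Qed.

Lemma bsnf_action (f : P -> Sym (bsstate m n)) y L (vL : bsvalid m n L) :
  is_hom f -> f t = bsT m0 n0 -> f a = bsA m n ->
  forall M (vM : bsvalid m n M), bsvalid m n (L ++ M) ->
  sval (app (f (bsnf (y, L))) (bsst 0%R vM)) = (y, L ++ M).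
Proof.
move=> fM ft fa M vM; rewrite /bsnf fM appM (hom_pow fM) fa bsA_pow // => vLM.
rewrite [(y, L).2]/=; set s := app _ _.
suff E : sval s = (0%R, L ++ M) by rewrite /bsA_fun /= E /= add0r.
rewrite /s {s}; elim: L vL vLM => [|[e r] L IH] /=; first by rewrite hom1.
case/and3P=> /eqP rE _ vL /and3P[_ h vLM].
rewrite fM (fM (te e)) !appM te_action // (hom_pow fM) fa bsA_pow //= IH // add0r.
have q0 : (r %/ mo e)%Z = 0%R.
  by rewrite divz_small // rE modz_ge0 ?mo0 //= ltz_mod ?mo0.
rewrite q0 mulr0 -rE; case: (L ++ M) h => [|[e' r'] L'] //= h.
by case: ifP => // /andP[/eqP e'E r0]; move: h; rewrite r0 e'E; case: (e).
Qed.

(** Write g = a^y L in normal form without trailing t^-1. Then g t^(p+1) has the normal form a^y L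
    t^(p+1), while t^(p+1) g puts at most p+1 letters in front of L. Equality makes L a power of t;
    then a^y commutes with t^(p+1), which growth allows only for y = 0. *)
Lemma bs_centraliser p g : g * t ^ p.+1%:Z%R = t ^ p.+1%:Z%R * g ->
  exists i, g = t ^ i.
Proof.
have [y [L [vL gE]]] := bsnf_ex g.
have [N] := ubnP (size L); elim: N g y L vL gE => // N IH g y L vL gE sN C.
have [E|ne] : (exists L0, L = rcons L0 (false, 0%R)) \/ last (true, 0%R) L != (false, 0%R).
- by case/lastP: (L) => [|L0 l]; [right|rewrite last_rcons; have [->|] := eqVneq l (false, 0%R);
    [left; exists L0|right]].
(* A trailing t^-1 is removed by passing to g t, which still commutes with the power of t. *)
- case: E => L0 LE; have gtE : g * t = bsnf (y, L0).
    rewrite gE LE -cats1 bsnf_cat {2}/bsnf /= gpow0 gmul1 !mulg1 mulgKV //.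
  have vL0 : bsvalid m n L0.
    move: vL; rewrite LE; elim: (L0) => [|[e r] L1 IH1] //= /and3P[-> h /IH1 ->].
    by rewrite andbT /=; case: (L1) h.
  have sL0 : size L0 < N by move: sN; rewrite LE size_rcons ltnS.
  have [|i gi] := IH (g * t) y L0 vL0 gtE sL0.
    rewrite -gmulA -gpow_nat1 gpow_natr gmulA C gpow_natr.
    by rewrite -!gmulA; congr (_ * _); rewrite !gmulA.
  by exists (i - 1)%R; rewrite gpowD gpowN gpow1 -gi mulgK.
have [f [fM ft fa]] := bs_action.
pose Z := nseq p.+1 (true, 0%R : int).
have vZ : bsvalid m n Z.
  rewrite /Z; elim: (p.+1) => //= q ->; rewrite mod0z eqxx andbT /=.
  by case: q => //= q; rewrite eqxx orbT.
have vLZ : bsvalid m n (L ++ Z).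
  move: vL ne; elim: (L) => [|[e r] L1 IH1] //= /and3P[-> h vL1].
  case: L1 h vL1 IH1 => [|l1 L1] /= h vL1 IH1 ne.
    by move: vZ; rewrite /Z /= => ->; rewrite andbT; move: ne; rewrite xpair_eqE negb_and; case: (e); rewrite ?orbT ?orbF.
  by rewrite h IH1.
have E0 : sval (app (f (t ^ p.+1%:Z%R)) (@bsst m n 0%R [::] isT)) = (0%R, Z).
  by have := @te_pow_action f true p.+1 [::] isT fM ft isT; rewrite cats0.
have E1 : sval (app (f (g * t ^ p.+1%:Z%R)) (@bsst m n 0%R [::] isT)) = (y, L ++ Z).
  rewrite fM appM; rewrite (_ : app (f (t ^ _)) _ = bsst 0%R vZ); last exact: val_inj.
  by rewrite gE bsnf_action.
have E2 : sval (app (f g) (@bsst m n 0%R [::] isT)) = (y, L).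
  by rewrite gE bsnf_action ?cats0.
have [_] := @te_pow_prefix f true p.+1 (app (f g) (@bsst m n 0%R [::] isT)) fM ft.
rewrite -[app _ _]/(app (f (t ^ p.+1%:Z%R) * f g) _) -fM -C E1 E2 /= size_cat size_nseq addnC.
case=> // R [sR LZ].
have LE : L = nseq (size L) (true, 0%R).
  have : rev (L ++ Z) = rev (R ++ L) by rewrite LZ.
  rewrite !rev_cat /Z rev_nseq => /(nseq_cat_periodic (ltn0Sn p)).
  by rewrite all_rev => /all_pred1P.
have gE' : g = a ^ y * t ^ (size L)%:Z%R.
  rewrite gE /bsnf /= LE size_nseq; congr (_ * _); elim: (size L) => [|q IHq] //=.
  by rewrite IHq gpow_nat1 gpow0 mulg1.
suff y0 : y = 0%R by exists (size L)%:Z%R; rewrite gE' y0 gpow0 gmul1.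
have E : te true ^ p.+1%:Z%R * a ^ y * (te true ^ p.+1%:Z%R)^-1 = a ^ y.
  apply: (@mulIr _ (t ^ p.+1%:Z%R)); rewrite mulgKV.
  have H (u v b h : P) : h = b * v -> h * u = u * h -> u * v = v * u -> u * b = b * u.
    by move=> hE hu uv; apply: (@mulIr _ v); rewrite -gmulA -hE -hu hE -!gmulA uv.
  exact: H gE' C (gpow_comm _ _ _).
by apply/eqP; apply: contraT => y0; have := bs_growth E y0; lia.
Qed.

Lemma bs_malnormal g i j : i != 0%R -> g * t ^ i * g^-1 = t ^ j -> exists z, g = t ^ z.
Proof.
move=> i0 E; have ij : i = j.
  have [f [fM ft fa]] := bs_exponent; move: E => /(congr1 f).
  rewrite fM (fM g) (homV fM) !(hom_pow fM) ft !intG_pow.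
  change ((f g + i * 1 + - f g = j * 1)%R -> i = j); lia.
have C : g * t ^ i = t ^ i * g by rewrite {2}ij -E mulgKV.
case: i => [[|p]|p] // in i0 C {E ij} *; first exact: bs_centraliser C.
apply: (@bs_centraliser p g); move: C; rewrite NegzE gpowN => C.
apply: (@mulIr _ (t ^ p.+1%:Z%R)^-1); rewrite mulgK -gmulA C.
by rewrite gmulA mulgV gmul1.
Qed.

End Expanding.

End BaumslagSolitar.

(** * Amalgamated products *)

Section Transversal.
Variables (A C : group) (j : C -> A).
Hypotheses (jM : is_hom j) (jI : injective j).

Definition imj (x : A) := exists c, x = j c.

(** The choice is made from the predicate that describes the coset j(C) x. Equal cosets give
    extensionally equal predicates, hence the same representative ([repM]). *)
Definition rep (x : A) : A :=
  if excluded_middle_informative (imj x) then gone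
  else epsilon (inhabits gone) (fun y => exists c, x = j c * y).

Definition cpart (x : A) : C := epsilon (inhabits gone) (fun c => x = j c * rep x).

Lemma cpartE x : x = j (cpart x) * rep x.
Proof.
apply: (epsilon_spec (inhabits (gone : C)) (fun c => x = j c * rep x)).
rewrite /rep; case: excluded_middle_informative => [[c xE]|_] /=.
  by exists c; rewrite mulg1.
apply: (epsilon_spec (inhabits (gone : A)) (fun y => exists c, x = j c * y)).
by exists x, gone; rewrite (hom1 jM) gmul1.
Qed.

Lemma imjM c x : imj (j c * x) <-> imj x.
Proof.
split=> [] [d E]; last by exists (c * d); rewrite jM E.
by exists (c^-1 * d); rewrite jM (homV jM) -E; gsimp.
Qed.

Lemma rep_imj x : imj x -> rep x = gone.
Proof. by rewrite /rep; case: excluded_middle_informative. Qed.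

Lemma repM c x : rep (j c * x) = rep x.
Proof.
rewrite /rep; case: excluded_middle_informative => h;
  case: excluded_middle_informative => h' //=.
- by case: h'; apply: (imjM c x).1.
- by case: h; apply: (imjM c x).2.
congr (epsilon _ _); apply: functional_extensionality => y.
apply: propositional_extensionality; split=> [] [d E].
  by exists (c^-1 * d); rewrite jM (homV jM) -gmulA -E; gsimp.
by exists (c * d); rewrite jM E gmulA.
Qed.

Lemma cpartM c x : cpart (j c * x) = c * cpart x.
Proof.
apply: jI; rewrite jM; apply: (@mulIr _ (rep x)).
by rewrite -{1}(repM c) -cpartE -gmulA -cpartE.
Qed.

Lemma cpart_j c : cpart (j c) = c.
Proof.
apply: jI; apply: (@mulIr _ (rep (j c))); rewrite -cpartE rep_imj ?mulg1 //.
by exists c.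
Qed.

Lemma imj_rep x : imj (rep x) <-> imj x.
Proof. by rewrite [in X in _ <-> X](cpartE x) imjM. Qed.

Lemma rep_rep x : rep (rep x) = rep x.
Proof. by rewrite -[in RHS](repM (cpart x)^-1) {3}(cpartE x) (homV jM); gsimp. Qed.

Definition ntrep := {x : A | rep x = x /\ ~ imj x}.

Definition mk_ntrep x (h : ~ imj x) : ntrep :=
  exist (fun x => rep x = x /\ ~ imj x) (rep x)
    (conj (rep_rep x) (fun k => h ((imj_rep x).1 k))).

End Transversal.

Inductive altlist (S T : Type) := anil | acons of S & altlist T S.
Arguments anil {S T}. Arguments acons {S T}.

Section Swap.
Variables (A B C : group) (jA : C -> A) (jB : C -> B).
Hypotheses (jAM : is_hom jA) (jAI : injective jA).
Hypotheses (jBM : is_hom jB) (jBI : injective jB).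

(** A head outside C leaves its representative on the list and passes only its C-part to B; a head
    in C passes over entirely and absorbs the next syllable, which lies in B. *)
Definition swap (s : A * altlist (ntrep jB) (ntrep jA)) :
    B * altlist (ntrep jA) (ntrep jB) :=
  match excluded_middle_informative (imj jA s.1) with
  | left _ =>
      match s.2 with
      | anil => (jB (cpart jA s.1), anil)
      | acons y L => (jB (cpart jA s.1) * sval y, L)
      end
  | right h => (jB (cpart jA s.1), acons (mk_ntrep jAM h) s.2)
  end.

Lemma swap_imj s : ~ imj jA s.1 -> imj jB (swap s).1.
Proof. by rewrite /swap; case: excluded_middle_informative => // h _; exists (cpart jA s.1). Qed.

Lemma swapC c x L : swap (jA c * x, L) = (jB c * (swap (x, L)).1, (swap (x, L)).2).
Proof.
rewrite /swap /= !cpartM // !jBM.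
case: excluded_middle_informative => /= h; case: excluded_middle_informative => /= h'.
- by case: L => [//|y L]; rewrite gmulA.
- by case: h'; apply: (imjM jAM c x).1.
- by case: h; apply: (imjM jAM c x).2.
- by congr (_, acons _ _); apply: sub_eq; rewrite /= repM.
Qed.

End Swap.

Lemma swapK (A B C : group) (jA : C -> A) (jB : C -> B)
    (jAM : is_hom jA) (jAI : injective jA) (jBM : is_hom jB) (jBI : injective jB) :
  cancel (swap (jB := jB) jAM) (swap (jB := jA) jBM).
Proof.
case=> x L; rewrite {2}/swap; case: excluded_middle_informative => /= [[c xE]|h].
  rewrite xE cpart_j //; case: L => [|y L]; rewrite /swap /=.
    case: excluded_middle_informative => [h|[]]; last by exists c.
    by rewrite cpart_j.
  case: y => y [ry ny] /=; case: excluded_middle_informative => h.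
    by case: ny; apply: (imjM jBM c y).1.
  have -> : cpart jB (jB c * y) = c.
    rewrite cpartM // -[RHS]mulg1; congr (_ * _); apply: jBI; apply: (@mulIr _ y).
    by have := cpartE jBM y; rewrite ry => <-; rewrite (hom1 jBM) gmul1.
  by congr (_, acons _ _); apply: sub_eq; rewrite /= repM.
rewrite /swap /=; case: excluded_middle_informative => [_|[]]; last by exists (cpart jA x).
by rewrite cpart_j // -cpartE.
Qed.

(* Van der Waerden's argument: A acts by left multiplication on normal forms
   whose head lies in A, B on those whose head lies in B, and [swap] identifies
   the two sets of normal forms. *)
Section AmalgamAction.
Variables (A B C : group) (jA : C -> A) (jB : C -> B).
Hypotheses (jAM : is_hom jA) (jAI : injective jA).
Hypotheses (jBM : is_hom jB) (jBI : injective jB).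

Definition astate := (A * altlist (ntrep jB) (ntrep jA))%type.

Let AtoB : astate -> _ := swap (jB := jB) jAM.
Let BtoA : _ -> astate := swap (jB := jA) jBM.

Lemma lmulK (T : Type) (H : group) (x : H) :
  cancel (fun s : H * T => (x * s.1, s.2)) (fun s => (x^-1 * s.1, s.2)).
Proof. by case=> y L; rewrite /= gmulA gmulV gmul1. Qed.

Lemma lmulVK (T : Type) (H : group) (x : H) :
  cancel (fun s : H * T => (x^-1 * s.1, s.2)) (fun s => (x * s.1, s.2)).
Proof. by case=> y L; rewrite /= gmulA mulgV gmul1. Qed.

Definition actA (x : A) : Sym astate := mkSym (lmulK x) (lmulVK x).

Lemma actB_K (y : B) : cancel (fun s => BtoA (y * (AtoB s).1, (AtoB s).2))
  (fun s => BtoA (y^-1 * (AtoB s).1, (AtoB s).2)).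
Proof.
move=> s; rewrite /AtoB /BtoA [swap _ (swap _ _)]swapK //= gmulA gmulV gmul1.
by rewrite -surjective_pairing swapK.
Qed.

Lemma actB_VK (y : B) : cancel (fun s => BtoA (y^-1 * (AtoB s).1, (AtoB s).2))
  (fun s => BtoA (y * (AtoB s).1, (AtoB s).2)).
Proof. by have := actB_K y^-1; rewrite invgK. Qed.

Definition actB (y : B) : Sym astate := mkSym (actB_K y) (actB_VK y).

Lemma actA_hom : is_hom actA.
Proof. by move=> x y; apply: Sym_eq => s; rewrite !appM !app_mkSym /= gmulA. Qed.

Lemma actB_hom : is_hom actB.
Proof.
move=> x y; apply: Sym_eq => s; rewrite !appM !app_mkSym /AtoB /BtoA.
by rewrite [swap _ (swap _ _)]swapK //= gmulA.
Qed.

Lemma act_agree c : actA (jA c) = actB (jB c).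
Proof.
apply: Sym_eq => -[x L]; rewrite !app_mkSym /AtoB /BtoA.
by rewrite -(swapC jAM jAI jBM) swapK.
Qed.

Definition headA (s : astate) := ~ imj jA s.1.
Definition headB (s : astate) := ~ imj jB (AtoB s).1.

Lemma headA_notB s : headA s -> ~ headB s.
Proof. by move=> h; apply; apply: swap_imj. Qed.

Lemma actA_headA x s : ~ imj jA x -> ~ headA s -> headA (app (actA x) s).
Proof.
move=> nx ns h; apply: ns => -[c sE]; apply: nx; move: h => [d]; rewrite /= sE => E.
by exists (d * c^-1); rewrite jAM homV // -E; gsimp.
Qed.

Lemma actB_headB y s : ~ imj jB y -> ~ headB s -> headB (app (actB y) s).
Proof.
rewrite /headB app_mkSym /AtoB /BtoA [swap _ (swap _ _)]swapK //= => ny ns h.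
apply: ns => -[c sE]; apply: ny; move: h => [d]; rewrite sE => E.
by exists (d * c^-1); rewrite jBM homV // -E; gsimp.
Qed.

Definition abase : astate := (gone, anil).

Lemma abaseB : AtoB abase = (gone, anil).
Proof.
rewrite /AtoB /swap /=; case: excluded_middle_informative => [_|[]].
  by rewrite -(hom1 jAM) cpart_j // (hom1 jBM).
by exists gone; rewrite (hom1 jAM).
Qed.

End AmalgamAction.

Section AlternatingWords.
Variables (G : group) (A : bool -> G -> Prop).

Definition gprod (s : seq G) : G := foldr gmul gone s.

Lemma gprod_cat s w : gprod (s ++ w) = gprod s * gprod w.
Proof. by elim: s => [|x s IH] /=; rewrite ?gmul1 // IH gmulA. Qed.

Lemma gprod_catrev s w : gprod (catrev (map ginv s) w) = (gprod s)^-1 * gprod w.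
Proof.
by elim: s w => [|x s IH] w /=; rewrite ?invg1 ?gmul1 // IH /= invMg gmulA.
Qed.

Fixpoint alt (b : bool) (s : seq G) : Prop :=
  if s is x :: s' then [/\ A b x, ~ A (~~ b) x & alt (~~ b) s'] else True.

(* Equivalent to A true and A false generating their amalgamated product over
   their intersection. *)
Definition amalg :=
  [/\ subgrp (A true), subgrp (A false) &
      forall b s, s <> [::] -> alt b s -> ~ (A true (gprod s) /\ A false (gprod s))].

Lemma alt_cat b s w : alt b (s ++ w) <-> alt b s /\ alt (b (+) odd (size s)) w.
Proof.
elim: s b => [|x s IH] b /=; first by rewrite addbF; split=> [|[]].
have := IH (~~ b); rewrite (_ : ~~ b (+) odd (size s) = b (+) ~~ odd (size s)).
  by case=> H1 H2; split=> [[? ? /H1[]]|[[? ? ?] ?]] //; split=> //; apply: H2.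
by rewrite addNb addbN.
Qed.

Hypothesis am : amalg.

Lemma am_sub b : subgrp (A b). Proof. by case: am b => ? ? _ []. Qed.

Lemma alt_catrev b s w : alt b s -> alt (~~ b) w ->
  alt (if odd (size s) then b else ~~ b) (catrev (map ginv s) w).
Proof.
elim: s b w => [|x s IH] b w //= [Ax nx As] Aw.
rewrite (_ : (if ~~ odd (size s) then b else ~~ b) = (if odd (size s) then ~~ b else ~~ ~~ b)).
  apply: IH => //=; rewrite negbK; split=> //; first exact: sgV (am_sub b) _ _.
  by move=> /(sgVE (am_sub (~~ b))).
by case: (odd _); rewrite ?negbK.
Qed.

Lemma alt_notC b s : s <> [::] -> alt b s -> ~ (A b (gprod s) /\ A (~~ b) (gprod s)).
Proof.
case: am => _ _ H; move=> s0 /(H _ _ s0) K [K1 K2]; apply: K.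
by case: b K1 K2.
Qed.

(** Otherwise the inverse of the product could be put in front as a letter of the other side, giving
    a longer alternating word with product 1. *)
Lemma alt_notin b s : s <> [::] -> alt b s -> ~ A (~~ b) (gprod s).
Proof.
move=> s0 As Az; have nA : ~ A b (gprod s) by move=> Ab; apply: (alt_notC s0 As).
apply: (@alt_notC (~~ b) ((gprod s)^-1 :: s)) => //=; rewrite ?negbK.
  split=> //; first exact: sgV (am_sub _) _ Az.
  by move=> /(sgVE (am_sub b)).
by rewrite gmulV; split; apply: sg1; apply: am_sub.
Qed.

Lemma alt_notin2 b s b' : 1 < size s -> alt b s -> ~ A b' (gprod s).
Proof.
move=> sz As; have s0 : s <> [::] by case: (s) sz.
have [->|->] : b' = ~~ b \/ b' = b by case: (b) (b') => [] []; auto.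
  exact: alt_notin.
move=> Az; case: s sz As Az {s0} => [|x [|y s]] // _ [Ax nx As] Az.
move: As Az; set s' := y :: s => As; rewrite /= (sgMl (am_sub b) _ Ax) => Az.
by apply: (@alt_notin (~~ b) s' _ As) => //; rewrite negbK.
Qed.

Lemma amalg_nf g : gen (fun x => A true x \/ A false x) g ->
  (A true g /\ A false g) \/ exists b s, [/\ s <> [::], alt b s & g = gprod s].
Proof.
pose Q g := (A true g /\ A false g) \/ exists b s, [/\ s <> [::], alt b s & g = gprod s].
have QE b g' : A b g' -> Q g'.
  move=> Ab; case: (classic (A (~~ b) g')) => nA; first by left; case: b Ab nA.
  by right; exists b, [:: g']; rewrite /= mulg1.
have Qm b x g' : A b x -> Q g' -> Q (x * g').
  move=> Ax [[A1 A2]|[b' [s [s0 As ->]]]].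
    by apply: (QE b); apply: sgM (am_sub b) _ _ Ax _; case: (b).
  case: (classic (A (~~ b) x)) => nx.
    case: s s0 As => // y s _ [Ay ny As]; right; exists b', (x * y :: s).
    have [Ab' Anb'] : A b' x /\ A (~~ b') x by move: Ax nx; case: (b) (b') => [] [] /=.
    rewrite /= gmulA; split=> //; split=> //; first exact: sgM (am_sub _) _ _ _ _.
    by rewrite (sgMl (am_sub _) _ Anb').
  have [bE|bE] : b' = ~~ b \/ b' = b by case: (b) (b') => [] []; auto.
    by subst b'; right; exists b, (x :: s).
  subst b'; case: s s0 As => // y s _ [Ay ny As] /=.
  have Axy : A b (x * y) by apply: sgM (am_sub _) _ _ _ _.
  case: (classic (A (~~ b) (x * y))) => nxy; last first.
    by right; exists b, (x * y :: s); rewrite /= gmulA.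
  case: s As => [|z s] /= As; first by apply: (QE b); rewrite mulg1.
  case: As => Az nz As; right; exists (~~ b), (x * y * z :: s); rewrite /= !gmulA.
  split=> //; split=> //; first exact: sgM (am_sub _) _ _ _ _.
  by rewrite negbK in nz *; rewrite (sgMl (am_sub _) _ Axy).
suff K : gen (fun x => A true x \/ A false x) g ->
    forall x, (Q x -> Q (g * x)) /\ (Q x -> Q (g^-1 * x)).
  move=> /K /(_ gone) [+ _]; rewrite mulg1; apply; apply: (QE true).
  exact: sg1 (am_sub _).
elim=> {g} [g [] Ag| |g h _ IHg _ IHh|g _ IHg] x.
- by split; apply: (Qm true) => //; apply: sgV (am_sub _) _ _.
- by split; apply: (Qm false) => //; apply: sgV (am_sub _) _ _.
- by rewrite invg1 gmul1.
- split=> Qx; rewrite ?invMg -gmulA; first by apply: (IHg _).1; apply: (IHh _).1.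
  by apply: (IHh _).2; apply: (IHg _).2.
- by rewrite invgK; have [] := IHg x.
Qed.

Lemma alt_conj_notin b y s b' : A b y -> ~ A (~~ b) y -> s <> [::] -> alt (~~ b) s ->
  ~ A b' ((gprod s)^-1 * y * gprod s).
Proof.
move=> Ay ny s0 As; rewrite -gmulA -[y * _]/(gprod (y :: s)) -gprod_catrev.
have W : alt (~~ ~~ b) (y :: s) by rewrite negbK.
apply: alt_notin2 (alt_catrev As W); rewrite catrevE size_cat /=.
have : 0 < size s by case: (s) s0.
lia.
Qed.

Definition amgen := gen (fun x => A true x \/ A false x).

Lemma amgen_in b x : A b x -> amgen x.
Proof. by case: b => Ax; apply: gen_in; [left|right]. Qed.

(* An element of [A b] with no conjugate in the amalgamated subgroup fixes a
   single vertex of the Bass-Serre tree. *)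
Lemma amalg_fix b y g : A b y -> (forall x, A b x -> ~ A (~~ b) (x^-1 * y * x)) ->
  amgen g -> (A b (g^-1 * y * g) -> A b g) /\ ~ A (~~ b) (g^-1 * y * g).
Proof.
move=> Ay nC Gg; have sb := am_sub b.
case: (classic (A b g)) => [Ag|nAg]; first by split=> //; apply: nC.
suff K b' : ~ A b' (g^-1 * y * g) by split=> [/K|].
case: (amalg_nf Gg) => [[Ct Cf]|[c [s [s0 As gE]]]].
  by case: nAg; case: (b).
have [cE|cE] : c = b \/ c = ~~ b by case: (b) (c) => [] []; auto.
  case: s s0 As gE => // x s _ [Ax nx As] gE; subst c.
  have Ay' : A b (x^-1 * y * x) by apply: (sgM sb) => //; apply: (sgM sb) => //; apply: sgV.
  have s0 : s <> [::] by move=> s0; apply: nAg; rewrite gE s0 /= mulg1.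
  have := @alt_conj_notin b _ s b' Ay' (nC _ Ax) s0 As.
  by rewrite gE /=; gsimp.
subst c; rewrite gE; apply: (@alt_conj_notin b) => //.
by have := nC gone (sg1 sb); rewrite invg1 gmul1 mulg1.
Qed.

(* If the amalgamated subgroup is malnormal in [A false], then the fixed set of
   one of its elements in the Bass-Serre tree has radius one around [A true]. *)
Lemma amalg_fix_star c g : A true c -> A false c -> c <> gone ->
  (forall z v, A true z -> A false z -> z <> gone -> A false v -> A true (v^-1 * z * v) -> A true v) ->
  amgen g ->
  (A true (g^-1 * c * g) -> A true g) /\
  (A false (g^-1 * c * g) -> exists u v, [/\ A true u, A false v & g = u * v]).
Proof.
move=> Ct Cf c1 mal Gg; have st := am_sub true; have sf := am_sub false.
case: (amalg_nf Gg) => [[Gt Gf]|[b [s [s0 As gE]]]].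
  by split=> // _; exists gone, g; rewrite gmul1; split=> //; apply: sg1.
have cj b' x z : A b' x -> A b' z -> A b' (x^-1 * z * x).
  by have sb := am_sub b' => Ax Az; apply: (sgM sb) => //; apply: (sgM sb) => //; apply: sgV.
have cj1 (x z : G) : z <> gone -> x^-1 * z * x <> gone.
  move=> z1 E; apply: z1; apply: (@mulIr _ x); apply: (@mulIl _ x^-1).
  by rewrite gmulA E gmul1 gmulV.
case: s s0 As gE => // x s _ /=; case: b => [[Ax nx]|[Ax nx]] As gE; last first.
  have ny : ~ A true (x^-1 * c * x) by move=> /(mal _ _ Ct Cf c1 Ax).
  have Ay := cj _ _ _ Ax Cf.
  have [s0|s0] : s = [::] \/ s <> [::] by case: (s); [left|right].
    rewrite gE s0 /= mulg1; split; first by move=> /ny.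
    by exists gone, x; rewrite gmul1; split=> //; apply: sg1.
  have K b' := @alt_conj_notin false _ s b' Ay ny s0 As.
  by split=> E; [case: (K true)|case: (K false)]; move: E; rewrite gE; gsimp.
have Ay := cj _ _ _ Ax Ct.
have [s0|s0] : s = [::] \/ s <> [::] by case: (s); [left|right].
  have xg : x = g by rewrite gE s0 /= mulg1.
  split=> _; rewrite -xg //; exists x, gone; rewrite mulg1; split=> //; exact: sg1.
case: (classic (A false (x^-1 * c * x))) => ny; last first.
  have K b' := @alt_conj_notin true _ s b' Ay ny s0 As.
  by split=> E; [case: (K true)|case: (K false)]; move: E; rewrite gE; gsimp.
case: s s0 As gE => // x2 s _ /= [Ax2 nx2 As] gE.
have ny2 : ~ A true (x2^-1 * (x^-1 * c * x) * x2).
  by move=> /(mal _ _ Ay ny (cj1 _ _ c1) Ax2).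
have Ay2 := cj _ _ _ Ax2 ny.
have [s0|s0] : s = [::] \/ s <> [::] by case: (s); [left|right].
  split=> E; last by exists x, x2; rewrite gE s0 /= mulg1.
  by case: ny2; move: E; rewrite gE s0 /= mulg1; gsimp.
have K b' := @alt_conj_notin false _ s b' Ay2 ny2 s0 As.
by split=> E; [case: (K true)|case: (K false)]; move: E; rewrite gE /=; gsimp.
Qed.

Lemma alt_rev b s : alt b s -> ~~ odd (size s) ->
  alt (~~ b) (catrev (map ginv s) [::]) /\ size (catrev (map ginv s) [::]) = size s.
Proof.
move=> As ev; split; last by rewrite catrevE cats0 size_rev size_map.
by have := alt_catrev As (w := [::]) I; rewrite (negPf ev).
Qed.

(** An alternating word of even length is cyclically reduced, hence hyperbolic on the Bass-Serre
    tree. The proof is by induction on the conjugating word. *)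
Lemma alt_hyperbolic b s g b' : alt b s -> 1 < size s -> ~~ odd (size s) -> amgen g ->
  ~ A b' (g^-1 * gprod s * g).
Proof.
move=> As sz ev Gg.
suff K xs c : alt c xs -> forall b s b', alt b s -> 1 < size s -> ~~ odd (size s) ->
    ~ A b' ((gprod xs)^-1 * gprod s * gprod xs).
  case: (amalg_nf Gg) => [[Ct Cf]|[c [xs [_ Axs ->]]]]; last exact: K Axs _ _ _ As sz ev.
  have Ab : A b' g by case: (b').
  rewrite (sgMr (am_sub b') _ Ab) (sgMl (am_sub b') _ (sgV (am_sub b') Ab)).
  exact: alt_notin2 As.
elim: xs c {b s g b' As sz ev Gg} => [|x xs IH] c.
  by move=> _ b s b' As sz _; rewrite invg1 gmul1 mulg1; apply: alt_notin2 As.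
move=> /= [Ax nx Axs].
suff L s b' : alt c s -> 1 < size s -> ~~ odd (size s) ->
    ~ A b' ((gprod (x :: xs))^-1 * gprod s * gprod (x :: xs)).
  move=> b s b' As sz ev; have [bE|cE] : b = c \/ c = ~~ b by case: (b) (c) => [] []; auto.
    by subst b; apply: L.
  (* An even word and its inverse start on opposite sides, so the word may be assumed to start on
     the side of the conjugator. *)
  subst c; have [Ar szr] := alt_rev As ev.
  move=> /(sgV (am_sub b')) H; apply: (L _ b' Ar); rewrite ?szr //.
  by rewrite gprod_catrev /= mulg1; move: H; gsimp.
case: s => [|y [|z s]] //= [Ay ny [Az nz As]] _ ev.
have Au : A c (x^-1 * y) by apply: (sgM (am_sub c)) => //; apply: sgV (am_sub c) _ _.
(* If x^-1 y is in the amalgamated subgroup, conjugating by x merely rotates the word and the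
   conjugator becomes shorter; otherwise the whole conjugate is already an alternating word. *)
case: (classic (A (~~ c) (x^-1 * y))) => nu.
  have := IH (~~ c) Axs (~~ c) ((x^-1 * y * z) :: s ++ [:: x]) b'.
  rewrite /= gprod_cat /= mulg1 => K H; apply: K; last by move: H; gsimp.
  - split; first exact: sgM (am_sub _) _ _ _ _.
      by rewrite negbK in nz *; rewrite (sgMl (am_sub _) _ Au).
    rewrite alt_cat; split=> //=.
    by move: ev; rewrite !negbK => /negPf ->; rewrite addbF; split.
  - by rewrite size_cat /=; lia.
  - by rewrite size_cat /= addn1 /= negbK; move: ev; rewrite negbK.
have W : alt (~~ ~~ c) ((x^-1 * y) :: z :: s ++ x :: xs).
  rewrite negbK /=; split=> //; split=> //; rewrite alt_cat; split=> //=.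
  by move: ev; rewrite !negbK => /negPf ->; rewrite addbF; split.
have := @alt_notin2 _ _ b' _ (alt_catrev Axs W).
rewrite gprod_catrev /= gprod_cat /= catrevE size_cat /= => K H; apply: K; first lia.
by move: H; gsimp.
Qed.

End AlternatingWords.

(** * Free subgroups generated by one element of each side of an amalgam *)

Section PowerWords.
Variables (G : group) (p q : G).

Fixpoint falt (b : bool) (s : seq G) : Prop :=
  if s is x :: s' then
    (exists2 z, z != 0%R & x = (if b then p else q) ^ z) /\ falt (~~ b) s'
  else True.

Lemma gen2_falt x : gen (fun y => y = p \/ y = q) x ->
  exists b s, falt b s /\ x = gprod s.
Proof.
pose Q x := exists b s, falt b s /\ x = gprod s.
have Qm (b : bool) z x' : Q x' -> Q ((if b then p else q) ^ z * x').
  case=> b' [s [Fs ->]].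
  have [->|z0] := eqVneq z 0%R; first by exists b', s; rewrite gpow0 gmul1.
  have [bE|bE] : b' = b \/ b' = ~~ b by case: (b) (b') => [] []; auto.
    subst b'; case: s Fs => [_|y s [[w w0 ->] Fs]].
      by exists b, [:: (if b then p else q) ^ z]; split=> //=; split=> //; exists z.
    rewrite /= gmulA -gpowD; have [->|zw] := eqVneq (z + w)%R 0%R.
      by exists (~~ b), s; rewrite gpow0 gmul1.
    by exists b, ((if b then p else q) ^ (z + w)%R :: s); split=> //=; split=> //; exists (z + w)%R.
  subst b'; exists b, ((if b then p else q) ^ z :: s); split=> //=; split=> //.
  by exists z.
suff K : gen (fun y => y = p \/ y = q) x ->
    forall y, (Q y -> Q (x * y)) /\ (Q y -> Q (x^-1 * y)).
  by move=> /K /(_ gone) [+ _]; rewrite mulg1; apply; exists true, [::].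
elim=> {x} [x [] ->| |x y _ IHx _ IHy|x _ IHx] g.
- by split; [have := @Qm true 1%R g|have := @Qm true (-1)%R g]; rewrite ?gpowN gpow1.
- by split; [have := @Qm false 1%R g|have := @Qm false (-1)%R g]; rewrite ?gpowN gpow1.
- by rewrite invg1 gmul1.
- split=> Qg; rewrite ?invMg -gmulA; first by apply: (IHx _).1; apply: (IHy _).1.
  by apply: (IHy _).2; apply: (IHx _).2.
- by rewrite invgK; have [] := IHx g.
Qed.

Lemma falt_gen b s : falt b s -> gen (fun y => y = p \/ y = q) (gprod s).
Proof.
elim: s b => [|x s IH] b /=; first by move=> _; apply: gen_one.
case=> [[z _ ->] /IH Gs]; apply: gen_mul => //; apply: (sgX (gen_subgrp _)).
by apply: gen_in; case: b; [left|right].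
Qed.

Lemma falt_cat b s w : falt b (s ++ w) <-> falt b s /\ falt (b (+) odd (size s)) w.
Proof.
elim: s b => [|x s IH] b /=; first by rewrite addbF; split=> [|[]].
have := IH (~~ b); rewrite (_ : ~~ b (+) odd (size s) = b (+) ~~ odd (size s)).
  by case=> H1 H2; split=> [[? /H1[]]|[[? ?] ?]] //; split=> //; apply: H2.
by rewrite addNb addbN.
Qed.

Variable A : bool -> G -> Prop.
Hypothesis am : amalg A.
Hypothesis pA : forall z, z != 0%R -> A true (p ^ z) /\ ~ A false (p ^ z).
Hypothesis qA : forall z, z != 0%R -> A false (q ^ z) /\ ~ A true (q ^ z).

Lemma falt_alt b s : falt b s -> alt A b s.
Proof.
elim: s b => //= x s IH b [[z z0 ->] /IH As].
by case: b As => As; have [] := (pA z0, qA z0) => -[? ?] [? ?].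
Qed.

Local Notation F := (gen (fun y => y = p \/ y = q)).

Lemma gen2_side b x : F x -> A b x -> exists z, x = (if b then p else q) ^ z.
Proof.
case/gen2_falt=> c [s [Fs ->]] Ax; have As := falt_alt Fs.
case: s Fs As Ax => [|y [|y' s]] Fs As Ax; first by exists 0%R.
  rewrite /= mulg1 in Ax *; case: Fs => -[z z0 yE] _; exists z.
  case: As => Ay ny _; have [<-//|cE] : c = b \/ b = ~~ c by case: (b) (c) => [] []; auto.
  by subst b.
by case: (alt_notin2 (b' := b) am _ As Ax).
Qed.

(** Cyclic reduction inside the free group on p and q: an even word is hyperbolic, and an odd word
    of length at least three begins and ends with powers of the same generator, which a conjugation
    merges into one letter or none. *)
Lemma gen2_elliptic b x g : F x -> amgen A g -> A b (g^-1 * x * g) ->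
  exists f z, F f /\ (x = f * p ^ z * f^-1 \/ x = f * q ^ z * f^-1).
Proof.
case/gen2_falt=> c [s [Fs ->]] Gg; have [N] := ubnP (size s).
elim: N c s Fs g Gg => // N IH c s Fs g Gg sN Ax.
case: s Fs sN Ax => [|y s] Fs sN Ax.
  by exists gone, 0%R; split; [apply: gen_one|left; rewrite gpow0 mulg1 mulgV].
case: (lastP s) Fs sN Ax => [|s0 y'] Fs sN Ax.
  case: Fs => -[z z0 yE] _; exists gone, z; split; first exact: gen_one.
  by rewrite /= yE !gmul1 invg1 !mulg1; case: (c); [left|right].
have As := falt_alt Fs.
have [ev|od] := boolP (odd (size s0)); last first.
  by case: (alt_hyperbolic am As (b' := b) (g := g)) => //; rewrite /= size_rcons //= negbK.
have [[z z0 yE] Fs'] : _ /\ falt (~~ c) (rcons s0 y') := Fs.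
have /falt_cat[Fs0] : falt (~~ c) (s0 ++ [:: y']) by rewrite cats1.
rewrite ev addbT negbK => -[[z' z0' yE'] _].
set X := gprod _ in Ax *.
set u := if c then p else q in yE yE'.
have Fu z1 : F (u ^ z1).
  by apply: (sgX (gen_subgrp _)); apply: gen_in; rewrite /u; case: (c); [left|right].
have XE : X = u ^ z * (gprod s0 * u ^ (z' + z)%R) * (u ^ z)^-1.
  by rewrite /X /= -cats1 gprod_cat /= mulg1 yE yE' gpowD; gsimp.
have [t [Ft tE st]] : exists t, [/\ falt (~~ c) t, gprod t = gprod s0 * u ^ (z' + z)%R
    & size t <= (size s0).+1].
  have [->|zz] := eqVneq (z' + z)%R 0%R; first by exists s0; rewrite gpow0 mulg1; split.
  exists (s0 ++ [:: u ^ (z' + z)%R]); rewrite gprod_cat /= mulg1 size_cat /= addn1; split=> //.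
  apply/falt_cat; split=> //; rewrite ev addbT negbK; split=> //.
  by exists (z' + z)%R.
have sz : size t < N by move: sN; rewrite /= size_rcons; lia.
have Gh : amgen A ((u ^ z)^-1 * g).
  apply: gen_mul => //; apply: gen_inv; apply: (amgen_in (b := c)).
  by rewrite -yE; case: As.
have [|f [w [Ff E]]] := IH (~~ c) t Ft _ Gh sz.
  by move: Ax; rewrite XE tE; gsimp.
exists (u ^ z * f), w; split; first exact: gen_mul.
by rewrite XE -tE; case: E => ->; [left|right]; gsimp.
Qed.

(** Compare y y' with the reduced word in p and q for the same element. By uniqueness of normal
    forms that word is p^x q^w, and the two factorizations differ by an element c of the amalgamated
    subgroup in the middle. *)
Lemma gen2_corner y y' : A true y -> A false y' -> F (y * y') ->
  exists x w c, [/\ A true c, A false c, y = p ^ x * c & y' = c^-1 * q ^ w].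
Proof.
move=> Ay Ay' Fyy; have st := am_sub am true; have sf := am_sub am false.
case: (classic (A false y)) => ny.
  have [w E] := gen2_side (b := false) Fyy (sgM sf ny Ay').
  by exists 0%R, w, y; rewrite gpow0 gmul1 -E gmulA gmulV gmul1.
case: (classic (A true y')) => ny'.
  have [x E] := gen2_side (b := true) Fyy (sgM st Ay ny').
  exists x, 0%R, y'^-1; rewrite gpow0 mulg1 invgK -E mulgK.
  by split=> //; apply: sgV.
have [b [s [Fs E]]] := gen2_falt Fyy; have As := falt_alt Fs.
have W : alt A true [:: y; y'] by [].
have no s' b' : s' <> [::] -> alt A b' s' -> gprod s' <> gone.
  move=> s0 As' E'; have := alt_notin am s0 As'; rewrite E'; apply.
  exact: sg1 (am_sub am _).
have noempty t (w : seq G) : w <> [::] -> catrev t w <> [::].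
  by rewrite catrevE; case: (rev t) => //; case: w.
case: b Fs As E => Fs As E; last first.
  case: (@no _ _ _ (alt_catrev am As W)); first exact: noempty.
  by rewrite gprod_catrev /= mulg1 E gmulV.
case: s Fs As E => [|f s] Fs As E.
  by case: (@no _ _ _ W) => //; rewrite /= mulg1 E.
have [[x _ fE] Fs'] := Fs; have [Af _ As'] := As.
have Au : A true (f^-1 * y) by apply: (sgM st) => //; apply: sgV.
have E' : f^-1 * y * y' = gprod s by rewrite -gmulA E /= gmulA gmulV gmul1.
case: (classic (A false (f^-1 * y))) => nu; last first.
  have W' : alt A (~~ false) [:: f^-1 * y; y'] by [].
  case: (@no _ _ _ (alt_catrev am As' W')); first exact: noempty.
  by rewrite gprod_catrev /= mulg1 E' gmulV.
have [w Ew] := gen2_side (b := false) (falt_gen Fs') (eq_ind _ (A false) (sgM sf nu Ay') _ E').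
exists x, w, (f^-1 * y); rewrite -Ew -E' -fE; split=> //; gsimp => //.
Qed.

End PowerWords.

(** * From the universal property of a pushout to alternating words *)

Section Pushout.
Variables (A B C P : group) (jA : C -> A) (jB : C -> B) (iA : A -> P) (iB : B -> P).
Hypotheses (jAM : is_hom jA) (jAI : injective jA).
Hypotheses (jBM : is_hom jB) (jBI : injective jB).
Hypotheses (iAM : is_hom iA) (iBM : is_hom iB).
Hypothesis agree : forall c, iA (jA c) = iB (jB c).
Hypothesis ext : forall (Q : group) (fA : A -> Q) (fB : B -> Q),
  is_hom fA -> is_hom fB -> (forall c, fA (jA c) = fB (jB c)) ->
  exists f : P -> Q, [/\ is_hom f, forall x, f (iA x) = fA x & forall y, f (iB y) = fB y].

Definition pimage (b : bool) (x : P) : Prop :=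
  if b then exists y, x = iA y else exists y, x = iB y.

Lemma pimage_sub b : subgrp (pimage b).
Proof.
case: b; split.
- by exists gone; rewrite (hom1 iAM).
- by move=> _ _ [x ->] [y ->]; exists (x * y); rewrite iAM.
- by move=> _ [x ->]; exists x^-1; rewrite (homV iAM).
- by exists gone; rewrite (hom1 iBM).
- by move=> _ _ [x ->] [y ->]; exists (x * y); rewrite iBM.
- by move=> _ [x ->]; exists x^-1; rewrite (homV iBM).
Qed.

(** Let P act on normal forms. An alternating word moves the base state to one that starts on the
    side of its first letter, whereas an element of both images moves it to one that starts on
    neither side. The orbit of the base state also shows that both factors embed. *)
Lemma pushout_amalg : [/\ injective iA, injective iB, amalg pimage &
  forall x, pimage true x -> pimage false x -> exists c, x = iA (jA c)].
Proof.
have [f [fM fA fB]] := ext (@actA_hom A B C jA jB) (actB_hom jAM jAI jBM jBI)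
  (act_agree jAM jAI jBM jBI).
pose o := abase jA jB.
have oA x : app (f (iA x)) o = (x, anil) by rewrite fA app_mkSym /= mulg1.
have oB y : swap (jB := jB) jAM (app (f (iB y)) o) = (y, anil).
  by rewrite fB app_mkSym swapK //= -/o abaseB //= mulg1.
have nhead x : pimage true x -> pimage false x ->
    ~ headA (app (f x) o) /\ ~ headB jAM (app (f x) o).
  move=> [a xa] [b xb].
  have H : ~ headA (app (f x) o) \/ ~ headB jAM (app (f x) o).
    case: (classic (headA (app (f x) o))); [right|by left]; exact: headA_notB.
  case: H => H; split=> //.
    move: H; rewrite xa oA /headA /= => /NNPP [c aE].
    rewrite /headB; apply; exists c; have := oB (jB c); rewrite -agree -aE.
    by rewrite oA => ->.
  have := H; rewrite {1}xb /headB oB /= => /NNPP [c bE].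
  by rewrite xb bE -agree oA; apply; exists c.
split.
- by apply: (hom_inj iAM) => x xE; move: (oA x); rewrite xE (hom1 fM) app1 => -[].
- apply: (hom_inj iBM) => y yE; move: (oB y).
  by rewrite yE (hom1 fM) app1 abaseB // => -[].
- split; [exact: pimage_sub|exact: pimage_sub|] => b s s0 As [Pt Pf].
  suff H : if b then headA (app (f (gprod s)) o) else headB jAM (app (f (gprod s)) o).
    by have [n1 n2] := nhead _ Pt Pf; case: b As H.
  have base : ~ headA o /\ ~ headB jAM o.
    have := @nhead gone; rewrite (hom1 fM) app1; apply; exact: sg1 (pimage_sub _).
  have step b' x z : pimage b' x -> ~ pimage (~~ b') x ->
      ~ (if b' then headA z else headB jAM z) ->
      if b' then headA (app (f x) z) else headB jAM (app (f x) z).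
    case: b' => /= -[y ->] ny hz; [rewrite fA; apply: actA_headA|rewrite fB; apply: actB_headB] => //.
      by case=> c yE; apply: ny; exists (jB c); rewrite yE agree.
    by case=> c yE; apply: ny; exists (jA c); rewrite yE agree.
  elim: s b As {Pt Pf s0} (s0) => // x s IH b /= [Px nx As] _.
  rewrite fM appM; apply: step => //.
  have [s0|s0] : s = [::] \/ s <> [::] by case: (s); [left|right].
    by rewrite s0 /= (hom1 fM) app1; case: (b); tauto.
  have := IH _ As s0; case: (b) => //= h1 h2; last exact: headA_notB h1 h2.
  exact: headA_notB h2 h1.
- move=> x Px Px'; have [+ _] := nhead _ Px Px'; have [a ->] := Px.
  by rewrite oA /headA /= => /NNPP [c ->]; exists c.
Qed.

End Pushout.

(** * Structure of Higman groups *)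

Definition Sg (G : group) (c : nat -> G) (u v : nat) : G -> Prop :=
  gen (fun x => exists2 j, u <= j <= v & x = c j).

Lemma Sg_in (G : group) (c : nat -> G) u v j : u <= j <= v -> Sg c u v (c j).
Proof. by move=> juv; apply: gen_in; exists j. Qed.

Lemma Sg_sub (G : group) (c : nat -> G) u v : subgrp (Sg c u v).
Proof. exact: gen_subgrp. Qed.

Lemma Sg_mono (G : group) (c : nat -> G) u v u' v' x : u' <= u -> v <= v' ->
  Sg c u v x -> Sg c u' v' x.
Proof. by move=> uu vv; apply: gen_sub => _ [j juv ->]; exists j => //; lia. Qed.

Lemma Sg_map (G H : group) (f : G -> H) (c : nat -> G) (b : nat -> H) u v x :
  is_hom f -> (forall j, u <= j <= v -> f (c j) = b j) ->
  Sg b u v x <-> exists y, Sg c u v y /\ x = f y.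
Proof.
move=> fM fc; rewrite -(gen_map _ fM); split; apply: gen_sub => z.
  by case=> j juv ->; exists (c j); rewrite fc //; split => //; exists j.
by case=> _ [[j juv ->] ->]; exists j; rewrite ?fc.
Qed.

Lemma amalg_eq (G : group) (A B : bool -> G -> Prop) :
  (forall b x, A b x <-> B b x) -> amalg A -> amalg B.
Proof.
move=> AB; suff -> : A = B by [].
apply: functional_extensionality => b; apply: functional_extensionality => x.
exact: propositional_extensionality.
Qed.

Lemma amalg_map (P G : group) (f : P -> G) (A : bool -> P -> Prop) (B : bool -> G -> Prop) :
  is_hom f -> injective f -> (forall b x, B b x <-> exists y, A b y /\ x = f y) ->
  amalg A -> amalg B.
Proof.
move=> fM fI BE am; apply: (@amalg_eq _ (fun b x => exists y, A b y /\ x = f y)).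
  by move=> b x; rewrite BE.
have sub b : subgrp (fun x => exists y, A b y /\ x = f y).
  have sb := am_sub am b; split.
  - by exists gone; rewrite (hom1 fM); split=> //; apply: sg1.
  - by move=> _ _ [x [Ax ->]] [y [Ay ->]]; exists (x * y); rewrite fM; split=> //; apply: sgM.
  - by move=> _ [x [Ax ->]]; exists x^-1; rewrite (homV fM); split=> //; apply: sgV.
split; [exact: (sub true)|exact: (sub false)|] => b s s0 As.
have [s' [sE As']] : exists s', s = map f s' /\ alt A b s'.
  elim: s b As {s0} => [|x s IH] b /=; first by exists [::].
  case=> -[y [Ay ->]] ny /IH [s' [-> As']]; exists (y :: s'); split=> //; split=> //.
  by move=> Ay'; apply: ny; exists y.
have pE : gprod s = f (gprod s').
  by rewrite sE; elim: (s') => [|x t IH] /=; rewrite ?(hom1 fM) // fM IH.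
rewrite pE => -[[x [Ax /fI xE]] [y [Ay /fI yE]]]; subst x y.
have s0' : s' <> [::] by move=> s'0; apply: s0; rewrite sE s'0.
by case: am => _ _ /(_ b s' s0' As'); apply.
Qed.

(** * Chains of Baumslag-Solitar relations *)

Section Chains.
Variables M N : nat -> int.
Hypotheses (M0 : forall j, M j != 0%R) (N0 : forall j, N j != 0%R).

Definition chain_sat u v (H : group) (b : nat -> H) := forall j, u <= j < v ->
  b j * b j.+1 ^ (M j) * (b j)^-1 = b j.+1 ^ (N j).

Definition is_chain u v (P : group) (c : nat -> P) :=
  [/\ chain_sat u v c, forall x, Sg c u v x &
      forall (H : group) (b : nat -> H), chain_sat u v b ->
        exists f : P -> H, is_hom f /\ forall j, u <= j <= v -> f (c j) = b j].

Definition wpow (j : nat) (z : int) : word nat :=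
  match z with Posz p => nseq p (j, true) | Negz p => nseq p.+1 (j, false) end.

Lemma weval_wpow (H : group) (b : nat -> H) j z : weval b (wpow j z) = b j ^ z.
Proof.
case: z => p; first by elim: p => // p IH; rewrite gpow_nat1 /= -IH.
rewrite [in RHS]NegzE gpowN -gpowV /wpow; elim: p.+1 => // q IH.
by rewrite gpow_nat1 /= -IH.
Qed.

(** The generators outside u..v are killed, so that all chains share the index type [nat]. *)
Definition chain_rel u v (w w' : word nat) : Prop :=
  (exists j, [/\ u <= j < v, w = (j, true) :: wpow j.+1 (M j) ++ [:: (j, false)]
     & w' = wpow j.+1 (N j)]) \/
  (exists j, [/\ ~~ (u <= j <= v), w = [:: (j, true)] & w' = [::]]).

Lemma chain_satP u v (H : group) (b : nat -> H) : sat (chain_rel u v) b <->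
  chain_sat u v b /\ forall j, ~~ (u <= j <= v) -> b j = gone.
Proof.
split=> [sb|[sb b1] w w' [[j [juv -> ->]]|[j [juv -> ->]]]].
- split=> j juv.
    have := sb _ _ (or_introl (ex_intro _ j (And3 juv erefl erefl))).
    by rewrite /= weval_cat !weval_wpow /= mulg1 /letter /= gmulA.
  have := sb _ _ (or_intror (ex_intro _ j (And3 juv erefl erefl))).
  by rewrite /= mulg1.
- by rewrite /= weval_cat !weval_wpow /= mulg1 /letter /= gmulA sb.
- by rewrite /= mulg1 /letter /= b1.
Qed.

Lemma chain_exists u v : exists (P : group) (c : nat -> P), is_chain u v c.
Proof.
exists (presG (chain_rel u v)), (pgen (chain_rel u v)).
have /chain_satP[sc c1] := sat_pgen (rel := chain_rel u v).
split=> // [x|H b sb].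
  apply: (gen_min (Sg_sub _ _ _) _ (pres_gen x)) => _ [j ->].
  have [juv|/c1 ->] := boolP (u <= j <= v); first exact: Sg_in.
  exact: sg1 (Sg_sub _ _ _).
pose b' j := if u <= j <= v then b j else gone.
have sb' : sat (chain_rel u v) b'.
  apply/chain_satP; split=> j juv; last by rewrite /b' (negPf juv).
  rewrite /b'; have [-> ->] : u <= j <= v /\ u <= j.+1 <= v by lia.
  exact: sb.
exists (plift b'); split; first exact: plift_hom.
by move=> j juv; rewrite plift_gen // /b' juv.
Qed.

Lemma chain_BS u (P : group) (c : nat -> P) : is_chain u u.+1 c ->
  is_BS (M u) (N u) (c u) (c u.+1).
Proof.
case=> sc Gc ext; split=> [|x|H t' a' E]; first by apply: sc; lia.
  apply: gen_sub (Gc x) => _ [j juv ->].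
  have [->|->] : j = u \/ j = u.+1 by lia.
    by left.
  by right.
have su : (u.+1 == u) = false by lia.
have [|f [fM fc]] := ext H (fun j => if j == u then t' else a').
  move=> j juv; have -> : j = u by lia.
  by rewrite eqxx su.
by exists f; split=> //; rewrite fc ?eqxx ?su //; lia.
Qed.

Section ChainStep.
Variables (u v : nat) (X Y P : group) (cX : nat -> X) (cY : nat -> Y) (c : nat -> P).
Hypothesis uv : u.+1 < v.
Hypotheses (hX : is_chain u u.+1 cX) (hY : is_chain u.+1 v cY) (hP : is_chain u v c).
Hypothesis tfY : forall z w, cY u.+1 ^ z = cY v ^ w -> z = 0%R /\ w = 0%R.

Lemma chain_step : exists (iX : X -> P) (iY : Y -> P),
  [/\ [/\ is_hom iX, injective iX & forall j, u <= j <= u.+1 -> iX (cX j) = c j],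
      [/\ is_hom iY, injective iY & forall j, u < j <= v -> iY (cY j) = c j],
      amalg (fun b => if b then Sg c u u.+1 else Sg c u.+1 v) &
      forall x, Sg c u u.+1 x -> Sg c u.+1 v x -> exists z, x = c u.+1 ^ z].
Proof.
have [sX GX eX] := hX; have [sY GY eY] := hY; have [sP GP eP] := hP.
have [|iX [iXM iXc]] := eX P c; first by move=> j ju; apply: sP; lia.
have [|iY [iYM iYc]] := eY P c; first by move=> j ju; apply: sP; lia.
pose jX (z : intG) : X := cX u.+1 ^ z; pose jY (z : intG) : Y := cY u.+1 ^ z.
have jXM : is_hom jX by move=> z w; rewrite /jX -gpowD.
have jYM : is_hom jY by move=> z w; rewrite /jY -gpowD.
have jXI : injective jX by move=> z w; apply: (bs_pow_inj (M0 u) (N0 u) (chain_BS hX)).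
have jYI : injective jY.
  apply: (hom_inj jYM) => z zE; have [] := @tfY z 0%R; last by [].
  by rewrite gpow0.
have ag z : iX (jX z) = iY (jY z).
  by rewrite /jX /jY (hom_pow iXM) (hom_pow iYM) iXc ?iYc //; lia.
have [|iXI iYI am inter] := pushout_amalg jXM jXI jYM jYI iXM iYM ag.
  move=> Q fX fY fXM fYM fag.
  pose b j := if j <= u.+1 then fX (cX j) else fY (cY j).
  have bY j : u < j -> b j = fY (cY j).
    move=> uj; rewrite /b; case: ifP => // ju; have -> : j = u.+1 by lia.
    by have := fag 1%R; rewrite /jX /jY !gpow1.
  have [j juv|f [fM fc]] := eP Q b.
    have [ju|ju] := leqP j u.
      have <- : u = j by lia.
      rewrite /b leqnSn leqnn -(homV fXM) -!(hom_pow fXM) -!fXM sX //; lia.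
    have [ju1 ju2] : u < j.+1 /\ u < j < v by lia.
    by rewrite !bY // -(homV fYM) -!(hom_pow fYM) -!fYM sY.
  exists f; split=> // x.
    apply: (hom_gen_ext (f := f \o iX) _ fXM _ (GX x)) => [y z|_ [j ju ->]] /=.
      by rewrite iXM fM.
    have [ju1 ju2] : j <= u.+1 /\ u <= j <= v by lia.
    by rewrite iXc // fc // /b ju1.
  apply: (hom_gen_ext (f := f \o iY) _ fYM _ (GY x)) => [y z|_ [j ju ->]] /=.
    by rewrite iYM fM.
  have [ju1 ju2] : u < j /\ u <= j <= v by lia.
  by rewrite iYc // fc // bY.
have imE b x : pimage iX iY b x <-> (if b then Sg c u u.+1 else Sg c u.+1 v) x.
  case: b; rewrite /pimage.
    rewrite (Sg_map _ iXM iXc); split=> [[y ->]|[y [_ ->]]]; exists y => //.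
  rewrite (Sg_map _ iYM iYc); split=> [[y ->]|[y [_ ->]]]; exists y => //.
exists iX, iY; split=> //; first exact: amalg_eq imE am.
move=> x Xx Yx; have [|z ->] := inter x ((imE true x).2 Xx); first exact: (imE false x).2.
exists z; rewrite (hom_pow iXM) iXc //; lia.
Qed.

End ChainStep.

(** A common power lies on both sides of the first splitting, hence is a power of c_(u+1); the
    Baumslag-Solitar group gives z = 0, and the tail gives w = 0. The induction hypothesis also
    makes that splitting available: with w = 0 it says that c_(u+1) has infinite order in the
    tail. *)
Lemma chain_ends d u (P : group) (c : nat -> P) : is_chain u (u + d.+1) c ->
  forall z w, c u ^ z = c (u + d.+1) ^ w -> z = 0%R /\ w = 0%R.
Proof.
elim: d u P c => [|d IH] u P c.
  rewrite addn1 => /chain_BS hBS z w; exact: bs_pow_eq hBS _ _.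
have [X [cX hX]] := chain_exists u u.+1.
have [Y [cY hY]] := chain_exists u.+1 (u + d.+2).
have tfY : forall z w, cY u.+1 ^ z = cY (u + d.+2) ^ w -> z = 0%R /\ w = 0%R.
  by rewrite -addSnnS in hY *; apply: IH.
move=> hP; have [|iX [iY [[iXM iXI iXc] [iYM iYI iYc] am inter]]] := chain_step _ hX hY hP tfY.
  lia.
move=> z w E; have [||x Ex] := inter (c u ^ z).
- by apply: (sgX (Sg_sub _ _ _)); apply: Sg_in; lia.
- by rewrite E; apply: (sgX (Sg_sub _ _ _)); apply: Sg_in; lia.
have z0 : z = 0%R.
  have [|//] := bs_pow_eq (M0 u) (N0 u) (chain_BS hX) (i := z) (y := x).
  by apply: iXI; rewrite !(hom_pow iXM) !iXc //; lia.
split=> //; have [|//] := tfY 0%R w; apply: iYI.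
by rewrite gpow0 (hom1 iYM) (hom_pow iYM) iYc; [rewrite -E z0|lia].
Qed.

(** What is later used of a chain, phrased for subgroups of any group so that it passes along
    injective homomorphisms. The last two clauses place the end generators on opposite sides, which
    makes them free generators of the group they span. *)
Definition splits_off (u v : nat) (P : group) (c : nat -> P) :=
  [/\ exists (X : group) (t a : X) (i : X -> P),
        [/\ is_BS (M u) (N u) t a, is_hom i, injective i, i t = c u & i a = c u.+1],
      amalg (fun b => if b then Sg c u u.+1 else Sg c u.+1 v),
      forall x, Sg c u u.+1 x -> Sg c u.+1 v x -> exists z, x = c u.+1 ^ z,
      forall z, z != 0%R -> Sg c u u.+1 (c u ^ z) /\ ~ Sg c u.+1 v (c u ^ z) &
      forall z, z != 0%R -> Sg c u.+1 v (c v ^ z) /\ ~ Sg c u u.+1 (c v ^ z)].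

Lemma splits_off_map u v (P Q : group) (c : nat -> P) (b : nat -> Q) (f : P -> Q) :
  u < v -> is_hom f -> injective f -> (forall j, u <= j <= v -> f (c j) = b j) ->
  splits_off u v c -> splits_off u v b.
Proof.
move=> uv fM fI fc [[X [t [a' [i [BS iM iI it ia]]]]] am inter pA qA].
have fc1 : forall j, u <= j <= u.+1 -> f (c j) = b j by move=> j ju; apply: fc; lia.
have fc2 : forall j, u < j <= v -> f (c j) = b j by move=> j ju; apply: fc; lia.
have E1 y : Sg b u u.+1 (f y) <-> Sg c u u.+1 y.
  by rewrite (Sg_map _ fM fc1); split=> [[z [Sz /fI ->]]|Sy] //; exists y.
have E2 y : Sg b u.+1 v (f y) <-> Sg c u.+1 v y.
  by rewrite (Sg_map _ fM fc2); split=> [[z [Sz /fI ->]]|Sy] //; exists y.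
split.
- exists X, t, a', (f \o i); split=> //=; last 1 first.
  + by rewrite ia fc1 //; lia.
  + by move=> x y; rewrite /= iM fM.
  + exact: inj_comp.
  + by rewrite it fc1 //; lia.
- by apply: amalg_map am => // -[] x; [apply: Sg_map|apply: Sg_map].
- move=> x /(Sg_map _ fM fc1) [y [Sy ->]] /E2 /(inter _ Sy) [z ->].
  by exists z; rewrite (hom_pow fM) fc1 //; lia.
- by move=> z /pA; rewrite -E1 -E2 (hom_pow fM) fc1 //; lia.
- by move=> z /qA; rewrite -E1 -E2 (hom_pow fM) fc2 //; lia.
Qed.

Lemma chain_split u d (P : group) (c : nat -> P) : is_chain u (u + d.+2) c ->
  splits_off u (u + d.+2) c.
Proof.
move=> hP; have [X [cX hX]] := chain_exists u u.+1.
have [Y [cY hY]] := chain_exists u.+1 (u + d.+2).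
have tfY : forall z w, cY u.+1 ^ z = cY (u + d.+2) ^ w -> z = 0%R /\ w = 0%R.
  by have := hY; rewrite -addSnnS; apply: chain_ends.
have [|iX [iY [[iXM iXI iXc] [iYM iYI iYc] am inter]]] := chain_step _ hX hY hP tfY.
  lia.
split=> //.
- exists X, (cX u), (cX u.+1), iX; split=> //; first exact: chain_BS.
    by apply: iXc; lia.
  by apply: iXc; lia.
- move=> z z0; have Sz : Sg c u u.+1 (c u ^ z).
    by apply: (sgX (Sg_sub _ _ _)); apply: Sg_in; lia.
  split=> // /(inter _ Sz) [w E]; case/eqP: z0.
  have [|//] := bs_pow_eq (M0 u) (N0 u) (chain_BS hX) (i := z) (y := w).
  by apply: iXI; rewrite !(hom_pow iXM) !iXc //; lia.
- move=> z z0; have Sz : Sg c u.+1 (u + d.+2) (c (u + d.+2) ^ z).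
    by apply: (sgX (Sg_sub _ _ _)); apply: Sg_in; lia.
  split=> // Sz'; have [w E] := inter _ Sz' Sz; case/eqP: z0.
  have [|//] := tfY w z; apply: iYI.
  by rewrite !(hom_pow iYM) !iYc //; lia.
Qed.

End Chains.

Lemma fst_hom (A B : group) : is_hom (fun x : prodG A B => x.1 : A). Proof. by []. Qed.
Lemma snd_hom (A B : group) : is_hom (fun x : prodG A B => x.2 : B). Proof. by []. Qed.

Lemma sval_hom (G : group) (S : G -> Prop) (sS : subgrp S) :
  is_hom (fun u : subG sS => sval u).
Proof. by []. Qed.

Lemma falt_map (G H : group) (f : G -> H) (p q : G) b s : is_hom f ->
  falt p q b s -> falt (f p) (f q) b (map f s).
Proof.
move=> fM; elim: s b => //= x s IH b [[z z0 ->] /IH Fs]; split=> //.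
by exists z => //; rewrite (hom_pow fM); case: (b).
Qed.

Lemma gprod_map (G H : group) (f : G -> H) s : is_hom f -> gprod (map f s) = f (gprod s).
Proof. by move=> fM; elim: s => [|x s IH] /=; rewrite ?(hom1 fM) // fM IH. Qed.

Lemma gen2_map_inj (G H : group) (f : G -> H) (p q : G) (A : bool -> H -> Prop) :
  is_hom f -> amalg A ->
  (forall z, z != 0%R -> A true (f p ^ z) /\ ~ A false (f p ^ z)) ->
  (forall z, z != 0%R -> A false (f q ^ z) /\ ~ A true (f q ^ z)) ->
  forall x, gen (fun y => y = p \/ y = q) x -> f x = gone -> x = gone.
Proof.
move=> fM am pA qA x /gen2_falt [b [s [Fs ->]]] E.
have As := falt_alt pA qA (falt_map fM Fs).
case: s {Fs} As E => // y s As E.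
case: (alt_notin am _ As) => //; rewrite gprod_map // E.
exact: sg1 (am_sub am _).
Qed.

(** * The Higman group as an amalgam of two chains *)

Section HigmanStructure.
Variables (k : nat) (m n : 'I_k -> int) (G : group) (a : 'I_k -> G).
Hypothesis k4 : 4 <= k.
Hypothesis mn0 : forall i, m i != 0%R /\ n i != 0%R.
Hypothesis hig : is_Hig m n a.

Lemma k_gt0 : 0 < k. Proof. exact: leq_trans k4. Qed.

Definition ik (j : nat) : 'I_k := Ordinal (ltn_pmod j k_gt0).

Lemma ik_ord (i : 'I_k) : ik i = i.
Proof. by apply: val_inj; rewrite /= modn_small. Qed.

Lemma ik_eq i j : i = j %[mod k] -> ik i = ik j.
Proof. by move=> E; apply: val_inj. Qed.

Lemma ikD j : ik (j + k) = ik j.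
Proof. by apply: ik_eq; rewrite modnDr. Qed.

Lemma ordS_ik j : ordS (ik j) = ik j.+1.
Proof. by apply: val_inj; rewrite /= -[(_ %% k).+1]addn1 modnDml addn1. Qed.

Lemma ord_pred_ik j : ord_pred (ik j.+1) = ik j.
Proof. by rewrite -ordS_ik ordSK. Qed.

Lemma oadd_ik j (t : 'I_k) : oadd (ik j) t = ik (j + t).
Proof. by apply: val_inj; rewrite /= modnDml. Qed.

Definition ga (j : nat) : G := a (ik j).
Local Notation A := ga.
Let M j := m (ik j).
Let N j := n (ik j).

Lemma gaD j : A (j + k) = A j. Proof. by rewrite /ga ikD. Qed.

Lemma ga_rel j : A j * A j.+1 ^ M j * (A j)^-1 = A j.+1 ^ N j.
Proof. by case: hig => + _ => /(_ (ik j)); rewrite /ga ordS_ik. Qed.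

(** The subgroup generated by the a_i satisfies the relations; the induced map into it, followed by
    the inclusion, is the identity by uniqueness. *)
Lemma hig_gen x : gen (fun y => exists i, y = a i) x.
Proof.
pose S := gen (fun y => exists i, y = a i).
have sS : subgrp S by apply: gen_subgrp.
pose b i : subG sS := exist S (a i) (gen_in (ex_intro _ i erefl)).
have [R ext] := hig.
have Rb : hig_rels m n b.
  have bX i z : sval ((b i : subG sS) ^ z) = a i ^ z.
    exact: (hom_pow (@sval_hom _ _ sS)).
  by move=> i; apply: sub_eq; rewrite /= !bX R.
have [f [fM fb _]] := ext _ b Rb.
have [g [gM gb uniq]] := ext _ a R.
have -> : x = sval (f x).
  transitivity (g x); last first.
    by symmetry; apply: (uniq (fun x => sval (f x))) => [y z|i]; rewrite ?fM // fb.
  exact: (uniq id (fun _ _ => erefl) (fun _ => erefl) x).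
exact: svalP (f x).
Qed.

Lemma hig_lift (H : group) (b : nat -> H) : (forall j, b (j + k) = b j) ->
  (forall j, b j * b j.+1 ^ M j * (b j)^-1 = b j.+1 ^ N j) ->
  exists f : G -> H, is_hom f /\ forall j, f (A j) = b j.
Proof.
move=> bD R; have [_ ext] := hig.
have bE i j : i = j %[mod k] -> b i = b j.
  have H1 q r : b (r + q * k)%N = b r.
    by elim: q => [|q IH]; rewrite ?mul0n ?addn0 // mulSn [(k + _)%N]addnC addnA bD.
  by move=> E; rewrite (divn_eq i k) (divn_eq j k) E ![(_ + _ %% k)%N]addnC !H1.
have [|f [fM fb _]] := ext H (fun i : 'I_k => b i).
  move=> i; have := R i; rewrite /M /N ik_ord.
  by rewrite -(@bE i.+1 (ordS i)) //= modn_mod.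
by exists f; split=> // j; rewrite /A fb; apply: bE; rewrite modn_mod.
Qed.

Section Split.
Variable x : nat.
Let y := (x + (k - 2))%N.

Lemma hig_split :
  [/\ splits_off M N x y A, splits_off M N y y.+2 A,
      amalg (fun b => if b then Sg A x y else Sg A y y.+2) &
      forall z, Sg A x y z -> Sg A y y.+2 z -> gen (fun z => z = A y \/ z = A y.+2) z].
Proof.
have M0 j : M j != 0%R by case: (mn0 (ik j)).
have N0 j : N j != 0%R by case: (mn0 (ik j)).
(* Here k >= 4 enters: the chain x..y has at least two steps, as [chain_split] requires. *)
have yE : y = (x + (k - 4).+2)%N by rewrite /y; lia.
have y2E : y.+2 = (x + k)%N by rewrite /y; lia.
have [H [h hH]] := chain_exists M N x y; have [K [c hK]] := chain_exists M N y y.+2.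
have spH : splits_off M N x y h by move: (hH); rewrite yE; apply: chain_split.
have spK : splits_off M N y y.+2 c.
  by have := @chain_split M N M0 N0 y 0 K c; rewrite addn2; apply.
have [sH GH eH] := hH; have [sK GK eK] := hK.
have [f [fM fc]] := eH G A (fun j _ => ga_rel j).
have [g [gM gc]] := eK G A (fun j _ => ga_rel j).
(* The amalgamated free group is realized inside the product of H and K. Both projections are
   injective on it, so it is the graph of the isomorphism that matches a_x with a_(y+2) and a_y with
   a_y. *)
pose p : prodG H K := (h x, c y.+2); pose q : prodG H K := (h y, c y).
pose S := gen (fun z => z = p \/ z = q).
have sS : subgrp S by apply: gen_subgrp.
pose C := subG sS; pose jH (u : C) : H := (sval u).1; pose jK (u : C) : K := (sval u).2.
have jHM : is_hom jH by []. have jKM : is_hom jK by [].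
have jHI : injective jH.
  apply: (hom_inj jHM) => -[u Su] E; apply: sub_eq; rewrite /=.
  have [_ am _ pA qA] := spH.
  exact (@gen2_map_inj _ _ _ p q _ (@fst_hom H K) am pA qA u Su E).
have jKI : injective jK.
  apply: (hom_inj jKM) => -[u Su] E; apply: sub_eq; rewrite /=.
  have [_ am _ pA qA] := spK.
  have Su' : gen (fun z => z = q \/ z = p) u.
    by apply: gen_sub (Su) => z [] ->; [right|left].
  exact (@gen2_map_inj _ _ _ q p _ (@snd_hom H K) am pA qA u Su' E).
have xy : x < y by rewrite /y; lia.
have ag u : f (jH u) = g (jK u).
  case: u => u Su; rewrite /jH /jK /=; elim: Su => {u} [u [] ->| |u v _ IHu _ IHv|u _ IHu] /=.
  - by rewrite fc ?gc ?y2E ?gaD //; rewrite ?y2E; lia.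
  - by rewrite fc ?gc //; lia.
  - by rewrite (hom1 fM) (hom1 gM).
  - by rewrite fM gM IHu IHv.
  - by rewrite (homV fM) (homV gM) IHu.
have [|fI gI am inter] := pushout_amalg jHM jHI jKM jKI fM gM ag.
  move=> Q fH fK fHM fKM fag.
  (* The representative of j modulo k in the window x..x+k-1; [k * x - x] stands for -x modulo k. *)
  pose e j := (x + (j + (k * x - x)) %% k)%N.
  pose b j := if e j <= y then fH (h (e j)) else fK (c (e j)).
  have agx : fH (h x) = fK (c y.+2).
    exact: (fag (exist S p (gen_in (or_introl erefl)))).
  have agy : fH (h y) = fK (c y).
    exact: (fag (exist S q (gen_in (or_intror erefl)))).
  have eW j : x <= e j < x + k.
    by rewrite leq_addr ltn_add2l ltn_mod k_gt0.
  have eM j : e j = j %[mod k].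
    rewrite modnDmr addnCA subnKC ?leq_pmull ?k_gt0 //.
    by rewrite addnC mulnC modnMDl.
  have eD j : e (j + k)%N = e j by rewrite /e addnAC modnDr.
  clearbody e.
  have eE j j' : x <= j < x + k -> j = j' %[mod k] -> e j' = j.
    move=> jW E; have eW' := eW j'.
    suff : j - x = e j' - x %[mod k] by rewrite !modn_small; lia.
    have [x1 x2] : x <= j /\ x <= e j' by lia.
    by apply/eqP; rewrite -(eqn_modDr x) !subnK // eM E.
  have [j|j|F [FM Fb]] := @hig_lift Q b.
  - by rewrite /b eD.
  - have bE i : y <= i < x + k -> b i = fK (c i).
      move=> iW; rewrite /b (eE i i) //; last by lia.
      by case: ifP => // iy; have -> : i = y by lia.
    have bE' i : x <= i <= y -> b i = fH (h i).
      by move=> iW; rewrite /b (eE i i) //; [case/andP: iW => _ ->|lia].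
    have bb i i' : i = i' %[mod k] -> b i = b i'.
      by rewrite /b => E; rewrite (eE (e i) i') // eM.
    have SS : (e j).+1 = j.+1 %[mod k] by rewrite -(addn1 (e j)) -(addn1 j) -modnDml eM modnDml.
    rewrite -(bb _ _ (eM j)) -(bb _ _ SS) /M /N -(ik_eq (eM j)).
    have [ey|ey] := ltnP (e j) y.
      have ejW := eW j; rewrite !bE'; try lia.
      by rewrite -(homV fHM) -!(hom_pow fHM) -!fHM sH //; lia.
    have ejW := eW j; have [ex|ex] := ltnP (e j).+1 (x + k).
      by rewrite !bE; try lia; rewrite -(homV fKM) -!(hom_pow fKM) -!fKM sK //; lia.
    (* The relation that closes the circle: here e j = y+1, and its successor y+2 = x+k falls back
       to x, where [agx] matches the two definitions of b. *)
    have -> : b (e j).+1 = fK (c (e j).+1).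
      have -> : (e j).+1 = y.+2 by lia.
      rewrite -agx y2E (bb _ x) ?modnDr // bE' //; lia.
    by rewrite bE; try lia; rewrite -(homV fKM) -!(hom_pow fKM) -!fKM sK //; lia.
  exists F; split=> // z.
    apply: (hom_gen_ext (f := F \o f) _ fHM _ (GH z)) => [u v|_ [j ju ->]] /=.
      by rewrite fM FM.
    rewrite fc // Fb /b (eE j j) //; last by lia.
    by case/andP: ju => _ ->.
  apply: (hom_gen_ext (f := F \o g) _ fKM _ (GK z)) => [u v|_ [j ju ->]] /=.
    by rewrite gM FM.
  rewrite gc // Fb; have [jx|jx] := ltnP j (x + k).
    rewrite /b (eE j j) //; last by lia.
    by case: ifP => // iy; have -> : j = y by lia.
  have -> : j = y.+2 by lia.
  rewrite -agx /b (eE x y.+2) ?y2E ?modnDr //; last by lia.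
  by rewrite ifT //; lia.
have spHA : splits_off M N x y A by apply: splits_off_map spH.
have spKA : splits_off M N y y.+2 A by apply: splits_off_map spK => //; lia.
have EH z : Sg A x y z <-> exists u, z = f u.
  rewrite (Sg_map _ fM fc); split=> [[u [_ ->]]|[u ->]]; exists u => //.
have EK z : Sg A y y.+2 z <-> exists u, z = g u.
  rewrite (Sg_map _ gM gc); split=> [[u [_ ->]]|[u ->]]; exists u => //.
split=> //.
  by apply: amalg_eq am => -[] z; rewrite /pimage; symmetry; [apply: EH|apply: EK].
move=> z /EH Hz /EK Kz; have [[u Su] ->] := inter z Hz Kz; rewrite /jH /=.
elim: Su => {u} [u [] ->| |u v _ IHu _ IHv|u _ IHu] /=.
- by apply: gen_in; right; rewrite fc ?y2E ?gaD //; lia.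
- by apply: gen_in; left; rewrite fc //; lia.
- by rewrite (hom1 fM); apply: gen_one.
- by rewrite fM; apply: gen_mul.
- by rewrite (homV fM); apply: gen_inv.
Qed.

End Split.

End HigmanStructure.

(** * Rigidity of links *)

Lemma int_increasing_bij (p : int -> int) : {homo p : x y / (x < y)%R} ->
  (forall y, exists x, p x = y) -> forall x, p x = (p 0 + x)%R.
Proof.
move=> inc surj.
have mono x y : (p x < p y)%R -> (x < y)%R.
  move=> pxy; have [//|yx|xy] := ltrgtP x y; last by move: pxy; rewrite xy ltxx.
  by have := inc _ _ yx; lia.
have S x : p (x + 1)%R = (p x + 1)%R.
  have [z pz] := surj (p x + 1)%R.
  have xz : (x < z)%R by apply: mono; lia.
  have [zx|zx] : (z = x + 1)%R \/ (x + 1 < z)%R by lia.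
    by rewrite -zx.
  have h1 : (p x < p (x + 1))%R by apply: inc; lia.
  by have := inc _ _ zx; lia.
elim=> [|q IH|q IH]; first by rewrite addr0.
  by rewrite intS addrC S IH; lia.
have := S (- q.+1%:Z)%R; rewrite (_ : - q.+1%:Z + 1 = - q%:Z)%R; last lia.
by rewrite IH; lia.
Qed.

(** Nothing is assumed when y lies below both x and z, so only peaks of p are excluded directly. One
    inversion then forces p to decrease on its left ([c1]), next on its right ([c2]), and finally
    everywhere; a monotone bijection of Z is a translation up to sign. *)
Lemma int_order_rigid (p : int -> int) (R R' : int -> int -> int -> Prop) :
  injective p -> (forall y, exists x, p x = y) ->
  (forall x y z, R x y z <-> R' (p x) (p y) (p z)) ->
  (forall x y z, (x < y < z)%R -> R x y z) ->
  (forall x y z, x != z -> (x < y)%R -> (z < y)%R -> ~ R x y z) ->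
  (forall x y z, (x < y < z)%R \/ (z < y < x)%R -> R' x y z) ->
  (forall x y z, x != z -> (x < y)%R -> (z < y)%R -> ~ R' x y z) ->
  exists s : bool, forall x, p x = (p 0 + (if s then x else - x))%R.
Proof.
move=> inj surj RR' Rb Rm Rb' Rm'.
have ne x y : (x < y)%R -> p x <> p y by move=> xy /inj E; move: xy; rewrite E ltxx.
have a x y z : (x < y < z)%R -> ~ ((p x < p y)%R /\ (p z < p y)%R).
  move=> xyz [h1 h2]; have /RR' := Rb _ _ _ xyz; apply: Rm' => //.
  by apply/eqP/ne; lia.
have b x y z : (x < y < z)%R -> ~ ((p x < p z < p y)%R \/ (p y < p z < p x)%R).
  move=> xyz h; apply: (Rm x z y); [lia|lia|lia|].
  by apply/RR'/Rb'.
have c1 x y o : (x < y)%R -> (p y < p x)%R -> (o < x)%R -> (p x < p o)%R.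
  move=> xy yx ox; have := a o x y; have := ne _ _ ox; lia.
have c2 x y z : (x < y)%R -> (p y < p x)%R -> (y < z)%R -> (p z < p y)%R.
  move=> xy yx yz; have nzx := ne x z; have nzy := ne _ _ yz.
  have [//|H] : (p z < p y)%R \/ (p x < p z)%R by have := b x y z; lia.
  (* If p turned upwards after the inversion, the values p (x - i) would grow with i and yet stay
     below p z. *)
  have low (i : nat) : (p x + i%:Z <= p (x - i%:Z) /\ p (x - i%:Z) < p z)%R.
    elim: i => [|i [IH1 IH2]]; first by rewrite subr0 addr0.
    have h1 : (p (x - i%:Z) < p (x - i.+1%:Z))%R.
      have [->|i0] := posnP i; first by rewrite subr0; apply: (c1 x y); lia.
      by apply: (c1 _ x); [lia|apply: (c1 x y); lia|lia].
    have h2 : (p x < p (x - i.+1%:Z))%R by apply: (c1 x y); lia.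
    split; first lia.
    have := b (x - i.+1%:Z)%R x z; have := ne (x - i.+1%:Z)%R z; lia.
  by have := low `|p z - p x|%N; lia.
have [[x [y [xy yx]]]|noinv] :=
    classic (exists x y, (x < y)%R /\ (p y < p x)%R); last first.
  exists true; apply: int_increasing_bij => // x y xy.
  case: (ltrgtP (p x) (p y)) => // [h|/inj E]; first by case: noinv; exists x, y.
  by move: xy; rewrite E ltxx.
have dec u v : (u < v)%R -> (p v < p u)%R.
  move=> uv; pose o := (Num.min x u - 1)%R.
  have ox : (o < x)%R by rewrite /o; lia.
  have ou : (o < u)%R by rewrite /o; lia.
  have pox : (p x < p o)%R by apply: (c1 x y).
  suff pou : (p u < p o)%R by apply: (c2 o u).
  case: (ltrgtP u x) => [ux|xu|->//]; last by have := c2 o x u; lia.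
  by have := c1 u x o; have := c1 x y u; lia.
exists false => z; have := @int_increasing_bij (fun x => - p x)%R _ _ z.
move=> H; suff : (- p z = - p 0 + z)%R by lia.
apply: H => [u v /dec|w]; first lia.
by have [v pv] := surj (- w)%R; exists v; rewrite pv opprK.
Qed.

Section LocalStructure.
Variables (k : nat) (m n : 'I_k -> int) (G : group) (a : 'I_k -> G).
Hypothesis k4 : 4 <= k.
Hypothesis mn0 : forall i, m i != 0%R /\ n i != 0%R.
Hypothesis mn : forall i, `|m i| < `|n i|.
Hypothesis hig : is_Hig m n a.

Local Notation ik := (ik k4).
Local Notation A := (ga a k4).
Local Notation M := (fun j => m (ik j)).
Local Notation N := (fun j => n (ik j)).

Let M0 j : M j != 0%R. Proof. by case: (mn0 (ik j)). Qed.
Let N0 j : N j != 0%R. Proof. by case: (mn0 (ik j)). Qed.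
Let MN j : `|M j| < `|N j|. Proof. exact: mn. Qed.

Lemma local_BS j : exists (X : group) (t b : X) (i : X -> G),
  [/\ is_BS (M j) (N j) t b, is_hom i, injective i & (i t = A j /\ i b = A j.+1)].
Proof.
have [[[X [t [b [i [BS iM iI it ib]]]]] _ _ _ _] _ _ _] := hig_split k4 mn0 hig j.
by exists X, t, b, i.
Qed.

Lemma Sg_local (X : group) (t b : X) (i : X -> G) j g :
  is_BS (M j) (N j) t b -> is_hom i -> i t = A j -> i b = A j.+1 ->
  Sg A j j.+1 g -> exists x, g = i x.
Proof.
move=> _ iM it ib; have sI : subgrp (fun g => exists x, g = i x).
  split; first by exists gone; rewrite (hom1 iM).
    by move=> _ _ [x ->] [y ->]; exists (x * y); rewrite iM.
  by move=> _ [x ->]; exists x^-1; rewrite (homV iM).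
apply: (gen_min sI) => _ [l jl ->].
by have [->|->] : l = j \/ l = j.+1; [lia|exists t|exists b].
Qed.

Lemma ga_torsionfree j z : A j ^ z = gone -> z = 0%R.
Proof.
have [X [t [b [i [BS iM iI [it ib]]]]]] := local_BS j.
rewrite -it -(hom_pow iM) -(hom1 iM) => /iI E.
by have [//|] := bs_pow_eq (M0 j) (N0 j) BS (i := z) (y := 0%R).
Qed.

Lemma ga_pow_inj j z w : A j ^ z = A j ^ w -> z = w.
Proof.
move=> E; suff : (z - w = 0)%R by lia.
by apply: (@ga_torsionfree j); rewrite gpowD gpowN E mulgV.
Qed.

Lemma ga_pow_eq j z w : A j ^ z = A j.+1 ^ w -> z = 0%R /\ w = 0%R.
Proof.
have [X [t [b [i [BS iM iI [it ib]]]]]] := local_BS j.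
rewrite -it -ib -!(hom_pow iM) => /iI; exact: bs_pow_eq BS _ _.
Qed.

Lemma ga_exponents j i y l w : A j ^ i * A j.+1 ^ y * A j ^ l = A j.+1 ^ w ->
  l = (- i)%R.
Proof.
have [X [t [b [f [BS fM fI [ft fb]]]]]] := local_BS j.
rewrite -ft -fb -!(hom_pow fM) -!fM => /fI; exact: bs_pow_exponents BS _ _ _ _.
Qed.

Lemma ga_malnormal j g i l : Sg A j j.+1 g -> i != 0%R ->
  g * A j ^ i * g^-1 = A j ^ l -> exists z, g = A j ^ z.
Proof.
have [X [t [b [f [BS fM fI [ft fb]]]]]] := local_BS j.
move=> /(Sg_local BS fM ft fb) [x ->] i0.
rewrite -ft -!(hom_pow fM) -(homV fM) -!fM => /fI.
by case/(bs_malnormal (M0 j) (N0 j) BS (MN j) i0) => z ->; exists z; rewrite (hom_pow fM).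
Qed.

Lemma ga_conj_pow j g i y : Sg A j j.+1 g -> g * A j ^ i * g^-1 = A j.+1 ^ y -> i = 0%R.
Proof.
have [X [t [b [f [BS fM fI [ft fb]]]]]] := local_BS j.
move=> /(Sg_local BS fM ft fb) [x ->].
rewrite -ft -fb -!(hom_pow fM) -(homV fM) -!fM => /fI; exact: bs_conj_pow BS _ _ _.
Qed.

Lemma ga_commens_conj j g : Sg A j j.+1 g ->
  exists y w, [/\ y != 0%R, w != 0%R & g * A j.+1 ^ y * g^-1 = A j.+1 ^ w].
Proof.
have [X [t [b [f [BS fM fI [ft fb]]]]]] := local_BS j.
move=> /(Sg_local BS fM ft fb) [x ->].
have [y [w [y0 w0 E]]] := bs_commens_conj (M0 j) (N0 j) BS x.
by exists y, w; split=> //; rewrite -fb -!(hom_pow fM) -(homV fM) -!fM E.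
Qed.

Definition commens (j : nat) (i y : int) :=
  exists w, A j ^ i * A j.+1 ^ y * A j ^ (- i)%R = A j.+1 ^ w.

Lemma commensE j (X : group) (t b : X) (f : X -> G) (e : bool) (p : nat) y :
  is_hom f -> injective f -> f t = A j -> f b = A j.+1 ->
  commens j (if e then p%:Z else - p%:Z)%R y <-> bscommens t b e p y.
Proof.
move=> fM fI ft fb; rewrite /commens /bscommens -ft -fb.
have E w : (f t ^ (if e then p%:Z else - p%:Z)%R * f b ^ y *
    f t ^ (- (if e then p%:Z else - p%:Z))%R = f b ^ w) <->
    te t e ^ p%:Z%R * b ^ y * (te t e ^ p%:Z%R)^-1 = b ^ w.
  rewrite -!(hom_pow fM) -!fM; have -> : te t e ^ p%:Z%R = t ^ (if e then p%:Z else - p%:Z)%R.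
    by case: e => //=; rewrite gpowV gpowN.
  by rewrite -gpowN; split=> [/fI|->].
by split=> [] [w /E]; exists w.
Qed.

Lemma commens_le j i l y : (0 <= l <= i)%R \/ (i <= l <= 0)%R ->
  commens j i y -> commens j l y.
Proof.
have [X [t [b [f [BS fM fI [ft fb]]]]]] := local_BS j.
have CE e p := @commensE j X t b f e p y fM fI ft fb.
have key e p q : q <= p -> commens j (if e then p%:Z else - p%:Z)%R y ->
    commens j (if e then q%:Z else - q%:Z)%R y.
  by move=> qp /CE H; apply/CE; apply: (bscommens_le (M0 j) (N0 j) BS) H.
case=> h.
  have [iE lE] : i = `|i|%N /\ l = `|l|%N by lia.
  by rewrite iE lE; apply: (key true); lia.
have [iE lE] : (i = - `|i|%N%:Z /\ l = - `|l|%N%:Z)%R by lia.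
by rewrite iE lE; apply: (key false); lia.
Qed.

Lemma commens_pos j i : (0 < i)%R -> exists y, commens j i y /\ ~ commens j (-1)%R y.
Proof.
have [X [t [b [f [BS fM fI [ft fb]]]]]] := local_BS j.
have CE e p y := @commensE j X t b f e p y fM fI ft fb.
case: i => [[|p]|p] // _.
have [y [Hy ny]] := bs_commens_pos (M0 j) (N0 j) BS (MN j) p.
by exists y; split; [apply/(CE true)|move=> /(CE false 1)].
Qed.

Lemma commens1 j y : commens j 1%R y <-> (M j %| y)%Z.
Proof.
have [X [t [b [f [BS fM fI [ft fb]]]]]] := local_BS j.
by rewrite (@commensE j X t b f true 1 y fM fI ft fb) (bscommens_dvd (M0 j) (N0 j) BS true).
Qed.

Lemma commensN1 j y : commens j (-1)%R y <-> (N j %| y)%Z.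
Proof.
have [X [t [b [f [BS fM fI [ft fb]]]]]] := local_BS j.
by rewrite (@commensE j X t b f false 1 y fM fI ft fb) (bscommens_dvd (M0 j) (N0 j) BS false).
Qed.

Lemma commens_shrink j (p : nat) y : commens j (- p%:Z)%R y -> y != 0%R -> p < `|y|.
Proof.
have [X [t [b [f [BS fM fI [ft fb]]]]]] := local_BS j.
move=> /(@commensE j X t b f false p y fM fI ft fb) [w].
exact: (bs_shrink (M0 j) (N0 j) BS (MN j)).
Qed.

Lemma ga_relX j z : A j * A j.+1 ^ (M j * z)%R * (A j)^-1 = A j.+1 ^ (N j * z)%R.
Proof. by rewrite !gpowM -(ga_rel k4 hig j) conj_pow. Qed.

End LocalStructure.

Section LinkRigidity.
Variables (k : nat) (m n : 'I_k -> int) (G : group) (a : 'I_k -> G).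
Hypothesis k4 : 4 <= k.
Hypothesis mn0 : forall i, m i != 0%R /\ n i != 0%R.
Hypothesis mn : forall i, `|m i| < `|n i|.
Hypothesis hig : is_Hig m n a.

Local Notation ik := (ik k4).
Local Notation A := (ga a k4).
Local Notation M := (fun j => m (ik j)).
Local Notation N := (fun j => n (ik j)).
Local Notation commens := (commens a k4).

Definition eqv (j : nat) (x y : G) := exists z, y = x * A j ^ z.

Lemma eqv_sym j x y : eqv j x y -> eqv j y x.
Proof. by case=> z ->; exists (- z)%R; rewrite gpowN mulgK. Qed.

Lemma eqv_trans j x y w : eqv j x y -> eqv j y w -> eqv j x w.
Proof. by case=> z -> [z' ->]; exists (z + z')%R; rewrite gpowD gmulA. Qed.

Lemma eqv_pow j x z : eqv j x (x * A j ^ z). Proof. by exists z. Qed.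

(* Stated in terms of cosets of <A j> and <A j.+1> only, hence transported by
   eqv_map; it holds when y lies between x and z and fails when y exceeds both. *)
Definition linkR j g x y z := forall u v,
  eqv j.+1 (g * A j ^ x) u -> eqv j.+1 (g * A j ^ z) v -> eqv j u v ->
  exists w, eqv j.+1 (g * A j ^ y) w /\ eqv j w u.

Lemma linkR_sym j g x y z : linkR j g x y z -> linkR j g z y x.
Proof.
move=> R u v zu xv uv; have [w [yw wv]] := R v u xv zu (eqv_sym uv).
by exists w; split=> //; apply: eqv_trans wv (eqv_sym uv).
Qed.

Lemma linkR_eq j (g : G) x z i s r : g * A j ^ x * A j.+1 ^ i * A j ^ s = g * A j ^ z * A j.+1 ^ r ->
  A j ^ (x - z)%R * A j.+1 ^ i * A j ^ s = A j.+1 ^ r.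
Proof.
move=> E; apply: (@mulIl _ (g * A j ^ z)); rewrite -E !gmulA; congr (_ * _ * _).
by rewrite -gmulA -gpowD; congr (_ * _ ^ _); lia.
Qed.

Lemma linkR_between j g x y z : (x < y < z)%R \/ (z < y < x)%R -> linkR j g x y z.
Proof.
move=> xyz u v [i ->] [r ->] [s /esym /linkR_eq E].
have sE : s = (- (x - z))%R := ga_exponents mn0 hig E; subst s.
have [w E'] : commens j (x - y)%R i.
  by apply: (commens_le mn0 hig (i := (x - z)%R)); [lia|exists r].
exists (g * A j ^ y * A j.+1 ^ w); split; first exact: eqv_pow.
exists (x - y)%R; rewrite -E' -!gmulA -gpowD addNr gpow0 mulg1 !gmulA; congr (_ * _).
by rewrite -gmulA -gpowD; congr (_ * _ ^ _); lia.
Qed.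

(** By [commens_pos] some power of a_(j+1) stays in its cyclic group under conjugation by a_j^(x-z)
    but not by a_j^-1. It links the cosets at x and z, and a link with y would allow conjugation by
    a_j^(x-y), a negative power. *)
Lemma linkR_above j g x y z : x != z -> (x < y)%R -> (z < y)%R -> ~ linkR j g x y z.
Proof.
wlog zx : x z / (z < x)%R.
  move=> H xz xy zy; have [xz'|zx|E] := ltrgtP x z; last by move: xz; rewrite E eqxx.
    by move/linkR_sym; apply: H; rewrite // eq_sym.
  exact: H.
move=> _ xy zy R; have xz : (0 < x - z)%R by lia.
have [i [[r E] nE]] := commens_pos k4 mn0 mn hig j xz.
case: nE; have [|||_ [[q ->] [s E']]] := R (g * A j ^ x * A j.+1 ^ i) (g * A j ^ z * A j.+1 ^ r).
- exact: eqv_pow.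
- exact: eqv_pow.
- exists (z - x)%R; rewrite -E opprB !gmulA; congr (_ * _ * _).
  by rewrite -gmulA -gpowD; congr (_ * _ ^ _); lia.
have {}E' : g * A j ^ x * A j.+1 ^ i * A j ^ (- s)%R = g * A j ^ y * A j.+1 ^ q.
  by rewrite E' gpowN mulgK.
have E2 := linkR_eq E'; have sE := ga_exponents mn0 hig E2.
apply: (commens_le mn0 hig (i := (x - y)%R)); first lia.
by exists q; rewrite -sE.
Qed.

Section LinkMap.
Variables (f h : G -> G).
Hypotheses (fK : cancel f h) (hK : cancel h f).

Definition eqv_map j l := forall x y, eqv j x y <-> eqv l (f x) (f y).

Lemma link_affine j l : eqv_map j l -> eqv_map j.+1 l.+1 ->
  forall g, exists s : bool, forall z,
    f (g * A j ^ z) = f g * A l ^ (if s then z else - z)%R.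
Proof.
move=> f0 f1 g.
have P z : exists w, f (g * A j ^ z) = f g * A l ^ w by apply/f0/eqv_pow.
pose p z := sval (constructive_indefinite_description _ (P z)).
have pE z : f (g * A j ^ z) = f g * A l ^ p z by exact: svalP (constructive_indefinite_description _ (P z)).
have [|w|x y z|x y z xyz||||s ps] := @int_order_rigid p (linkR j g) (linkR l (f g)).
- move=> x y xy; apply: (ga_pow_inj mn0 hig (j := j)); apply: (@mulIl _ g).
  by apply: (can_inj fK); rewrite !pE xy.
- have /f0 : eqv l (f g) (f (h (f g * A l ^ w))) by rewrite hK; apply: eqv_pow.
  case=> z E; exists z; apply: (ga_pow_inj mn0 hig (j := l)); apply: (@mulIl _ (f g)).
  by rewrite -pE -E hK.
- split=> R u v.
    rewrite -!pE -(hK u) -(hK v) => /f1 xu /f1 zv /f0 uv.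
    have [w [yw wu]] := R _ _ xu zv uv; exists (f w).
    by split; [apply/f1|apply/f0].
  move=> /f1 xu /f1 zv /f0 uv; rewrite !pE in xu zv.
  have [w [yw wu]] := R _ _ xu zv uv; exists (h w).
  by split; [apply/f1|apply/f0]; rewrite hK ?pE.
- by apply: linkR_between; left.
- exact: linkR_above.
- exact: linkR_between.
- exact: linkR_above.
exists s => z; rewrite pE ps; suff -> : p 0%R = 0%R by rewrite add0r.
apply: (ga_torsionfree mn0 hig (j := l)); apply: (@mulIl _ (f g)).
by rewrite -pE gpow0 !mulg1.
Qed.

(** By [link_affine] the relation at j is carried, up to signs, to a relation at l. A wrong sign on
    the stable letter would give |m_j| = |q| |n_l| and |n_j| = |q| |m_l| with q nonzero, against |m|
    < |n| at both places. *)
Lemma link_relation j l : eqv_map j l -> eqv_map j.+1 l.+1 -> eqv_map j.+2 l.+2 ->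
  forall g, f (g * A j) = f g * A l.
Proof.
move=> f0 f1 f2 g.
have [s1 E1] := link_affine f0 f1 g.
have Eg : f (g * A j) = f g * A l ^ (if s1 then 1 else -1)%R by rewrite -E1 gpow1.
have [s2 E2] := link_affine f1 f2 (g * A j).
have [s3 E3] := link_affine f0 f1 (g * A j * A j.+1 ^ M j).
have [s4 E4] := link_affine f1 f2 g.
pose e (s : bool) (z : int) := if s then z else (- z)%R.
have E : A l ^ e s1 1%R * A l.+1 ^ e s2 (M j) * A l ^ e s3 (-1)%R = A l.+1 ^ e s4 (N j).
  apply: (@mulIl _ (f g)); rewrite -E4 -(ga_rel k4 hig j) !gmulA.
  by rewrite -Eg -E2 -E3 gpowN gpow1.
have ex := ga_exponents mn0 hig E; rewrite Eg.
case: s1 {E1 Eg} E ex => E ex; first by rewrite gpow1.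
rewrite ex in E; have C : commens l (-1)%R (e s2 (M j)) by exists (e s4 (N j)).
move: C => /(commensN1 k4 mn0 hig) /dvdzP [q qE]; exfalso.
have R := ga_relX k4 hig l q; rewrite -[N _]/(n (ik l)) in R.
have : A l.+1 ^ e s4 (N j) = A l.+1 ^ (M l * q)%R.
  rewrite -E qE mulrC -R /e opprK gpowN gpow1; gsimp => //.
move/(ga_pow_inj mn0 hig) => nE.
have q0 : q != 0%R.
  have [mj _] := mn0 (ik j); apply/eqP => q0; move: qE; rewrite q0 mul0r /e /=.
  by case: (s2); lia.
have := mn (ik j); have := mn (ik l).
have e1 : `|m (ik j)| = (`|q| * `|n (ik l)|)%N by rewrite -abszM -qE /e /=; case: (s2); rewrite ?abszN.
have e2 : `|n (ik j)| = (`|m (ik l)| * `|q|)%N by rewrite -abszM -nE /e /=; case: (s4); rewrite ?abszN.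
have : 0 < `|q| by rewrite absz_gt0.
rewrite e1 e2; nia.
Qed.

Lemma link_pow j l : (forall g, f (g * A j) = f g * A l) ->
  forall g z, f (g * A j ^ z) = f g * A l ^ z.
Proof.
move=> fA g z; elim: z g => [|p IH|p IH] g; first by rewrite !gpow0 !mulg1.
  by rewrite intS addrC !gpowS !gmulA fA IH.
apply: (@mulIr _ (A l)); rewrite -fA -!gmulA -!gpowS.
by rewrite (_ : - p.+1%:Z + 1 = - p%:Z)%R ?IH //; lia.
Qed.

(** The relation at j is carried to a consequence of the relation at l. Applied also to the inverse
    map, this leaves q = 1 or q = -1, the condition defining F_sigma. *)
Lemma link_dvd j l : (forall g, f (g * A j) = f g * A l) ->
  (forall g, f (g * A j.+1) = f g * A l.+1) ->
  exists q, M j = (q * M l)%R /\ N j = (q * N l)%R.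
Proof.
move=> fA0 /link_pow fA1; have fA := link_pow fA0.
have E : A l ^ 1%R * A l.+1 ^ M j * A l ^ (-1)%R = A l.+1 ^ N j.
  apply: (@mulIl _ (f gone)); rewrite -fA1 -(ga_rel k4 hig j) gpow1 gpowN gpow1 !gmulA.
  have V g : f (g * (A j)^-1) = f g * (A l)^-1 by have := fA g (-1)%R; rewrite !gpowN !gpow1.
  by rewrite V fA1 fA0.
have /(commens1 k4 mn0 hig) /dvdzP [q qE] : commens l 1%R (M j) by exists (N j).
exists q; split=> //; apply: (ga_pow_inj mn0 hig (j := l.+1)).
rewrite -E qE gpow1 gpowN gpow1 (mulrC q (m _)) (mulrC q (n _)).
exact: ga_relX.
Qed.

(* Stable and base letters are exchanged by the map. *)
Lemma link_swap_unit j l : eqv_map j l.+1 -> eqv_map j.+1 l -> `|M l| = 1%N.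
Proof.
move=> f0 f1; pose g0 := h gone; pose g1 := h (A l.+1).
have [p g1E] : eqv j g0 g1.
  by apply/f0; rewrite !hK; exists 1%R; rewrite gmul1 gpow1.
have SA : Sg A j j.+1 (A j ^ p).
  by apply: (sgX (Sg_sub _ _ _)); apply: Sg_in; lia.
(* Commensuration closes a square g0, g1, x, x' with sides in cosets of <a_j> and <a_(j+1)>. One
   side of its image runs from 1 to a_(l+1), so conjugation by a nonzero power of a_l keeps a_(l+1)
   itself in its cyclic group. *)
have [y [w [y0 w0 E]]] := ga_commens_conj mn0 hig SA.
pose x' := g0 * A j.+1 ^ w; pose x := g1 * A j.+1 ^ y.
have xE : x = x' * A j ^ p by rewrite /x /x' g1E -E; gsimp.
have /f1 [c fx'] : eqv j.+1 g0 x' by apply: eqv_pow.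
have /f1 [d fx] : eqv j.+1 g1 x by apply: eqv_pow.
have /f0 [e fxx] : eqv j x' x by rewrite xE; apply: eqv_pow.
rewrite !hK ?gmul1 in fx fx'; rewrite fx' fx in fxx.
have E' : A l ^ (- c)%R * A l.+1 ^ 1%R * A l ^ d = A l.+1 ^ e.
  by rewrite gpow1 -gmulA fxx gpowN gmulA gmulV gmul1.
have dE := ga_exponents mn0 hig E'; rewrite dE in E'.
have c0 : c != 0%R.
  apply/eqP => c0; move: fx'; rewrite c0 gpow0 -(hK gone) -/g0 => /(can_inj fK).
  move=> E2; case/eqP: w0; apply: (ga_torsionfree mn0 hig (j := j.+1)).
  by apply: (@mulIl _ g0); rewrite mulg1.
have C : commens l (- c)%R 1%R by exists e.
have := mn (ik l); have [m0 _] := mn0 (ik l).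
have [cp|cn] : (1 <= - c)%R \/ (- c <= -1)%R by lia.
  have : commens l 1%R 1%R by apply: (commens_le mn0 hig (i := (- c)%R)); [lia|].
  by move/(commens1 k4 mn0 hig); rewrite dvdzE /= dvdn1 => /eqP.
have : commens l (-1)%R 1%R by apply: (commens_le mn0 hig (i := (- c)%R)); [lia|].
by move/(commensN1 k4 mn0 hig); rewrite dvdzE /= dvdn1 => /eqP ->; lia.
Qed.

End LinkMap.

(** Since |m_j| = 1, every power of a_(j+1) can be carried across a_j. In the image, a fixed
    a_(l+1)^w could then be contracted by any number of conjugations by a_l^-1, while
    [commens_shrink] stops this before |w| of them. *)
Lemma link_no_swap (f h : G -> G) j l : cancel f h -> cancel h f ->
  eqv_map f j l.+1 -> eqv_map f j.+1 l -> False.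
Proof.
move=> fK hK f0 f1.
have Mj : `|M j| = 1%N.
  by apply: (link_swap_unit hK fK (j := l)) => x y; rewrite (f0, f1) !hK.
have [w wE] : eqv l.+1 (f gone) (f (A j)).
  by apply/f0; exists 1%R; rewrite gmul1 gpow1.
have w0 : w != 0%R.
  apply/eqP => w0; move: wE; rewrite w0 gpow0 mulg1 => /(can_inj fK) E.
  by have := @ga_torsionfree _ _ _ _ _ k4 mn0 hig j 1%R; rewrite gpow1 E => /(_ erefl).
pose c := Posz `|w|%N.
have /f1 [z xE] : eqv l (f (A j)) (f (h (f (A j) * A l ^ c))) by rewrite hK; apply: eqv_pow.
have /dvdzP [q zE] : (M j %| z)%Z by rewrite dvdzE Mj dvd1n.
pose y := A j.+1 ^ (N j * q)%R.
have xE' : h (f (A j) * A l ^ c) = y * A j.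
  by rewrite xE zE mulrC /y -(ga_relX k4 hig j q) mulgKV.
have /f1 [d yE] : eqv j.+1 gone y by rewrite -[y]gmul1; apply: eqv_pow.
have /f0 [e xyE] : eqv j y (y * A j) by exists 1%R; rewrite gpow1.
have E : A l ^ (- d)%R * A l.+1 ^ w * A l ^ c = A l.+1 ^ e.
  apply: (@mulIl _ (f y)); rewrite -xyE -xE' hK wE yE gpowN; gsimp => //.
have cE := ga_exponents mn0 hig E; rewrite opprK in cE; subst d.
have C : commens l (- Posz `|w|%N)%R w by exists e; rewrite opprK.
by have := commens_shrink mn0 mn hig C w0; rewrite ltnn.
Qed.

Lemma link_rigid (f h : G -> G) (t : nat) : cancel f h -> cancel h f ->
  (forall j, eqv_map f j (j + t)%N) ->
  (forall x y, f (x * y) = f x * (f gone)^-1 * f y) /\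
  (forall j, f (A j) = f gone * A (j + t)%N) /\
  (forall j, (M (j + t)%N = M j /\ N (j + t)%N = N j) \/
    (M (j + t)%N = (- M j)%R /\ N (j + t)%N = (- N j)%R)).
Proof.
move=> fK hK fE.
have fA j g : f (g * A j) = f g * A (j + t)%N.
  exact: (link_relation fK hK (fE j) (fE j.+1) (fE j.+2)).
have hE j : eqv_map h (j + t)%N j by move=> x y; rewrite (fE j) !hK.
have hA j g : h (g * A (j + t)%N) = h g * A j.
  exact: (link_relation hK fK (hE j) (hE j.+1) (hE j.+2)).
split; [|split].
- move=> x y; have := hig_gen hig y; move=> Gy; move: x; elim: Gy => {y}.
  + move=> _ [i ->] x; rewrite -(ik_ord k4 i) -[a _]/(A i) fA.
    by rewrite -[A i in RHS]gmul1 fA; gsimp.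
  + by move=> x; rewrite mulg1; gsimp.
  + by move=> y z _ IHy _ IHz x; rewrite gmulA IHz IHy (IHz y); gsimp.
  + move=> y _ IH x; have E1 := IH (x * y^-1); have E2 := IH y^-1.
    rewrite mulgKV in E1; rewrite gmulV in E2.
    apply: (@mulIr _ ((f gone)^-1 * f y)); rewrite gmulA -E1.
    by rewrite -!gmulA (gmulA (f y^-1)) -E2 gmulV mulg1.
- by move=> j; rewrite -[A j]gmul1 fA.
- move=> j.
  have [q [mq nq]] := link_dvd (fA j) (fA j.+1).
  have [r [mr nr]] := link_dvd (hA j) (hA j.+1).
  have [m0 _] := mn0 (ik j).
  have rq : (r * q = 1)%R.
    move: m0 mq mr; rewrite /=; move: (m (ik j)) (m (ik (j + t))) => x y x0 xE yE.
    by apply: (mulIf x0); rewrite mul1r [RHS]xE yE; ring.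
  have q1 : `|q| = 1%N.
    have : `|(r * q)%R| = 1%N by rewrite rq.
    by rewrite abszM => /eqP; rewrite muln_eq1 => /andP[_ /eqP].
  have [qE|qE] : q = 1%R \/ q = (-1)%R by lia.
    by left; rewrite mq nq qE !mul1r.
  by right; rewrite mq nq qE !mulN1r !opprK.
Qed.

End LinkRigidity.

Lemma setoid_bij_iff (T : Type) (eqT : T -> T -> Prop) (f : T -> T) :
  (forall x y, eqT x y -> eqT y x) -> (forall x y z, eqT x y -> eqT y z -> eqT x z) ->
  setoid_bij eqT f -> forall x y, eqT x y <-> eqT (f x) (f y).
Proof.
move=> sym trans [fE [g [gE gf _]]] x y; split=> [/fE //|/gE E].
exact: trans (sym _ _ (gf x)) (trans _ _ _ E (gf y)).
Qed.

(** * The developed complex *)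

Section AutX.
Variables (k : nat) (m n : 'I_k -> int) (G : group) (a : 'I_k -> G).
Hypothesis k4 : 4 <= k.
Hypothesis mn0 : forall i, m i != 0%R /\ n i != 0%R.
Hypothesis mn : forall i, `|m i| < `|n i|.
Hypothesis hig : is_Hig m n a.

Local Notation ik := (ik k4).
Local Notation A := (ga a k4).
Local Notation Gi := (Gi a).
Local Notation Ei := (Ei a).
Local Notation veq := (veq a).
Local Notation eeq := (eeq a).
Local Notation eqv := (eqv a k4).

Lemma GiE j x : Gi (ik j.+1) x <-> Sg A j j.+1 x.
Proof.
rewrite /Defs.Gi ord_pred_ik; split; apply: gen_sub => y.
  by case=> ->; [exists j|exists j.+1] => //; lia.
by case=> l jl ->; have [->|->] : l = j \/ l = j.+1; [lia|left|right].
Qed.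

Lemma EiE j x : Ei (ik j) x <-> exists z, x = A j ^ z.
Proof. exact: gen_cyc. Qed.

Lemma ik_pred (i : 'I_k) : exists j, i = ik j.+1.
Proof.
exists (i + k - 1)%N; rewrite (_ : (_ - 1).+1 = i + k)%N ?ikD ?ik_ord //.
by have := ltn_ord i; lia.
Qed.

Lemma Ei_Gi i x : Ei i x -> Gi i x /\ Gi (ordS i) x.
Proof.
have [j ->] := ik_pred i; move=> Ex; rewrite ordS_ik !GiE.
have [z ->] := (EiE _ _).1 Ex.
by split; apply: (sgX (Sg_sub _ _ _)); apply: Sg_in; lia.
Qed.

Lemma eeqE j x y : eeq (ik j, x) (ik j, y) <-> eqv j x y.
Proof.
rewrite /Defs.eeq /=; split=> [[_ /EiE [z E]]|[z ->]].
  by exists z; rewrite -E gmulA mulgV gmul1.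
by split=> //; apply/EiE; exists z; rewrite gmulA gmulV gmul1.
Qed.

Lemma veq_refl v : veq v v.
Proof. by split=> //; rewrite gmulV; apply: gen_one. Qed.

Lemma veq_sym v w : veq v w -> veq w v.
Proof.
case: v w => [i x] [j y] [/= <- H]; split=> //=.
by move: (gen_inv H); rewrite invMg invgK.
Qed.

Lemma veq_trans v w u : veq v w -> veq w u -> veq v u.
Proof.
case: v w u => [i x] [j y] [l z] [/= <- H] [/= <- H']; split=> //=.
by move: (gen_mul H H'); rewrite !gmulA mulgK.
Qed.

Lemma eeq_refl v : eeq v v.
Proof. by split=> //; rewrite gmulV; apply: gen_one. Qed.

Lemma eeq_sym v w : eeq v w -> eeq w v.
Proof.
case: v w => [i x] [j y] [/= <- H]; split=> //=.
by move: (gen_inv H); rewrite invMg invgK.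
Qed.

Lemma eeq_trans v w u : eeq v w -> eeq w u -> eeq v u.
Proof.
case: v w u => [i x] [j y] [l z] [/= <- H] [/= <- H']; split=> //=.
by move: (gen_mul H H'); rewrite !gmulA mulgK.
Qed.

Lemma eeq_veq i j x y : eeq (i, x) (j, y) -> veq (i, x) (j, y) /\ veq (ordS i, x) (ordS j, y).
Proof. by case=> /= <- /Ei_Gi [H1 H2]; split; split. Qed.

Lemma edge_vert_eeq e e' v : eeq e e' -> edge_vert a e v -> edge_vert a e' v.
Proof.
case: e e' => [i x] [j y] /eeq_veq [H1 H2] [] H; [left|right].
  exact: veq_trans H H1.
exact: veq_trans H H2.
Qed.

Section Surjective.
Variables (fV : vert k G -> vert k G) (fE : edge k G -> edge k G) (fF : face G -> face G).
Hypothesis aut : is_autX a fV fE fF.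

Let fVE v w : veq v w <-> veq (fV v) (fV w).
Proof. by case: aut => H _ _ _ _; apply: setoid_bij_iff H _ _; [apply: veq_sym|apply: veq_trans]. Qed.

Let fEE v w : eeq v w <-> eeq (fE v) (fE w).
Proof. by case: aut => _ H _ _ _; apply: setoid_bij_iff H _ _; [apply: eeq_sym|apply: eeq_trans]. Qed.

Definition dE (c : G) (i : 'I_k) : 'I_k := (fE (i, c)).1.
Definition dV (c : G) (i : 'I_k) : 'I_k := (fV (i, c)).1.

Lemma fE_face c i : eeq (fE (i, c)) (dE c i, fF c).
Proof.
have [_ _ _ _ inc] := aut.
have /inc [j E] : face_edge a c (i, c) by exists i; apply: eeq_refl.
by rewrite /dE; case: (E) => ->.
Qed.

Lemma fV_edge c i j : j = i \/ j = ordS i ->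
  veq (fV (j, c)) (dV c j, fF c) /\ (dV c j = dE c i \/ dV c j = ordS (dE c i)).
Proof.
have [_ _ _ inc _] := aut => ji.
have /inc : edge_vert a (i, c) (j, c).
  by case: ji => ->; [left|right]; apply: veq_refl.
by rewrite /dV => /(edge_vert_eeq (fE_face c i)) [] H; case: (H) => /= ->; split=> //;
  [left|right].
Qed.

Lemma dV_inj c : injective (dV c).
Proof.
move=> i j E; have [Hi _] := @fV_edge c i i (or_introl erefl).
have [Hj _] := @fV_edge c j j (or_introl erefl).
have : veq (fV (i, c)) (fV (j, c)) by apply: veq_trans Hi _; rewrite E; apply: veq_sym.
by case/(fVE (i, c) (j, c)).2.
Qed.

Lemma ik_neq j d : 0 < d < k -> ik (j + d)%N <> ik j.
Proof.
move=> dk [/eqP]; rewrite -{2}(addn0 j) eqn_modDl mod0n modn_small; lia.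
Qed.

Lemma ordS_neq (i : 'I_k) : ordS i <> i.
Proof. by rewrite -(ik_ord k4 i) ordS_ik -addn1; apply: ik_neq; lia. Qed.

Lemma ordSS_neq (i : 'I_k) : ordS (ordS i) <> i.
Proof. by rewrite -(ik_ord k4 i) !ordS_ik -addn2; apply: ik_neq; lia. Qed.

Lemma ordS_inj : injective (@ordS k).
Proof. exact: can_inj (@ordSK k). Qed.

Lemma dV_step c i : (dV c (ordS i) = ordS (dV c i) /\ dE c i = dV c i) \/
  (dV c i = ordS (dV c (ordS i)) /\ dE c i = dV c (ordS i)).
Proof.
have [_ [h1|h1]] := @fV_edge c i i (or_introl erefl);
  have [_ [h2|h2]] := @fV_edge c i (ordS i) (or_intror erefl).
- by case: (@ordS_neq i); apply: (@dV_inj c); rewrite h1 h2.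
- by left; rewrite h1 h2.
- by right; rewrite h1 h2.
- by case: (@ordS_neq i); apply: (@dV_inj c); rewrite h1 h2.
Qed.

Lemma dV_turn c i : dV c (ordS i) = ordS (dV c i) ->
  dV c (ordS (ordS i)) = ordS (dV c (ordS i)).
Proof.
have [[//]|[h _]] := dV_step c (ordS i) => E.
case: (@ordSS_neq i); apply: (@dV_inj c); apply: ordS_inj.
by rewrite -h E.
Qed.

Lemma dV_turn' c i : dV c i = ordS (dV c (ordS i)) ->
  dV c (ordS i) = ordS (dV c (ordS (ordS i))).
Proof.
have [[h _]|[//]] := dV_step c (ordS i) => E.
by case: (@ordSS_neq i); apply: (@dV_inj c); rewrite h -E.
Qed.

Lemma dV_forward c i : dV c (ordS i) = ordS (dV c i) ->
  forall j, dV c (ik (i + j)%N) = ik (dV c i + j)%N /\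
    dV c (ordS (ik (i + j)%N)) = ordS (dV c (ik (i + j)%N)).
Proof.
move=> h; elim=> [|j [IH1 IH2]]; first by rewrite !addn0 !ik_ord.
rewrite !addnS -!ordS_ik -IH1; split=> //; exact: dV_turn.
Qed.

Lemma dV_backward c i : dV c i = ordS (dV c (ordS i)) ->
  forall j, dV c i = ik (dV c (ik (i + j)%N) + j)%N /\
    dV c (ik (i + j)%N) = ordS (dV c (ordS (ik (i + j)%N))).
Proof.
move=> h; elim=> [|j [IH1 IH2]]; first by rewrite !addn0 !ik_ord.
rewrite !addnS -!ordS_ik; split; last exact: dV_turn'.
rewrite IH1 IH2; apply: val_inj => /=.
by rewrite modnDml addSn -[((_ + _) %% k).+1]addn1 modnDml addn1.
Qed.

Lemma ik_shift (i j : 'I_k) : exists d, j = ik (i + d)%N.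
Proof.
exists (j + k - i)%N; rewrite -[LHS](ik_ord k4) -ikD; congr ik.
by have := ltn_ord i; lia.
Qed.

Lemma dV_agree c c' i : dV c i = dV c' i -> dV c (ordS i) = dV c' (ordS i) ->
  dV c =1 dV c'.
Proof.
move=> h hS j; have [d ->] := ik_shift i j.
have [[h1 _]|[h1 _]] := dV_step c i.
  have h1' : dV c' (ordS i) = ordS (dV c' i) by rewrite -h -hS.
  by have [-> _] := dV_forward h1 d; have [-> _] := dV_forward h1' d; rewrite h.
have h1' : dV c' i = ordS (dV c' (ordS i)) by rewrite -h -hS.
have [E _] := dV_backward h1 d; have [E' _] := dV_backward h1' d.
apply: val_inj; move: E; rewrite h E' => -[/eqP].
by rewrite eqn_modDr !modn_small // => /eqP.
Qed.

(** The cells c and c a_i share the edge of type i, hence two consecutive vertices, which determine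
    the image types of all the others ([dV_agree]); and the a_i generate G. *)
Lemma dV_const c : dV c =1 dV gone.
Proof.
suff K x : forall c i, dV (c * x) i = dV c i by move=> i; rewrite -{1}(gmul1 c) K.
elim: (hig_gen hig x) => {x} [_ [i ->] c' j| c' j|x y _ IHx _ IHy c' j|x _ IHx c' j].
- apply: (@dV_agree _ _ i).
    have /fVE [] // : veq (i, c' * a i) (i, c').
    by apply: veq_sym; split=> //=; rewrite gmulA gmulV gmul1; apply: gen_in; right.
  have /fVE [] // : veq (ordS i, c' * a i) (ordS i, c').
  apply: veq_sym; split=> //=; rewrite gmulA gmulV gmul1.
  by apply: (Ei_Gi (i := i) _).2; apply: gen_in.
- by rewrite mulg1.
- by rewrite gmulA IHy IHx.
- by rewrite -[in RHS](mulgKV c' x) IHx.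
Qed.

Lemma fF_bij : exists h : G -> G, cancel fF h /\ cancel h fF.
Proof. by case: aut => _ _ [_ [h [_ h1 h2]]] _ _; exists h. Qed.

Lemma fF_eqv_map j l : (forall c, dE c (ik j) = ik l) -> eqv_map a k4 fF j l.
Proof.
move=> dl x y; rewrite -eeqE fEE -eeqE.
have Hx := fE_face x (ik j); have Hy := fE_face y (ik j); rewrite !dl in Hx Hy.
split=> H; first exact: eeq_trans (eeq_sym Hx) (eeq_trans H Hy).
exact: eeq_trans Hx (eeq_trans H (eeq_sym Hy)).
Qed.

Lemma autX_rigid : exists t : 'I_k, [/\ in_Fsigma m n t,
  forall x y, fF (x * y) = fF x * (fF gone)^-1 * fF y,
  forall j, fF (A j) = fF gone * A (j + t)%N,
  forall v, veq (fV v) (oadd v.1 t, fF v.2) &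
  forall e, eeq (fE e) (oadd e.1 t, fF e.2)].
Proof.
have [h [fK hK]] := fF_bij.
have [[h1 _]|[h1 _]] := dV_step gone (ik 0); last first.
  (* Reversed orientation: edges of types 0 and 1 go to types l+1 and l, so the map on cells would
     exchange stable and base letters. *)
  exfalso; have h2 := dV_turn' h1; rewrite !ordS_ik in h1 h2.
  pose l : nat := dV gone (ik 2).
  have lE : dV gone (ik 2) = ik l by rewrite ik_ord.
  have lE1 : dV gone (ik 1) = ik l.+1 by rewrite h2 lE ordS_ik.
  have E0 c : dE c (ik 0) = ik l.+1.
    rewrite -lE1; have [[E _]|[_ ->]] := dV_step c (ik 0); last by rewrite dV_const ordS_ik.
    by move: E; rewrite !dV_const ordS_ik h1 => /esym/ordSS_neq.
  have E1 c : dE c (ik 1) = ik l.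
    rewrite -lE; have [[E _]|[_ ->]] := dV_step c (ik 1); last by rewrite dV_const ordS_ik.
    by move: E; rewrite !dV_const ordS_ik h2 => /esym/ordSS_neq.
  exact: (link_no_swap mn0 mn hig fK hK (fF_eqv_map E0) (fF_eqv_map E1)).
pose t := dV gone (ik 0); exists t.
have dVE c i : dV c i = oadd i t.
  rewrite dV_const; have [d ->] := ik_shift (ik 0) i.
  have [-> _] := dV_forward h1 d; rewrite oadd_ik /=; apply: val_inj => /=.
  by rewrite mod0n add0n addnC.
have dEE c i : dE c i = oadd i t.
  have [[_ ->]|[E _]] := dV_step c i; first exact: dVE.
  have [d iE] := ik_shift (ik 0) i; have [_ E'] := dV_forward h1 d.
  by move: E; rewrite !dV_const iE E' => /esym/ordSS_neq.
have fm j : eqv_map a k4 fF j (j + t)%N.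
  by apply: fF_eqv_map => c; rewrite dEE oadd_ik.
have [fM [fA tF]] := link_rigid mn0 mn hig fK hK fm.
split=> //.
- by move=> i; rewrite -(ik_ord k4 i) oadd_ik; apply: tF.
- by case=> i c; rewrite /= -(dVE c); apply: (@fV_edge c i i (or_introl erefl)).1.
- by case=> i c; rewrite /= -(dEE c); apply: fE_face.
Qed.

End Surjective.

End AutX.

(** * The action of the extended group *)

Section Action.
Variables (k : nat) (m n : 'I_k -> int) (G : group) (a : 'I_k -> G) (alpha : 'I_k -> G -> G).
Hypothesis k4 : 4 <= k.
Hypothesis hig : is_Hig m n a.
Hypothesis alphaP : forall t, in_Fsigma m n t ->
  is_hom (alpha t) /\ forall i, alpha t (a i) = a (oadd i t).

Local Notation ik := (ik k4).
Local Notation Gi := (Gi a).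
Local Notation Ei := (Ei a).
Local Notation veq := (veq a).
Local Notation eeq := (eeq a).

Definition oopp (t : 'I_k) : 'I_k := ik (k - t).

Lemma oaddK i t : oadd (oadd i t) (oopp t) = i.
Proof.
apply: val_inj; rewrite /oopp /= modnDml modnDmr -addnA subnKC 1?ltnW //.
by rewrite modnDr modn_small.
Qed.

Lemma oaddVK i t : oadd (oadd i (oopp t)) t = i.
Proof.
apply: val_inj; rewrite /oopp /= modnDml addnAC modnDmr -addnA subnKC 1?ltnW //.
by rewrite modnDr modn_small.
Qed.

Lemma oadd_ordS (i t : 'I_k) : oadd (ordS i) t = ordS (oadd i t).
Proof. by rewrite -(ik_ord k4 i) ordS_ik !oadd_ik ordS_ik. Qed.

Lemma oadd_ord_pred (i t : 'I_k) : oadd (ord_pred i) t = ord_pred (oadd i t).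
Proof. by rewrite -{2}(ord_predK i) oadd_ordS ordSK. Qed.

Lemma in_Fsigma_opp t : in_Fsigma m n t -> in_Fsigma m n (oopp t).
Proof.
move=> Ft i; have := Ft (oadd i (oopp t)); rewrite oaddVK.
by case=> -[-> ->]; [left|right]; rewrite ?opprK.
Qed.

Lemma alphaK t : in_Fsigma m n t -> cancel (alpha t) (alpha (oopp t)).
Proof.
move=> Ft x; have [hM ha] := alphaP Ft; have [hM' ha'] := alphaP (in_Fsigma_opp Ft).
apply: (hom_gen_ext (f := alpha (oopp t) \o alpha t) (f' := id) _ _ _ (hig_gen hig x)) => //.
  by move=> y z; rewrite /= hM hM'.
by move=> _ [i ->]; rewrite /= ha ha' oaddK.
Qed.

Lemma alphaVK t : in_Fsigma m n t -> cancel (alpha (oopp t)) (alpha t).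
Proof.
move=> Ft x; have [hM ha] := alphaP Ft; have [hM' ha'] := alphaP (in_Fsigma_opp Ft).
apply: (hom_gen_ext (f := alpha t \o alpha (oopp t)) (f' := id) _ _ _ (hig_gen hig x)) => //.
  by move=> y z; rewrite /= hM' hM.
by move=> _ [i ->]; rewrite /= ha' ha oaddVK.
Qed.

Lemma gen_alpha t (S S' : G -> Prop) x : in_Fsigma m n t ->
  (forall y, S y -> S' (alpha t y)) -> gen S x -> gen S' (alpha t x).
Proof.
move=> Ft SS; have [hM _] := alphaP Ft; elim=> {x}.
- by move=> x /SS; apply: gen_in.
- by rewrite (hom1 hM); apply: gen_one.
- by move=> x y _ IHx _ IHy; rewrite hM; apply: gen_mul.
- by move=> x _ IH; rewrite (homV hM); apply: gen_inv.
Qed.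

Lemma alpha_Gi t i x : in_Fsigma m n t -> Gi i x <-> Gi (oadd i t) (alpha t x).
Proof.
move=> Ft; have D t' i' y : in_Fsigma m n t' -> Gi i' y -> Gi (oadd i' t') (alpha t' y).
  move=> Ft'; have [_ ha] := alphaP Ft'.
  by apply: gen_alpha => // z [] ->; rewrite ha ?oadd_ord_pred; [left|right].
split; first exact: D.
by move/(D (oopp t) _ _ (in_Fsigma_opp Ft)); rewrite oaddK alphaK.
Qed.

Lemma alpha_Ei t i x : in_Fsigma m n t -> Ei i x <-> Ei (oadd i t) (alpha t x).
Proof.
move=> Ft; have D t' i' y : in_Fsigma m n t' -> Ei i' y -> Ei (oadd i' t') (alpha t' y).
  move=> Ft'; have [_ ha] := alphaP Ft'.
  by apply: gen_alpha => // z ->; rewrite ha.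
split; first exact: D.
by move/(D (oopp t) _ _ (in_Fsigma_opp Ft)); rewrite oaddK alphaK.
Qed.

Section OneElement.
Variables (g : G) (t : 'I_k).
Hypothesis Ft : in_Fsigma m n t.

Let hM : is_hom (alpha t). Proof. by case: (alphaP Ft). Qed.
Let hM' : is_hom (alpha (oopp t)). Proof. by case: (alphaP (in_Fsigma_opp Ft)). Qed.

Let act (v : 'I_k * G) := (oadd v.1 t, g * alpha t v.2).
Let act' (v : 'I_k * G) := (oadd v.1 (oopp t), alpha (oopp t) (g^-1 * v.2)).

Let actK : cancel act act'.
Proof.
by case=> i x; rewrite /act /act' /= oaddK gmulA gmulV gmul1 alphaK.
Qed.

Let actVK : cancel act' act.
Proof.
by case=> i x; rewrite /act /act' /= oaddVK alphaVK // gmulA mulgV gmul1.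
Qed.

Let act_diff x y : (g * alpha t x)^-1 * (g * alpha t y) = alpha t (x^-1 * y).
Proof. by rewrite hM (homV hM); gsimp. Qed.

Let oadd_inj i j : oadd i t = oadd j t -> i = j.
Proof. by move=> E; rewrite -(oaddK i t) E oaddK. Qed.

Lemma act_veq v w : veq v w <-> veq (actV alpha g t v) (actV alpha g t w).
Proof.
case: v w => [i x] [j y]; rewrite /Defs.veq /= act_diff -alpha_Gi //.
by split=> -[E ?]; split=> //; [rewrite E|apply: oadd_inj].
Qed.

Lemma act_eeq v w : eeq v w <-> eeq (actE alpha g t v) (actE alpha g t w).
Proof.
case: v w => [i x] [j y]; rewrite /Defs.eeq /= act_diff -alpha_Ei //.
by split=> -[E ?]; split=> //; [rewrite E|apply: oadd_inj].
Qed.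

Let bij_iff (eqT : 'I_k * G -> 'I_k * G -> Prop) : (forall v, eqT v v) ->
  (forall v w, eqT v w <-> eqT (act v) (act w)) -> setoid_bij eqT act.
Proof.
move=> refl E; split=> [v w /E //|]; exists act'; split=> [v w|v|v]; last 2 first.
- by rewrite actK.
- by rewrite actVK.
by rewrite (E (act' v)) !actVK.
Qed.

Lemma act_autX : is_autX a (actV alpha g t) (actE alpha g t) (actF alpha g t).
Proof.
split.
- by apply: bij_iff act_veq => v; apply: veq_refl.
- by apply: bij_iff act_eeq => v; apply: eeq_refl.
- split=> [x y -> //|]; exists (fun x => alpha (oopp t) (g^-1 * x)); split.
  + by move=> x y ->.
  + by move=> x; rewrite /feq /actF gmulA gmulV gmul1 alphaK.
  + by move=> x; rewrite /feq /actF alphaVK // gmulA mulgV gmul1.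
- case=> i x v; rewrite /edge_vert (act_veq v (_, x)) (act_veq v (ordS _, x)).
  by rewrite /actV /= oadd_ordS.
- move=> c e; split=> -[i].
    by move/act_eeq => H; exists (oadd i t).
  move=> H; exists (oadd i (oopp t)); apply/act_eeq.
  by rewrite /actE /= oaddVK.
Qed.

Lemma act_stab v x : stab a v x <-> stab a (actV alpha g t v) (g * alpha t x * g^-1).
Proof.
rewrite /stab /= (alpha_Gi v.1 _ Ft).
have -> : (g * alpha t v.2)^-1 * (g * alpha t x * g^-1) * (g * alpha t v.2) =
  alpha t (v.2^-1 * x * v.2) by rewrite !hM (homV hM); gsimp.
by [].
Qed.

Lemma act_autTheta : is_autTheta a (actV alpha g t).
Proof.
split; first by apply: bij_iff act_veq => v; apply: veq_refl.
move=> v w; rewrite /adj act_veq; split=> -[nvw [x [x1 vx wx]]]; split=> //.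
  exists (g * alpha t x * g^-1); split; [|exact: (act_stab v x).1|exact: (act_stab w x).1].
  move=> E; apply: x1; apply: (can_inj (alphaK Ft)); rewrite (hom1 hM).
  by apply: (@mulIr _ g^-1); apply: (@mulIl _ g); rewrite gmulA E gmul1 mulgV.
have xE : x = g * alpha t (alpha (oopp t) (g^-1 * x * g)) * g^-1.
  by rewrite alphaVK //; gsimp.
exists (alpha (oopp t) (g^-1 * x * g)); split; last 2 first.
- by apply: (act_stab v _).2; rewrite -xE.
- by apply: (act_stab w _).2; rewrite -xE.
move=> E; apply: x1; rewrite xE E (hom1 hM); gsimp => //.
Qed.

End OneElement.

Lemma affine_alpha t (F : G -> G) c : in_Fsigma m n t ->
  (forall x y, F (x * y) = F x * (F gone)^-1 * F y) ->
  (forall j, F (ga a k4 j) = F gone * ga a k4 (j + t)%N) -> F c = F gone * alpha t c.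
Proof.
move=> Ft FM FA; have [hM ha] := alphaP Ft.
apply: (@mulIl _ (F gone)^-1); rewrite gmulA gmulV gmul1.
apply: (hom_gen_ext (f := fun c => (F gone)^-1 * F c) _ hM _ (hig_gen hig c)).
  by move=> x y; rewrite FM !gmulA.
move=> _ [i ->]; rewrite ha -(ik_ord k4 i) oadd_ik -[a (ik i)]/(ga a k4 i) FA.
by rewrite gmulA gmulV gmul1.
Qed.

Lemma autX_surjective (mn0 : forall i, m i != 0%R /\ n i != 0%R)
    (mn : forall i, `|m i| < `|n i|) fV fE fF : is_autX a fV fE fF ->
  exists g t, [/\ in_Fsigma m n t, forall v, veq (fV v) (actV alpha g t v),
    forall e, eeq (fE e) (actE alpha g t e) & forall c, feq (fF c) (actF alpha g t c)].
Proof.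
move=> aut; have [t [Ft fM fA fVt fEt]] := autX_rigid k4 mn0 mn hig aut.
have fFE c := affine_alpha c Ft fM fA.
exists (fF gone), t; split=> //.
- by move=> v; rewrite /actV -fFE; apply: fVt.
- by move=> v; rewrite /actE -fFE; apply: fEt.
Qed.

End Action.

(** * The intersection graph *)

Section FixedStars.
Variables (k : nat) (m n : 'I_k -> int) (G : group) (a : 'I_k -> G).
Hypothesis k4 : 4 <= k.
Hypothesis mn0 : forall i, m i != 0%R /\ n i != 0%R.
Hypothesis mn : forall i, `|m i| < `|n i|.
Hypothesis hig : is_Hig m n a.

Local Notation ik := (ik k4).
Local Notation A := (ga a k4).
Local Notation Gi := (Gi a).
Local Notation veq := (veq a).
Local Notation stab := (stab a).

Definition arrow (u v : vert k G) := v.1 = ordS u.1 /\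
  exists h, Gi u.1 (u.2^-1 * h) /\ Gi v.1 (v.2^-1 * h).

(** For u = (i, g) these turn out to be the vertices fixed by some nontrivial power of g a_i
    g^-1. *)
Definition inK (u v : vert k G) := veq u v \/ arrow u v.

(** With H = S(x,y) and K = S(y,y+2): the types x+1..y are those whose group lies in H, while y+1
    and y+2 give the two halves L and R of K. *)
Lemma ik_cases x (i : 'I_k) (y := (x + (k - 2))%N) :
  (exists2 j, x <= j < y & i = ik j.+1) \/ i = ik y.+1 \/ i = ik y.+2.
Proof.
have [d iE] := ik_shift k4 (ik x.+1) i.
have {}iE : i = ik (x + (d %% k)).+1.
  by rewrite iE; apply: ik_eq; rewrite /= modnDml -addSn modnDmr.
have dk : d %% k < k by rewrite ltn_mod; lia.
have [dl|dl] := ltnP (d %% k) (k - 2); first by left; exists (x + d %% k) => //; lia.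
right; have [dE|dE] : d %% k = k - 2 \/ d %% k = k - 1 by lia.
  by left; rewrite iE dE.
by right; rewrite iE dE /y; congr ik; lia.
Qed.

Section Split.
Variable x : nat.
Let y := (x + (k - 2))%N.

Let spH : splits_off (fun j => m (ik j)) (fun j => n (ik j)) x y A.
Proof. by case: (hig_split k4 mn0 hig x). Qed.
Let spK : splits_off (fun j => m (ik j)) (fun j => n (ik j)) y y.+2 A.
Proof. by case: (hig_split k4 mn0 hig x). Qed.
Let amHK : amalg (fun b => if b then Sg A x y else Sg A y y.+2).
Proof. by case: (hig_split k4 mn0 hig x). Qed.
Let interHK z : Sg A x y z -> Sg A y y.+2 z -> gen (fun z => z = A y \/ z = A y.+2) z.
Proof. by case: (hig_split k4 mn0 hig x) => _ _ _; apply. Qed.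
Let LR (b : bool) := if b then Sg A y y.+1 else Sg A y.+1 y.+2.
Let amLR : amalg LR. Proof. by case: spK. Qed.
Let interLR z : Sg A y y.+1 z -> Sg A y.+1 y.+2 z -> exists w, z = A y.+1 ^ w.
Proof. by case: spK => _ _ + _ _; apply. Qed.
Let pA z : z != 0%R -> LR true (A y ^ z) /\ ~ LR false (A y ^ z).
Proof. by case: spK => _ _ _ + _; apply. Qed.
Let qA z : z != 0%R -> LR false (A y.+2 ^ z) /\ ~ LR true (A y.+2 ^ z).
Proof. by case: spK => _ _ _ _; apply. Qed.

Lemma amgen_HK g : amgen (fun b => if b then Sg A x y else Sg A y y.+2) g.
Proof.
apply: gen_sub (hig_gen hig g) => _ [i ->].
have [[j jxy ->]|[->|->]] := ik_cases x i.
- by left; apply: Sg_in; lia.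
- by right; apply: Sg_in; rewrite /y; lia.
- by right; apply: Sg_in; rewrite /y; lia.
Qed.

Lemma amgen_LR g : Sg A y y.+2 g -> amgen LR g.
Proof.
apply: gen_sub => _ [j jy ->]; have [j1|j1] := leqP j y.+1.
  by left; apply: Sg_in; lia.
by right; apply: Sg_in; lia.
Qed.

Lemma pow_in j u v z : u <= j <= v -> Sg A u v (A j ^ z).
Proof. by move=> juv; apply: (sgX (Sg_sub _ _ _)); apply: Sg_in. Qed.

Lemma LR_K b g : LR b g -> Sg A y y.+2 g.
Proof. by case: b; apply: Sg_mono; lia. Qed.

Lemma F_K g : gen (fun z => z = A y \/ z = A y.+2) g -> Sg A y y.+2 g.
Proof. by apply: gen_sub => z [] ->; [exists y|exists y.+2] => //; lia. Qed.

(** The conjugate lies in H and in K, hence in the free group on a_y and a_(y+2). It is also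
    conjugate in K into L or R, so [gen2_elliptic] applies. *)
Lemma elliptic_HK b c h : LR b c -> Sg A y y.+2 h -> Sg A x y (h^-1 * c * h) ->
  exists e z, Sg A y y.+2 e /\ (c = e * A y ^ z * e^-1 \/ c = e * A y.+2 ^ z * e^-1).
Proof.
move=> cb Kh Hc; have sK := Sg_sub A y y.+2.
have Fc := interHK Hc (sgM sK (sgM sK (sgV sK Kh) (LR_K cb)) Kh).
have [|e [z [Fe E]]] := gen2_elliptic amLR pA qA (b := b) (g := h^-1) Fc (amgen_LR (sgV sK Kh)).
  by move: cb; gsimp.
exists (h * e), z; split; first exact: sgM sK _ _ Kh (F_K Fe).
have cE : c = h * (h^-1 * c * h) * h^-1 by gsimp.
by case: E => E; [left|right]; rewrite cE E; gsimp.
Qed.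

(** Otherwise it would be conjugate in K to a nontrivial power of a_y or of a_(y+2). The former has
    no conjugate in R and the latter none in L, but a_(y+1) lies in both. *)
Lemma center_pow_notH z h : z != 0%R -> Sg A y y.+2 h -> ~ Sg A x y (h^-1 * A y.+1 ^ z * h).
Proof.
move=> z0 Kh Hc; have ct : LR true (A y.+1 ^ z) by apply: pow_in; lia.
have cf : LR false (A y.+1 ^ z) by apply: pow_in; lia.
have c1 : A y.+1 ^ z <> gone.
  by move/(ga_torsionfree mn0 hig) => z0'; rewrite z0' in z0.
have [e [w [Ke E]]] := elliptic_HK ct Kh Hc.
have ge := amgen_LR (sgV (Sg_sub _ _ _) Ke).
have w0 : w != 0%R.
  by apply/eqP => w0; apply: c1; case: E => ->; rewrite w0 gpow0 mulg1 mulgV.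
case: E => E.
  have [Lp _] := pA w0; have [|_] := amalg_fix amLR Lp _ ge.
    move=> g Lg Rc; have [s] : exists s, g^-1 * A y ^ w * g = A y.+1 ^ s.
      apply: interLR => //; have sL := Sg_sub A y y.+1.
      by apply: (sgM sL) => //; apply: (sgM sL) => //; apply: sgV.
    rewrite -[g in _ * g]invgK => /(ga_conj_pow mn0 hig) w0'; case/eqP: w0; apply: w0'.
    exact: sgV (Sg_sub _ _ _) _ _.
  by rewrite invgK -E; apply.
have [Rq _] := qA w0; have [|_] := amalg_fix amLR Rq _ ge.
  move=> g Rg Lc; have [s Es] : exists s, g^-1 * A y.+2 ^ w * g = A y.+1 ^ s.
    apply: interLR => //; have sR := Sg_sub A y.+1 y.+2.
    by apply: (sgM sR) => //; apply: (sgM sR) => //; apply: sgV.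
  have Es' : g * A y.+1 ^ s * g^-1 = A y.+2 ^ w by rewrite -Es; gsimp.
  have s0 := ga_conj_pow mn0 hig Rg Es'; case/eqP: w0.
  by apply: (ga_torsionfree mn0 hig (j := y.+2)); rewrite -Es' s0 gpow0 mulg1 mulgV.
by rewrite invgK -E; apply.
Qed.

Lemma Gi_cases i : [\/ forall g, Gi i g -> Sg A x y g,
  i = ik y.+1 /\ (forall g, Gi i g <-> Sg A y y.+1 g) |
  i = ik y.+2 /\ (forall g, Gi i g <-> Sg A y.+1 y.+2 g)].
Proof.
have [[j jxy ->]|[->|->]] := ik_cases x i.
- by constructor 1 => g /GiE; apply: Sg_mono; lia.
- by constructor 2; split=> // g; apply: GiE.
- by constructor 3; split=> // g; apply: GiE.
Qed.

(** By [center_pow_notH] only the vertex K is fixed in the tree of H and K. Inside K the fixed set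
    has radius one around L, because a_(y+1) is the stable letter of R and generates a malnormal
    subgroup there. *)
Lemma center_fix z i g : z != 0%R -> stab (i, g) (A y.+1 ^ z) -> inK (ik y.+1, gone) (i, g).
Proof.
move=> z0; rewrite /Defs.stab /= => st.
have ct : LR true (A y.+1 ^ z) by apply: pow_in; lia.
have cf : LR false (A y.+1 ^ z) by apply: pow_in; lia.
have [gK gH] := amalg_fix amHK (b := false) (LR_K ct)
  (fun h Kh => @center_pow_notH z h z0 Kh) (amgen_HK g).
have c1 : A y.+1 ^ z <> gone.
  by move/(ga_torsionfree mn0 hig) => z0'; rewrite z0' in z0.
have mal z' v : LR true z' -> LR false z' -> z' <> gone -> LR false v ->
    LR true (v^-1 * z' * v) -> LR true v.
  move=> Lz Rz z1 Rv Lv; have [w zE] := interLR Lz Rz; subst z'.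
  have sR := Sg_sub A y.+1 y.+2.
  have [s Es] := interLR Lv (sgM sR (sgM sR (sgV sR Rv) Rz) Rv).
  have w0 : w != 0%R by apply/eqP => w0; apply: z1; rewrite w0.
  rewrite -[v in _ * v]invgK in Es.
  have [r vE] := ga_malnormal mn0 mn hig (sgV sR Rv) w0 Es.
  by rewrite -(invgK v) vE -gpowN; apply: pow_in; lia.
have [Hi|[iE Li]|[iE Ri]] := Gi_cases i.
- by case: gH; apply: Hi.
- have gK' : Sg A y y.+2 g by apply: gK; apply: (LR_K (b := true)); apply/Li.
  have [Lg _] := amalg_fix_star amLR ct cf c1 mal (amgen_LR gK').
  left; rewrite /Defs.veq /= invg1 gmul1; split=> //.
  by rewrite -iE; apply/Li/Lg; apply/Li.
- have gK' : Sg A y y.+2 g by apply: gK; apply: (LR_K (b := false)); apply/Ri.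
  have [_ /(_ _)[]] := amalg_fix_star amLR ct cf c1 mal (amgen_LR gK').
    exact/Ri.
  move=> u [v [Lu Rv gE]]; right; rewrite /arrow /= ordS_ik; split=> //.
  exists u; rewrite invg1 gmul1; split; first by apply/GiE.
  by apply/Ri; rewrite gE; gsimp; apply: sgV (Sg_sub _ _ _) _ _.
Qed.

(** Such an element fixes a single vertex in each of two trees: that of G over H and K, then that of
    K over L and R. *)
Lemma generic_fix c i g : Gi (ik y.+1) c ->
  (forall e j z, c <> e * A j ^ z * e^-1) -> stab (i, g) c -> veq (ik y.+1, gone) (i, g).
Proof.
move=> /GiE Lc nconj; rewrite /Defs.stab /= => st.
have [gK gH] : (Sg A y y.+2 (g^-1 * c * g) -> Sg A y y.+2 g) /\ ~ Sg A x y (g^-1 * c * g).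
  apply: (amalg_fix amHK (b := false) (LR_K (b := true) Lc) _ (amgen_HK g)).
  move=> h Kh Hc; have [e [z [_ []]]] := elliptic_HK (b := true) Lc Kh Hc; exact: nconj.
have LRc : (LR true (g^-1 * c * g) -> LR true g) /\ ~ LR false (g^-1 * c * g) \/ ~ Sg A y y.+2 g.
  case: (classic (Sg A y y.+2 g)) => [Kg|]; [left|by right].
  apply: (amalg_fix amLR (b := true) Lc _ (amgen_LR Kg)) => e Le Re.
  have sL := Sg_sub A y y.+1.
  have [s E] := interLR (sgM sL (sgM sL (sgV sL Le) Lc) Le) Re.
  by apply: (nconj e y.+1 s); rewrite -E; gsimp.
have [Hi|[iE Li]|[iE Ri]] := Gi_cases i.
- by case: gH; apply: Hi.
- have Lg : LR true (g^-1 * c * g) by apply/Li.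
  case: LRc => [[Lg' _]|[]]; last exact: gK (LR_K Lg).
  split=> //=; rewrite invg1 gmul1 -iE; apply/Li; exact: Lg'.
- have Rg : LR false (g^-1 * c * g) by apply/Ri.
  by case: LRc => [[_ []]//|[]]; apply: gK (LR_K Rg).
Qed.

End Split.

Lemma stab_mul e v c : stab v c <-> stab (v.1, e * v.2) (e * c * e^-1).
Proof. by rewrite /Defs.stab /=; gsimp. Qed.

Lemma veq_mul e v w : veq v w <-> veq (v.1, e * v.2) (w.1, e * w.2).
Proof. by rewrite /Defs.veq /=; gsimp. Qed.

Lemma arrow_mul e v w : arrow v w <-> arrow (v.1, e * v.2) (w.1, e * w.2).
Proof.
rewrite /arrow /=; split=> -[E [h [H1 H2]]]; split=> //; [exists (e * h)|exists (e^-1 * h)];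
  by move: H1 H2; gsimp.
Qed.

Lemma inK_mul e v w : inK v w <-> inK (v.1, e * v.2) (w.1, e * w.2).
Proof. by rewrite /inK -veq_mul -arrow_mul. Qed.

Lemma ik_split (i : 'I_k) : exists x, i = ik (x + (k - 2)).+1.
Proof. by exists i.+1; rewrite (_ : (_ + _).+1 = i + k)%N ?ikD ?ik_ord //; lia. Qed.

(** If c is conjugate to a power of a generator, [center_fix] puts all its fixed vertices in one
    star; otherwise it fixes a single vertex. *)
Lemma common_star v w c : c <> gone -> stab v c -> stab w c ->
  exists u, inK u v /\ inK u w.
Proof.
move=> c1 vc wc; case: (classic (exists e j z, c = e * A j ^ z * e^-1)).
  case=> e [j [z cE]]; have z0 : z != 0%R.
    by apply/eqP => z0; apply: c1; rewrite cE z0 gpow0 mulg1 mulgV.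
  have [x jE] := ik_split (ik j).
  have AE : A j = A (x + (k - 2)).+1 by rewrite /ga jE.
  exists (ik j, e); rewrite jE.
  have K v' : stab v' c -> inK (ik (x + (k - 2)).+1, e) v'.
    move=> sv; rewrite (inK_mul e^-1) /= gmulV; apply: (center_fix (z := z)) => //.
    by move: sv; rewrite (stab_mul e^-1) cE AE; gsimp.
  by split; apply: K.
move=> nc; case: v w vc wc => [i g] [i' g'] vc wc.
have [x iE] := ik_split i; exists (i, g); split; first by left; apply: veq_refl.
left; rewrite (veq_mul g^-1) /= gmulV iE; apply: (generic_fix (c := g^-1 * c * g)).
- by rewrite -iE.
- move=> e j z E; apply: nc; exists (g * e), j, z.
  have cE : c = g * (g^-1 * c * g) * g^-1 by gsimp.
  by rewrite {1}cE E; gsimp.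
- by move: wc; rewrite (stab_mul g^-1); gsimp.
Qed.

Lemma inK_stab u v o (h := u.2) : u.1 = ik o.+1 -> inK u v ->
  exists l, Sg A o o.+1 l /\ forall z, stab v (h * l * A o.+1 ^ z * (h * l)^-1).
Proof.
case: u v @h => [i h] [i' g] /= ->; case=> [[/= <- E]|[/= -> [e [E1 E2]]]].
  move/GiE: E => E; exists gone; split=> [|z]; first exact: gen_one.
  rewrite /Defs.stab /=; apply/GiE; have sL := Sg_sub A o o.+1.
  have -> : g^-1 * (h * gone * A o.+1 ^ z * (h * gone)^-1) * g =
    (h^-1 * g)^-1 * A o.+1 ^ z * (h^-1 * g) by gsimp.
  by apply: (sgM sL) => //; apply: (sgM sL); [apply: sgV|apply: pow_in; lia].
move/GiE: E1 => E1; rewrite ordS_ik in E2 *; move/GiE: E2 => E2.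
exists (h^-1 * e); split=> // z; rewrite /Defs.stab /=; apply/GiE.
have sR := Sg_sub A o.+1 o.+2.
have -> : g^-1 * (h * (h^-1 * e) * A o.+1 ^ z * (h * (h^-1 * e))^-1) * g =
  (g^-1 * e) * A o.+1 ^ z * (g^-1 * e)^-1 by gsimp.
by apply: (sgM sR); [apply: (sgM sR) => //; apply: pow_in; lia|apply: sgV].
Qed.

Lemma adjP v w : adj a v w <-> ~ veq v w /\ exists u, inK u v /\ inK u w.
Proof.
split=> [[nvw [c [c1 vc wc]]]|[nvw [u [uv uw]]]]; split=> //.
  exact: common_star c1 vc wc.
have [o uE] := ik_pred k4 u.1.
have [l [Ll vl]] := inK_stab uE uv; have [l' [Ll' wl]] := inK_stab uE uw.
have sL := Sg_sub A o o.+1.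
(* The two stabilizers contain conjugates of one cyclic group by elements of the stabilizer type of
   u, and these conjugates are commensurable. *)
have [z [z' [z0 z0' E]]] := ga_commens_conj mn0 hig (sgM sL (sgV sL Ll') Ll).
exists (u.2 * l * A o.+1 ^ z * (u.2 * l)^-1); split; [|exact: vl|].
  move=> E1; case/eqP: z0; apply: (ga_torsionfree mn0 hig (j := o.+1)).
  apply: (@mulIl _ (u.2 * l)); apply: (@mulIr _ (u.2 * l)^-1).
  by rewrite E1; gsimp.
have -> : u.2 * l * A o.+1 ^ z * (u.2 * l)^-1 = u.2 * l' * A o.+1 ^ z' * (u.2 * l')^-1.
  by rewrite -E; gsimp.
exact: wl.
Qed.

End FixedStars.

(** * Closed chains of stars *)

Section Cycles.
Variables (k : nat) (m n : 'I_k -> int) (G : group) (a : 'I_k -> G).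
Hypothesis k4 : 4 <= k.
Hypothesis mn0 : forall i, m i != 0%R /\ n i != 0%R.
Hypothesis mn : forall i, `|m i| < `|n i|.
Hypothesis hig : is_Hig m n a.

Local Notation ik := (ik k4).
Local Notation A := (ga a k4).
Local Notation Gi := (Gi a).
Local Notation veq := (veq a).
Local Notation inK := (inK a).
Local Notation arrow := (arrow a).

Definition incoset (v : vert k G) (h : G) := Gi v.1 (v.2^-1 * h).

Lemma inK_coset u v : inK u v -> exists h, incoset u h /\ incoset v h.
Proof.
case=> [E|[_ [h [H1 H2]]]]; last by exists h.
have [_ E'] := veq_sym E; exists u.2; split; last exact: E'.
by rewrite /incoset gmulV; apply: gen_one.
Qed.

Lemma incoset_diff v h h' : incoset v h -> incoset v h' -> Gi v.1 (h^-1 * h').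
Proof. by move=> H H'; have := gen_mul (gen_inv H) H'; gsimp. Qed.

Lemma incoset_veq v w h h' : v.1 = w.1 -> incoset v h -> incoset w h' ->
  Gi v.1 (h^-1 * h') -> veq v w.
Proof.
move=> E Hv Hw D; split=> //; rewrite /incoset -E in Hw.
by have := gen_mul (gen_mul Hv D) (gen_inv Hw); gsimp.
Qed.

Lemma veq_incoset v w h : veq v w -> incoset v h -> incoset w h.
Proof.
case: v w => [i x] [j y] [/= <- E] H; rewrite /incoset /=.
by have := gen_mul (gen_inv E) H; gsimp.
Qed.

(* The levels [lev], [rl] lift the types of [P] and [U] to integers; the chain is
   cut at a vertex [P 0] of highest level y.+1, and y.+1 - x = k - 1. Read between
   visits to the top level, it is an alternating word in H = S(x,y) and
   K = S(y,y+2). *)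
Section LinearCycle.
Variables (x r b : nat) (P U : nat -> vert k G) (lev rl : nat -> nat).
Let y := (x + (k - 2))%N.
Hypothesis r2 : 2 <= r.
Hypothesis PE : forall j, (P j).1 = ik (lev j).
Hypothesis UE : forall j, (U j).1 = ik (rl j).
Hypothesis lev_rl : forall j, rl j <= lev j <= (rl j).+1.
Hypothesis levS_rl : forall j, rl j <= lev j.+1 <= (rl j).+1.
Hypothesis UP : forall j, inK (U j) (P j).
Hypothesis UPS : forall j, inK (U j) (P j.+1).
Hypothesis rl_low : forall j, x < rl j.
Hypothesis lev_top : forall j, lev j <= y.+1.
Hypothesis lev0 : lev 0 = y.+1.
Hypothesis levb : lev b = y.+1.
Hypothesis br : b < r.
Hypothesis Pr : veq (P r) (P 0).
Hypothesis levr : lev r = y.+1.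
Hypothesis no_bottom : forall l, l < b -> rl l != x.+1.
Hypothesis no_top : forall l, b < l < r -> lev l != y.+1.
Hypothesis Pneq : forall i j, i < j < r -> ~ veq (P i) (P j).
Hypothesis Uneq : forall j, j.+1 < r -> ~ veq (U j) (U j.+1).
Hypothesis Urneq : ~ veq (U r.-1) (U 0).

Let T (c : bool) := if c then Sg A x y else Sg A y y.+2.
Let amT : amalg T. Proof. by case: (hig_split k4 mn0 hig x). Qed.
Let interT z : T true z -> T false z -> gen (fun z => z = A y \/ z = A y.+2) z.
Proof. by case: (hig_split k4 mn0 hig x) => _ _ _; apply. Qed.

Let AyE : A y.+2 = A x.
Proof. by rewrite -(gaD a k4 x); congr ga; rewrite /y; lia. Qed.

Lemma cycle_Gi_sub u v l g : u < l <= v -> Gi (ik l) g -> Sg A u v g.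
Proof. by case: l => // l ul /GiE; apply: Sg_mono; lia. Qed.

(** H and K meet in the free group on a_y and a_(y+2), which meets S(y,y+1) only in powers of
    a_y. *)
Lemma top_notH g : Gi (ik y.+1) g -> (forall w, g <> A y ^ w) -> T false g /\ ~ T true g.
Proof.
move=> /GiE Lg ng; have Kg : T false g by apply: Sg_mono Lg; lia.
split=> // Hg; have [_ [_ am _ pA qA] _ _] := hig_split k4 mn0 hig x.
by have [w] := gen2_side (b := true) am pA qA (interT Hg Kg) Lg; apply: ng.
Qed.

Lemma low_notK g : Sg A x.+1 y g -> (forall w, g <> A y ^ w) -> T true g /\ ~ T false g.
Proof.
move=> Sg1 ng; have Hg : T true g by apply: Sg_mono Sg1; lia.
split=> // Kg; have [[_ am _ pA qA] _ _ _] := hig_split k4 mn0 hig x.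
have F : gen (fun z => z = A x \/ z = A y) g.
  by apply: gen_sub (interT Hg Kg) => z []; rewrite ?AyE; auto.
by have [w] := gen2_side (b := false) am pA qA F Sg1; apply: ng.
Qed.

(** A star centred at the top level could meet the chain only in its own centre, making two
    consecutive vertices equal. *)
Lemma rl_top j : j < r -> rl j <= y.
Proof.
move=> jr; have h1 := lev_rl j; have h2 := levS_rl j; have h3 := lev_top j.
have h4 := lev_top j.+1; suff : rl j != y.+1 by lia.
apply/eqP => rE; have V i : lev i = rl j -> inK (U j) (P i) -> veq (U j) (P i).
  move=> E [//|[F _]]; move: F; rewrite PE UE E ordS_ik => F.
  by case: (@ik_neq k k4 (rl j) 1); [lia|rewrite addn1].
have V1 : veq (P j) (P j.+1).
  by apply: veq_trans (veq_sym (V j _ (UP j))) (V j.+1 _ (UPS j)); lia.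
have [jr'|jr'] : j.+1 < r \/ j.+1 = r by lia.
  by apply: Pneq V1; lia.
have := @Pneq 0 j; rewrite jr' in V1 => N; apply: N; first lia.
by apply: veq_sym; apply: veq_trans V1 Pr.
Qed.

Lemma cycle_linear : False.
Proof.
pose E j := constructive_indefinite_description _ (inK_coset (UP j)).
pose E' j := constructive_indefinite_description _ (inK_coset (UPS j)).
pose e j := sval (E j); pose e' j := sval (E' j).
have Ue j : incoset (U j) (e j) by case: (svalP (E j)).
have Pe j : incoset (P j) (e j) by case: (svalP (E j)).
have Ue' j : incoset (U j) (e' j) by case: (svalP (E' j)).
have Pe' j : incoset (P j.+1) (e' j) by case: (svalP (E' j)).
clearbody e e'; clear E E'.
have Dr j : Gi (ik (rl j)) ((e j)^-1 * e' j) by rewrite -UE; apply: incoset_diff.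
have Dl j : Gi (ik (lev j.+1)) ((e' j)^-1 * e j.+1) by rewrite -PE; apply: incoset_diff.
pose z := e' r.-1.
have rl_eq j : j < r -> lev j = y.+1 \/ lev j.+1 = y.+1 -> rl j = y.
  by move=> jr h; have := rl_top jr; have := lev_rl j; have := levS_rl j; lia.
have Ay w : Gi (ik y) (A y ^ w).
  have yS : y = (y.-1).+1 by rewrite /y; lia.
  by rewrite yS; apply/GiE; apply: pow_in; lia.
have Uturn i j g h w : rl i = y -> rl j = y -> incoset (U i) g -> incoset (U j) h ->
    g^-1 * h = A y ^ w -> veq (U i) (U j).
  move=> ri rj Ug Uh D; apply: incoset_veq Ug Uh _; first by rewrite !UE ri rj.
  by rewrite D UE ri.
(* Here j is the last top vertex up to l. The element from j to the closing point z is an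
   alternating word beginning in K, and the pending stretch from j to l stays in S(x+1,y). A new top
   vertex puts two letters in front: the turn in K and the stretch through H. *)
have step l : l <= b -> exists j s, [/\ j <= l, lev j = y.+1, s <> [::],
    alt T false s & (e j)^-1 * z = gprod s /\ Sg A x.+1 y ((e j)^-1 * e l)].
  elim: l => [_|l IH lb].
    exists 0, [:: (e 0)^-1 * z]; rewrite /= mulg1 gmulV; split=> //; last first.
      by split=> //; apply: sg1 (Sg_sub _ _ _).
    have Pz : incoset (P 0) z.
      by apply: veq_incoset Pr _; have := Pe' r.-1; rewrite prednK //; lia.
    have [||K nH] := @top_notH ((e 0)^-1 * z).
    - by rewrite -lev0 -PE; apply: incoset_diff.
    - move=> w D; apply: Urneq; apply: veq_sym; apply: Uturn (Ue 0) (Ue' r.-1) D.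
        by apply: rl_eq; [lia|left].
      by apply: rl_eq; [lia|right; rewrite prednK //; lia].
    by split.
  have [j [s [jl lj s0 As [sE Sl]]]] := IH (ltnW lb).
  have Sl' : Sg A x.+1 y ((e j)^-1 * e' l).
    have -> : (e j)^-1 * e' l = ((e j)^-1 * e l) * ((e l)^-1 * e' l) by gsimp.
    apply: sgM (Sg_sub _ _ _) _ _ Sl _; apply: cycle_Gi_sub (Dr l).
    have := rl_low l; have := no_bottom lb; have := @rl_top l; lia.
  have [lt|lt] := eqVneq (lev l.+1) y.+1; last first.
    exists j, s; split=> //; first lia; split=> //.
    have -> : (e j)^-1 * e l.+1 = ((e j)^-1 * e' l) * ((e' l)^-1 * e l.+1) by gsimp.
    apply: sgM (Sg_sub _ _ _) _ _ Sl' _; apply: cycle_Gi_sub (Dl l).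
    have := rl_low l; have := no_bottom lb; have := levS_rl l; have := lev_top l.+1; lia.
  have [Hh nKh] : T true ((e j)^-1 * e' l) /\ ~ T false ((e j)^-1 * e' l).
    apply: low_notK Sl' _ => w D; apply: (@Pneq j l.+1); first lia.
    apply: incoset_veq (Pe j) (Pe' l) _; first by rewrite !PE lj lt.
    by rewrite D PE lj; apply/GiE; apply: pow_in; lia.
  have [||KY nHY] := @top_notH ((e' l)^-1 * e l.+1).
  - by rewrite -lt.
  - move=> w D; apply: (@Uneq l); first lia.
    by apply: Uturn (Ue' l) (Ue l.+1) D; apply: rl_eq; auto; lia.
  exists l.+1, (((e' l)^-1 * e l.+1)^-1 :: ((e j)^-1 * e' l)^-1 :: s); split=> //.
    have st := am_sub amT true; have sf := am_sub amT false.
    by rewrite /=; split; [apply: (sgV sf)|move/(sgVE st)|split; [apply: (sgV st)|move/(sgVE sf)|]].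
  rewrite gmulV; split; last exact: sg1 (Sg_sub _ _ _).
  by rewrite /= -sE; gsimp.
have [j [s [jb lj s0 As [sE Sb]]]] := step b (leqnn b).
(* After b the chain stays in H, so an alternating word that begins in K would have its product in
   H. *)
apply: (alt_notin amT s0 As); rewrite -sE /=.
have -> : (e j)^-1 * z = (e j)^-1 * e b * ((e b)^-1 * z) by gsimp.
have sH := Sg_sub A x y.
apply: (sgM sH); first by apply: Sg_mono Sb.
have K i : b + i < r -> Sg A x y ((e b)^-1 * e' (b + i)%N).
  have HD l : l < r -> Sg A x y ((e l)^-1 * e' l).
    by move=> lr; apply: cycle_Gi_sub (Dr l); have := rl_low l; have := rl_top lr; lia.
  elim: i => [|i IH] bi; first by rewrite addn0; apply: HD.
  have -> : (e b)^-1 * e' (b + i.+1)%N = ((e b)^-1 * e' (b + i)%N) *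
    (((e' (b + i)%N)^-1 * e (b + i).+1) * ((e (b + i).+1)^-1 * e' (b + i).+1)).
    by rewrite addnS; gsimp.
  apply: (sgM sH); first by apply: IH; lia.
  apply: (sgM sH); last by apply: HD; lia.
  apply: cycle_Gi_sub (Dl _).
  have := @no_top (b + i).+1; have := lev_top (b + i).+1; have := levS_rl (b + i).
  have := rl_low (b + i); lia.
by have := @K (r.-1 - b)%N; rewrite subnKC; [apply; lia|lia].
Qed.

End LinearCycle.

Section LevelCycle.
Variables (r : nat) (P U : nat -> vert k G) (lev rl : nat -> nat).
Hypothesis rk : 2 <= r <= k.
Hypothesis PE : forall j, (P j).1 = ik (lev j).
Hypothesis UE : forall j, (U j).1 = ik (rl j).
Hypothesis lev_rl : forall j, rl j <= lev j <= (rl j).+1.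
Hypothesis levS_rl : forall j, rl j <= lev j.+1 <= (rl j).+1.
Hypothesis UP : forall j, inK (U j) (P j).
Hypothesis UPS : forall j, inK (U j) (P j.+1).
Hypothesis perP : forall j, P (j + r)%N = P j.
Hypothesis perU : forall j, U (j + r)%N = U j.
Hypothesis perl : forall j, lev (j + r)%N = lev j.
Hypothesis perr : forall j, rl (j + r)%N = rl j.
Hypothesis lev_big : forall j, k <= lev j.
Hypothesis Pinj : forall i j, veq (P i) (P j) -> i = j %[mod r].
Hypothesis Uneq : forall j, ~ veq (U j) (U j.+1).

(** Levels change by at most one per step, so between two top vertices at most k steps apart the
    chain sinks by about k/2 and its stars stay above x. It is then rotated so that a stretch
    reaching level x+1, if there is one, comes last. *)
Lemma cycle_levels : False.
Proof.
have perlM q j : lev (j + q * r)%N = lev j.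
  by elim: q => [|q IH]; rewrite ?mul0n ?addn0 // mulSn addnCA addnC perl.
have perrM q j : rl (j + q * r)%N = rl j.
  by elim: q => [|q IH]; rewrite ?mul0n ?addn0 // mulSn addnCA addnC perr.
have r0 : 0 < r by lia.
have [T0 [M [levT lev_le]]] : exists (T0 M : nat), lev T0 = M /\ forall j, lev j <= M.
  have [T _ Tmax] := @arg_maxnP 'I_r (Ordinal r0) predT (fun i => lev i) isT.
  exists T, (lev T); split=> // j; rewrite (divn_eq j r) addnC perlM.
  have jr : j %% r < r by rewrite ltn_mod.
  exact: (Tmax (Ordinal jr)).
have kM := lev_big T0; rewrite levT in kM.
have [x ME] : exists x, M = (x + (k - 2)).+1 by exists (M - (k - 1))%N; lia.
have desc t i : lev t = M -> M <= rl (t + i)%N + i.+1.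
  move=> tM; elim: i => [|i IH]; first by rewrite addn0; have := lev_rl t; lia.
  have := levS_rl (t + i); have := lev_rl (t + i).+1; rewrite (addnS t i); lia.
have asc t i : i < t -> lev t = M -> M <= rl (t - i.+1)%N + i.+1.
  move=> + tM; elim: i => [|i IH] it.
    by have := levS_rl (t - 1)%N; rewrite -subSn ?subSS ?subn0; lia.
  have h := IH (ltnW it); have := levS_rl (t - i.+2)%N; have := lev_rl (t - i.+1)%N.
  rewrite (_ : (t - i.+2).+1 = t - i.+1)%N; lia.
have between t t' l : lev t = M -> lev t' = M -> t <= l < t' ->
    M <= rl l + (l - t).+1 /\ M <= rl l + (t' - l).
  move=> tM tM' tl; have := desc t (l - t)%N tM; rewrite subnKC; last lia.
  have := asc t' (t' - l).-1 _ tM'; rewrite prednK; last lia.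
  by rewrite subKn; lia.
have low l : x < rl l.
  have -> : rl l = rl (l + T0 * r)%N by rewrite perrM.
  set l' := (l + T0 * r)%N.
  have h : exists q, T0 + q * r <= l' < T0 + q.+1 * r.
    exists ((l' - T0) %/ r); have := divn_eq (l' - T0) r.
    have := ltn_pmod (l' - T0) r0; have : T0 <= l' by rewrite /l'; nia.
    by rewrite mulSn; lia.
  have [q ql] := h; have [] := between _ _ l' _ _ ql; rewrite ?perlM //.
  rewrite mulSn in ql *; lia.
(* b0 marks a star of the lowest level x+1, if any. Such a star needs at least 2k-5 steps between
   the top vertices around it, and two stretches of this kind would take 4k-10 > k steps; so up to
   the period all of them lie between B and al. *)
have [b0 [Tb bot]] : exists b0, T0 <= b0 /\ forall l, rl l = x.+1 -> rl b0 = x.+1.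
  case: (classic (exists l, rl l = x.+1)) => [[l lx]|nl].
    by exists (l + T0 * r)%N; rewrite perrM; split=> //; nia.
  by exists T0; split=> // l lx; case: nl; exists l.
have exB : exists t, (t <= b0) && (lev t == M) by exists T0; rewrite Tb levT eqxx.
have leB t : (t <= b0) && (lev t == M) -> t <= b0 by case/andP.
case: (ex_maxnP exB leB) => B /andP[Bb /eqP levB] maxB.
have exA : exists t, (b0 < t) && (lev t == M).
  by exists (T0 + b0.+1 * r)%N; rewrite perlM levT eqxx andbT; nia.
case: (ex_minnP exA) => al /andP[bal /eqP levA] minA.
have levBr : lev (B + r)%N = M by rewrite perl.
have bB : b0 < B + r.
  by rewrite ltnNge; apply/negP => h; have := maxB (B + r)%N; rewrite h levBr eqxx => /(_ isT); lia.
have alB : al <= B + r by apply: minA; rewrite bB levBr eqxx.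
apply: (@cycle_linear x r (B + r - al) (fun j => P (al + j)%N) (fun j => U (al + j)%N)
  (fun j => lev (al + j)%N) (fun j => rl (al + j)%N)); rewrite -?ME ?addn0 //.
- by lia.
- by move=> j; rewrite addnS; apply: levS_rl.
- by move=> j; rewrite addnS; apply: UPS.
- by rewrite subnKC.
- by lia.
- by rewrite perP; apply: veq_refl.
- by rewrite perl.
- move=> l lb; apply/eqP => lx.
  have [h1 h2] := between al (B + r)%N (al + l)%N levA levBr ltac:(lia).
  have [h3 h4] := between B al b0 levB levA ltac:(lia).
  have := bot _ lx; move: h1 h2 h3 h4; rewrite lx; lia.
- move=> l lb; apply/eqP => lM; have E : (al + l = (al + l - r) + r)%N by lia.
  rewrite E perl in lM; have [h|h] := leqP (al + l - r) b0.
    by have := maxB (al + l - r)%N; rewrite h lM eqxx => /(_ isT); lia.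
  by have := minA (al + l - r)%N; rewrite h lM eqxx => /(_ isT); lia.
- move=> i j ij /Pinj /eqP; rewrite eqn_modDl !modn_small; lia.
- by move=> j _; rewrite addnS; apply: Uneq.
- by have := @Uneq (al + r.-1)%N; rewrite -addnS prednK // perU.
Qed.

End LevelCycle.

Section Dichotomy.
Variables (r : nat) (P U : nat -> vert k G).
Hypothesis rk : 2 <= r <= k.
Hypothesis UP : forall j, inK (U j) (P j).
Hypothesis UPS : forall j, inK (U j) (P j.+1).
Hypothesis perP : forall j, P (j + r)%N = P j.
Hypothesis perU : forall j, U (j + r)%N = U j.
Hypothesis Pinj : forall i j, veq (P i) (P j) -> i = j %[mod r].
Hypothesis Uneq : forall j, ~ veq (U j) (U j.+1).

Let nveq u v : bool := if excluded_middle_informative (veq u v) then false else true.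
Let up j := nveq (U j) (P j.+1).
Let dn j := nveq (U j) (P j).

Let nveqP u v : inK u v -> if nveq u v then v.1 = ordS u.1 else veq u v.
Proof.
rewrite /nveq; case: excluded_middle_informative => // nv [//|[]//].
Qed.

Let sumup j := (\sum_(i < j) up i)%N.
Let sumdn j := (\sum_(i < j) dn i)%N.

Let sum_le (f : nat -> bool) j : (\sum_(i < j) f i)%N <= j.
Proof.
by rewrite -[X in _ <= X]card_ord -sum1_card; apply: leq_sum => i _; case: (f i).
Qed.

Let type_level j : ik ((P 0).1 + sumup j) = ik ((P j).1 + sumdn j).
Proof.
elim: j => [|j IH]; first by rewrite /sumup /sumdn !big_ord0.
rewrite /sumup /sumdn !big_ord_recr /= -/(sumup j) -/(sumdn j) !addnA.
have H1 := nveqP (UP j); have H2 := nveqP (UPS j); rewrite -/(up j) -/(dn j) in H1 H2.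
have upE : (P j.+1).1 = ik ((U j).1 + up j).
  case: (up j) H2 => [->|[<- _]]; first by rewrite -{1}(ik_ord k4 (U j).1) ordS_ik addn1.
  by rewrite addn0 ik_ord.
have dnE : (P j).1 = ik ((U j).1 + dn j).
  case: (dn j) H1 => [->|[<- _]]; first by rewrite -{1}(ik_ord k4 (U j).1) ordS_ik addn1.
  by rewrite addn0 ik_ord.
move: IH; rewrite upE dnE => IH; apply: ik_eq; have /(congr1 val) /= := IH.
rewrite !modnDml => E.
rewrite -modnDml E modnDml -!addnA !modnDml; congr (_ %% k); lia.
Qed.

(** The type goes up [sumup] times and down [sumdn] times, each at most r <= k, and the difference
    vanishes modulo k. If the two are equal, the types lift to integer levels, which [cycle_levels]
    excludes. Otherwise one is k and the other 0, so every step goes the same way. *)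
Lemma cycle_dichotomy : r = k /\
  ((forall j, veq (U j) (P j)) \/ (forall j, veq (U j) (P j.+1))).
Proof.
have r0 : 0 < r by lia.
have perup j : up (j + r)%N = up j by rewrite /up -addSn perP perU.
have perdn j : dn (j + r)%N = dn j by rewrite /dn perP perU.
have permod (f : nat -> bool) : (forall j, f (j + r)%N = f j) -> forall j, f j = f (j %% r).
  move=> per j; rewrite {1}(divn_eq j r) addnC; elim: (j %/ r) => [|q IH].
    by rewrite mul0n addn0.
  by rewrite mulSn addnCA addnC per.
have all0 (f : nat -> bool) : (forall j, f (j + r)%N = f j) -> (\sum_(i < r) f i)%N = 0 ->
    forall j, f j = false.
  move=> per S0 j; rewrite permod //.
  have jr : j %% r < r by rewrite ltn_mod.
  move: S0; rewrite (bigD1 (Ordinal jr)) //=; by case: (f _).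
have tl := type_level r.
have P0r : P r = P 0 by rewrite -[r]add0n perP.
rewrite P0r in tl; move: tl => /(congr1 val) /= /eqP; rewrite eqn_modDl => /eqP tl.
have hu : sumup r <= r := sum_le up r; have hd : sumdn r <= r := sum_le dn r.
have [E|[[Eu Ed]|[Eu Ed]]] : sumup r = sumdn r \/ (sumup r = k /\ sumdn r = 0) \/
    (sumup r = 0 /\ sumdn r = k).
- move: tl; have [hu'|hu'] := ltnP (sumup r) k; have [hd'|hd'] := ltnP (sumdn r) k.
  + by rewrite !modn_small //; left.
  + have -> : sumdn r = k by lia.
    by rewrite modnn modn_small // => ->; right; right.
  + have -> : sumup r = k by lia.
    by rewrite modnn modn_small // => <-; right; left.
  + by left; lia.
(* The multiple k * k of k keeps all levels at least k, so that no subtraction truncates. *)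
- exfalso; pose L := ((P 0).1 + k * k)%N.
  have kk : k + r <= k * k by nia.
  pose lev0 j := (L + sumup j - sumdn j)%N.
  have lev0S j : j < r -> lev0 j.+1 = (lev0 j - dn j + up j)%N.
    move=> jr; rewrite /lev0 /sumup /sumdn !big_ord_recr /= -/(sumup j) -/(sumdn j).
    have : sumdn j <= j := sum_le dn j; rewrite /L; case: (dn j); case: (up j) => /=; lia.
  have lev0r : lev0 r = lev0 0.
    by rewrite /lev0 E /sumup /sumdn !big_ord0; lia.
  pose lev j := lev0 (j %% r); pose rl j := (lev j - dn j)%N.
  have big j : k <= lev0 (j %% r).
    have : sumdn (j %% r) <= j %% r := sum_le dn _; have : j %% r < r by rewrite ltn_mod.
    by rewrite /lev0 /L; lia.
  have levS j : lev j.+1 = (rl j + up j)%N.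
    have jr : j %% r < r by rewrite ltn_mod.
    rewrite /rl /lev (permod up) // (permod dn) // -lev0S //.
    have : j.+1 %% r = (j %% r).+1 %% r by rewrite -!(addn1 (_ %% _)) modnDml addn1.
    move=> ->; have [lt|ge] : (j %% r).+1 < r \/ (j %% r).+1 = r by lia.
      by rewrite modn_small.
    by rewrite ge modnn lev0r.
  have PlevE j : (P j).1 = ik (lev j).
    have -> : P j = P (j %% r).
      rewrite {1}(divn_eq j r) addnC; elim: (j %/ r) => [|q IH]; first by rewrite mul0n addn0.
      by rewrite mulSn addnCA addnC perP.
    have /(congr1 val) /= T := type_level (j %% r); rewrite -[LHS](ik_ord k4).
    apply: ik_eq; rewrite /lev /lev0 /L.
    have sd : sumdn (j %% r) <= j %% r := sum_le dn _.
    have jr : j %% r < r by rewrite ltn_mod.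
    apply/eqP; rewrite -(eqn_modDr (sumdn (j %% r))) subnK; last by nia.
    by rewrite -T [in X in _ == X]addnAC [in X in _ == X]addnC modnMDl.
  apply: (@cycle_levels r P U lev rl) => //.
  + move=> j; have H := nveqP (UP j); rewrite -/(dn j) in H.
    case dE: (dn j) H => H; last first.
      by case: H => -> _; rewrite PlevE /rl dE subn0.
    move: H; rewrite PlevE => H; apply: (@ordS_inj k); rewrite -H ordS_ik /rl dE subn1.
    by rewrite prednK //; have := big j; rewrite -/(lev j); lia.
  + by move=> j; rewrite /rl; have := big j; rewrite -/(lev j); case: (dn j) => /=; lia.
  + by move=> j; rewrite levS; case: (up j); rewrite ?addn0 ?addn1 leqnn leqnSn.
  + by move=> j; rewrite /lev modnDr.
  + by move=> j; rewrite /rl /lev modnDr perdn.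
- split; first lia.
  left=> j; have := nveqP (UP j); rewrite -/(dn j) (all0 _ perdn) //.
- split; first lia.
  right=> j; have := nveqP (UPS j); rewrite -/(up j) (all0 _ perup) //.
Qed.

End Dichotomy.

End Cycles.

(** * Stars, edges and cells recovered from incidences *)

Section Theta.
Variables (k : nat) (m n : 'I_k -> int) (G : group) (a : 'I_k -> G).
Hypothesis k4 : 4 <= k.
Hypothesis mn0 : forall i, m i != 0%R /\ n i != 0%R.
Hypothesis mn : forall i, `|m i| < `|n i|.
Hypothesis hig : is_Hig m n a.

Local Notation ik := (ik k4).
Local Notation A := (ga a k4).
Local Notation Gi := (Gi a).
Local Notation veq := (veq a).
Local Notation inK := (inK a).
Local Notation arrow := (arrow a).
Local Notation eqv := (eqv a k4).
Local Notation incoset := (incoset a).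

Lemma arrow_neq u v : arrow u v -> ~ veq u v.
Proof. by case=> E _ [E' _]; case: (@ordS_neq k k4 u.1); rewrite -E. Qed.

Lemma inK_veq u u' v v' : veq u u' -> veq v v' -> inK u v -> inK u' v'.
Proof.
move=> uu vv [uv|[E [h [H1 H2]]]].
  by left; apply: veq_trans (veq_sym uu) (veq_trans uv vv).
right; split; first by case: (uu) (vv) => <- _ [<- _].
by exists h; split; [apply: veq_incoset uu _|apply: veq_incoset vv _].
Qed.

Lemma inK_refl u : inK u u. Proof. by left; apply: veq_refl. Qed.

Lemma arrow_face j c : arrow (ik j, c) (ik j.+1, c).
Proof.
by split; rewrite /= ?ordS_ik //; exists c; rewrite gmulV; split; apply: gen_one.
Qed.

Lemma out_vertex u : exists w, arrow u w.
Proof.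
exists (ordS u.1, u.2); split=> //; exists u.2; rewrite /= gmulV; split; exact: gen_one.
Qed.

(** Two distinct stars through v and w would form a closed chain of length two, but only length k is
    possible. [triangle_star] is the same argument with length three. *)
Lemma unique_star u u' v w : ~ veq v w -> inK u v -> inK u w -> inK u' v -> inK u' w ->
  veq u u'.
Proof.
move=> vw uv uw uv' uw'; apply: NNPP => uu.
have H : 2 = k.
  have [] // := @cycle_dichotomy k m n G a k4 mn0 hig 2
    (fun j => if odd j then w else v) (fun j => if odd j then u' else u).
  - by lia.
  - by move=> j; case: (odd j).
  - by move=> j; rewrite /=; case: (odd j).
  - by move=> j; rewrite oddD addbF.
  - by move=> j; rewrite oddD addbF.
  - move=> i j; rewrite !modn2; case: (odd i); case: (odd j) => // H.
    by case: vw; apply: veq_sym.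
  - by move=> j; rewrite /=; case: (odd j) => // /veq_sym.
by move: k4; rewrite -H.
Qed.

Lemma triangle_star v w x : adj a v w -> adj a w x -> adj a x v ->
  exists u, [/\ inK u v, inK u w & inK u x].
Proof.
move=> /(adjP k4 mn0 mn hig) [vw [u0 [u0v u0w]]] /(adjP k4 mn0 mn hig) [wx [u1 [u1w u1x]]].
move=> /(adjP k4 mn0 mn hig) [xv [u2 [u2x u2v]]].
have R := @veq_refl k G a.
case: (classic (veq u0 u1)) => [E|n01].
  by exists u0; split=> //; apply: inK_veq (veq_sym E) (R x) u1x.
case: (classic (veq u1 u2)) => [E|n12].
  by exists u1; split=> //; apply: inK_veq (veq_sym E) (R v) u2v.
case: (classic (veq u2 u0)) => [E|n20].
  by exists u2; split=> //; apply: inK_veq (veq_sym E) (R w) u0w.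
exfalso; pose pt (X : Type) (p q s : X) (j : nat) := nth s [:: p; q] (j %% 3).
have H : 3 = k.
  have mS j : j.+1 %% 3 = (j %% 3).+1 %% 3 by rewrite -addn1 -modnDml addn1.
  have m3 j : j %% 3 < 3 by rewrite ltn_mod.
  have [] // := @cycle_dichotomy k m n G a k4 mn0 hig 3 (pt _ v w x) (pt _ u0 u1 u2).
  - by lia.
  - by move=> j; rewrite /pt; case: (j %% 3) (m3 j) => [|[|[|]]].
  - by move=> j; rewrite /pt mS; case: (j %% 3) (m3 j) => [|[|[|]]].
  - by move=> j; rewrite /pt modnDr.
  - by move=> j; rewrite /pt modnDr.
  - move=> i j; rewrite /pt; case: (i %% 3) (m3 i) => [|[|[|]]] // _;
      case: (j %% 3) (m3 j) => [|[|[|]]] // _ /= E; exfalso;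
      first [by apply: vw|by apply: wx|by apply: xv|by apply: vw; apply: veq_sym|
          by apply: wx; apply: veq_sym|by apply: xv; apply: veq_sym].
  - by move=> j; rewrite /pt mS; case: (j %% 3) (m3 j) => [|[|[|]]].
by move: k4; rewrite -H.
Qed.

(** The groups of types j and j+1 meet exactly in the cyclic group of a_j. *)
Lemma eqv_veq j x y : eqv j x y <->
  veq (ik j, x) (ik j, y) /\ veq (ik j.+1, x) (ik j.+1, y).
Proof.
rewrite -eeqE; split=> [E|]; first by rewrite -ordS_ik; apply: eeq_veq E.
case=> -[_ /= H1] [_ /= H2]; split=> //=; apply/EiE.
have [q jE] : exists q, (q + (k - 2)).+1 = j + k by exists (j + 1); lia.
move: H1 H2; rewrite -(ikD k4 j) -(ikD k4 j.+1) addSn -jE => /GiE H1 /GiE H2.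
have [_ [_ _ inter _ _] _ _] := hig_split k4 mn0 hig q.
by have [z ->] := inter _ H1 H2; exists z; rewrite jE gaD.
Qed.

Lemma eqv_eq j x y : eqv j x y -> eqv j.+1 x y -> x = y.
Proof.
case=> z zE [w wE]; have [|z0 _] := @ga_pow_eq _ _ _ _ _ k4 mn0 hig j z w.
  by apply: (@mulIl _ x); rewrite -zE -wE.
by rewrite zE z0 gpow0 mulg1.
Qed.

Lemma face_eq x y : (forall j, veq (ik j, x) (ik j, y)) -> x = y.
Proof. by move=> H; apply: (@eqv_eq 0); apply/eqv_veq. Qed.

Lemma Sg_period u v g : Sg A (u + k) (v + k) g -> Sg A u v g.
Proof.
apply: gen_sub => _ [j juv ->]; exists (j - k)%N; first lia.
by rewrite -(gaD a k4 (j - k)) subnK //; lia.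
Qed.

(** Choose [e j] in the cosets of w j and w (j+1). The passage from [e j] to [e j.+2] is a product
    of an element of L and one of R; going around the other way it lies in H, hence in the free
    group. [gen2_corner] then yields one cell c carrying three consecutive edges, and neighbouring
    corners, sharing two edges, have the same c. *)
Lemma directed_face (w : nat -> vert k G) (t : nat) : (forall j, (w j).1 = ik (j + t)%N) ->
  (forall j, w (j + k)%N = w j) -> (forall j, arrow (w j) (w j.+1)) ->
  exists c, forall j, veq (w j) (ik (j + t)%N, c).
Proof.
move=> wE per ar.
have perM j : w (j %% k) = w j.
  rewrite {2}(divn_eq j k) addnC; elim: (j %/ k) => [|q IH]; first by rewrite mul0n addn0.
  by rewrite mulSn addnCA addnC per.
have ex j : exists h, incoset (w j) h /\ incoset (w j.+1) h by case: (ar j) => _ [h]; exists h.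
pose e0 j := sval (constructive_indefinite_description _ (ex j)).
have e0P j : incoset (w j) (e0 j) /\ incoset (w j.+1) (e0 j).
  exact: svalP (constructive_indefinite_description _ (ex j)).
pose e j := e0 (j %% k).
have perS j : w (j %% k).+1 = w j.+1.
  by rewrite -perM -addn1 modnDml addn1 perM.
have e1 j : incoset (w j) (e j) by rewrite -perM; case: (e0P (j %% k)).
have e2 j : incoset (w j.+1) (e j) by rewrite -perS; case: (e0P (j %% k)).
have ek j : e (j + k)%N = e j by rewrite /e modnDr.
clearbody e.
(* Shifted by one period, so that q j = x + (k - 2) with x = j + t + 2. *)
pose q j := (j + t + k)%N.
have Y j : Sg A (q j) (q j).+1 ((e j)^-1 * e j.+1).
  apply/GiE; have -> : ik (q j).+1 = (w j.+1).1 by rewrite wE -addSn ikD.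
  exact: incoset_diff.
have corner j : exists c, [/\ eqv (q j) (e j) c, eqv (q j).+1 (e j.+1) c
    & eqv (q j).+2 (e j.+2) c].
  pose x := (j + t).+2; have qx : q j = (x + (k - 2))%N by rewrite /q /x; lia.
  have [_ [_ am inter pA qA] amHK interHK] := hig_split k4 mn0 hig x.
  rewrite -qx in am inter pA qA amHK interHK.
  have L := Y j; have R := Y j.+1; rewrite -[q j.+1]/(q j).+1 in R.
  have HY i : 2 <= i -> i <= k -> Sg A (x + k) (q j + k) ((e j.+2)^-1 * e (j + i)%N).
    elim: i => [|i IH] // i2 ik'; have [->|i2'] := eqVneq i 1.
      by rewrite addn2 gmulV; apply: gen_one.
    have -> : (e j.+2)^-1 * e (j + i.+1)%N =
      ((e j.+2)^-1 * e (j + i)%N) * ((e (j + i)%N)^-1 * e (j + i).+1).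
      by rewrite addnS; gsimp.
    apply: (sgM (Sg_sub _ _ _)); first by apply: IH; lia.
    by apply: Sg_mono (Y (j + i)%N); rewrite /q /x; lia.
  have H : Sg A x (q j) ((e j)^-1 * e j.+2).
    have := Sg_period (HY k ltac:(lia) (leqnn k)); rewrite ek.
    by move/(sgV (Sg_sub _ _ _)); rewrite invMg invgK.
  have F : gen (fun z => z = A (q j) \/ z = A (q j).+2)
      ((e j)^-1 * e j.+1 * ((e j.+1)^-1 * e j.+2)).
    have E : (e j)^-1 * e j.+1 * ((e j.+1)^-1 * e j.+2) = (e j)^-1 * e j.+2 by gsimp.
    apply: interHK; first by rewrite E.
    by apply: (sgM (Sg_sub _ _ _)); [apply: Sg_mono L|apply: Sg_mono R]; lia.
  have [u [v [c [Lc Rc E1 E2]]]] := gen2_corner am pA qA L R F.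
  have [s cE] := inter _ Lc Rc; subst c.
  exists (e j * A (q j) ^ u); split; first by exists u.
    exists (- s)%R; apply: (@mulIr _ (A (q j).+1 ^ s)); rewrite gpowN mulgKV -gmulA -E1.
    by rewrite gmulA mulgV gmul1.
  exists (- v)%R; apply: (@mulIr _ (A (q j).+2 ^ v)); rewrite gpowN mulgKV.
  apply: (@mulIl _ ((e j.+1)^-1)); rewrite E2.
  have -> : e j.+1 = e j * A (q j) ^ u * A (q j).+1 ^ s.
    by rewrite -gmulA -E1; gsimp.
  by gsimp.
pose c j := sval (constructive_indefinite_description _ (corner j)).
have cP j : [/\ eqv (q j) (e j) (c j), eqv (q j).+1 (e j.+1) (c j)
    & eqv (q j).+2 (e j.+2) (c j)].
  exact: svalP (constructive_indefinite_description _ (corner j)).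
have cS j : c j.+1 = c j.
  have [_ h1 h2] := cP j; have [h1' h2' _] := cP j.+1.
  apply: (@eqv_eq (q j).+1); first exact: eqv_trans (eqv_sym h1') h1.
  exact: eqv_trans (eqv_sym h2') h2.
have c0 j : c j = c 0 by elim: j => [|j IH] //; rewrite cS.
exists (c 0) => j; have [[z cE] _ _] := cP j; rewrite c0 in cE.
apply: (@incoset_veq _ _ _ (w j) (ik (j + t)%N, c 0) _ _ (wE j) (e1 j) (_ : incoset (_, c 0) (c 0))).
  by rewrite /incoset /= gmulV; apply: gen_one.
rewrite wE cE gmulA gmulV gmul1 -ikD.
have [p pE] : exists p, q j = p.+1 by exists (q j).-1; rewrite /q; lia.
by rewrite -/(q j) pE; apply/GiE; apply: pow_in; lia.
Qed.

End Theta.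

(** * Automorphisms of the intersection graph *)

Section ThetaAut.
Variables (k : nat) (m n : 'I_k -> int) (G : group) (a : 'I_k -> G).
Hypothesis k4 : 4 <= k.
Hypothesis mn0 : forall i, m i != 0%R /\ n i != 0%R.
Hypothesis mn : forall i, `|m i| < `|n i|.
Hypothesis hig : is_Hig m n a.

Local Notation ik := (ik k4).
Local Notation A := (ga a k4).
Local Notation Gi := (Gi a).
Local Notation veq := (veq a).
Local Notation inK := (inK a).
Local Notation arrow := (arrow a).
Local Notation eqv := (eqv a k4).

Lemma arrow_inK u v : arrow u v <-> inK u v /\ ~ veq u v.
Proof.
by split=> [H|[[]//]]; split; [right|apply: arrow_neq H].
Qed.

Lemma arrow_adj u w : arrow u w -> adj a u w.
Proof.
move=> uw; apply/(adjP k4 mn0 mn hig); split; first by case/arrow_inK: uw.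
by exists u; split; [apply: inK_refl|right].
Qed.

Lemma veq_adj v v' w w' : veq v v' -> veq w w' -> adj a v w -> adj a v' w'.
Proof.
move=> vv ww /(adjP k4 mn0 mn hig) [vw [u [uv uw]]]; apply/(adjP k4 mn0 mn hig).
split=> [vw'|]; first by apply: vw; apply: veq_trans vv (veq_trans vw' (veq_sym ww)).
by exists u; split; [apply: inK_veq vv uv|apply: inK_veq ww uw]; apply: veq_refl.
Qed.

Lemma star_incl_veq u u' : (forall x, inK u x -> inK u' x) -> veq u u'.
Proof.
move=> H; have [w uw] := out_vertex a u; have [uw' nuw] := (arrow_inK _ _).1 uw.
apply: (unique_star k4 mn0 hig nuw) => //; first exact: inK_refl.
  by apply: H; apply: inK_refl.
exact: H.
Qed.

Lemma inverse_autTheta f : is_autTheta a f ->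
  exists g, [/\ is_autTheta a g, forall x, veq (g (f x)) x & forall x, veq (f (g x)) x].
Proof.
case=> -[fE [g [gE gf fg]]] fA; exists g; split=> //; split.
  by split=> //; exists f.
move=> v w; rewrite (fA (g v)); split; apply: veq_adj => //; exact: veq_sym.
Qed.

Lemma autTheta_veq f v w : is_autTheta a f -> veq v w <-> veq (f v) (f w).
Proof.
by case=> fB _; apply: setoid_bij_iff fB v w; [apply: veq_sym|apply: veq_trans].
Qed.

(** An arrow from u to w becomes an edge, which lies in a unique star. Any other x in K_u forms a
    triangle with u and w, so its image lies in that star too. *)
Lemma star_sub f u : is_autTheta a f -> exists u', forall x, inK u x -> inK u' (f x).
Proof.
move=> fT; have fE v w : veq v w -> veq (f v) (f w) by apply: (autTheta_veq v w fT).1.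
have [w uw] := out_vertex a u; have Auw := arrow_adj uw.
have [_ fA] := fT; have Afuw := (fA _ _).1 Auw.
have [nf [u' [u'u u'w]]] := (adjP k4 mn0 mn hig _ _).1 Afuw.
exists u' => x ux.
case: (classic (veq u x)) => [E|nux]; first exact: inK_veq (veq_refl _ _) (fE _ _ E) u'u.
case: (classic (veq w x)) => [E|nwx]; first exact: inK_veq (veq_refl _ _) (fE _ _ E) u'w.
have Awx : adj a w x.
  by apply/(adjP k4 mn0 mn hig); split=> //; exists u; split=> //; right.
have Axu : adj a x u.
  apply/(adjP k4 mn0 mn hig); split; first by move/veq_sym.
  by exists u; split=> //; apply: inK_refl.
have [u'' [h1 h2 h3]] := triangle_star k4 mn0 mn hig Afuw ((fA _ _).1 Awx) ((fA _ _).1 Axu).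
have E : veq u'' u' by apply: (unique_star k4 mn0 hig nf).
exact: inK_veq E (veq_refl _ _) h3.
Qed.

Lemma star_image f u : is_autTheta a f -> exists u', forall x, inK u x <-> inK u' (f x).
Proof.
move=> fT; have [g [gT gf fg]] := inverse_autTheta fT.
have [u' uu'] := star_sub u fT; have [u'' u'u''] := star_sub u' gT.
have H x : inK u' (f x) -> inK u'' x.
  by move/u'u''; apply: inK_veq (gf x); apply: veq_refl.
have E : veq u u'' by apply: star_incl_veq => x /uu'/H.
exists u' => x; split; first exact: uu'.
by move/H; apply: inK_veq (veq_sym E) (veq_refl _ _).
Qed.

Section OneAut.
Variable f : vert k G -> vert k G.
Hypothesis fT : is_autTheta a f.

Let fE v w : veq v w <-> veq (f v) (f w). Proof. exact: autTheta_veq. Qed.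

Lemma autTheta_inK u x : inK u x <-> inK (f u) (f x).
Proof.
pose L u := sval (constructive_indefinite_description _ (star_image u fT)).
have LK u' x' : inK u' x' <-> inK (L u') (f x').
  exact: svalP (constructive_indefinite_description _ (star_image u' fT)) x'.
clearbody L.
have LE u1 u2 : veq (L u1) (L u2) <-> veq u1 u2.
  split=> E.
    apply: star_incl_veq => x' /LK H; apply/LK; exact: inK_veq E (veq_refl _ _) H.
  have [g [_ _ fg]] := inverse_autTheta fT.
  apply: star_incl_veq => y H.
  have {}H : inK (L u1) (f (g y)) by apply: inK_veq (veq_refl _ _) (veq_sym (fg y)) H.
  have {}H := inK_veq E (veq_refl _ _) ((LK _ _).2 H).
  exact: inK_veq (veq_refl _ _) (fg y) ((LK _ _).1 H).
(* [L u] is the centre of the star onto which f maps K_u. Around one cell, the centres L and the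
   vertices f form a closed chain of length k, and the two alternatives are its directions. *)
have dich c : (forall j, veq (L (ik j, c)) (f (ik j, c))) \/
    (forall j, veq (L (ik j, c)) (f (ik j.+1, c))).
  have [] // := @cycle_dichotomy k m n G a k4 mn0 hig k
    (fun j => f (ik j, c)) (fun j => L (ik j, c)).
  - by lia.
  - by move=> j; apply: (LK _ _).1; apply: inK_refl.
  - by move=> j; apply: (LK _ _).1; right; apply: arrow_face.
  - by move=> j; rewrite ikD.
  - by move=> j; rewrite ikD.
  - by move=> i j /(fE _ _).2 [/= []].
  - by move=> j /(LE _ _).1 [/= E _]; case: (@ik_neq k k4 j 1); rewrite ?addn1 //; lia.
have shared c j : j = 1 \/ j = 2 -> veq (ik j, c) (ik j, c * A 1).
  have cA : c^-1 * (c * A 1) = A 1 ^ 1 by rewrite gmulA gmulV gmul1 gpow1.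
  by case=> ->; split=> //=; rewrite cA; apply/GiE; apply: pow_in.
have fwd c j : veq (L (ik j, c)) (f (ik j, c)).
  (* Compare with the cell c a_1, which shares the vertices of types 1 and 2. If it goes forward, L
     takes the same value at these two vertices. If it goes backward, the cells also share the
     vertex of type 0, hence the edge of type 0, and a_1 would be a power of a_0. *)
  have [//|bwd] := dich c; exfalso.
  have s1 := shared c 1 (or_introl erefl); have s2 := shared c 2 (or_intror erefl).
  have [fwd'|bwd'] := dich (c * A 1).
    have : veq (L (ik 1, c)) (L (ik 2, c)).
      apply: veq_trans (bwd 1) _; apply: veq_trans ((fE _ _).1 s2) _.
      by apply: veq_trans (veq_sym (fwd' 2)) _; apply: (LE _ _).2; apply: veq_sym.
    by case/(LE _ _).1 => /= E _; case: (@ik_neq k k4 1 1); [lia|].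
  have s0 : veq (ik 0, c) (ik 0, c * A 1).
    apply: (LE _ _).1; apply: veq_trans (bwd 0) _; apply: veq_trans ((fE _ _).1 s1) _.
    exact: veq_sym (bwd' 0).
  have [z E] : eqv 0 c (c * A 1) by apply/(eqv_veq k4 mn0 hig).
  have := mulIl E; rewrite -[A 1 in LHS]gpow1 => /esym/(ga_pow_eq mn0 hig) [_].
  by [].
have LF v : veq (L v) (f v) by case: v => i c; rewrite -(ik_ord k4 i); apply: fwd.
by rewrite LK; split; apply: inK_veq (veq_refl _ _) => //; apply: veq_sym.
Qed.

Lemma autTheta_arrow u v : arrow u v <-> arrow (f u) (f v).
Proof. by rewrite !arrow_inK autTheta_inK fE. Qed.

Lemma autTheta_face : exists (t : 'I_k) (fF : G -> G),
  forall c j, veq (f (ik j, c)) (ik (j + t)%N, fF c).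
Proof.
pose t := (f (ik 0, gone)).1.
have fS c j : (f (ik j.+1, c)).1 = ordS (f (ik j, c)).1.
  by have /autTheta_arrow [] := arrow_face a k4 j c.
have agree c c' j : (f (ik j, c)).1 = (f (ik j, c')).1 -> (f (ik 0, c)).1 = (f (ik 0, c')).1.
  by elim: j => // j IH; rewrite !fS => /ordS_inj /IH.
have step c x : (f (ik 0, c * x)).1 = (f (ik 0, c)).1.
  elim: (hig_gen hig x) c => {x} [_ [i ->] c|c|x y _ IHx _ IHy c|x _ IHx c].
  - apply: (@agree _ _ i); apply: proj1; apply: (fE _ _).1; apply: veq_sym; split=> //=.
    by rewrite gmulA gmulV gmul1 ik_ord; apply: gen_in; right.
  - by rewrite mulg1.
  - by rewrite gmulA IHy IHx.
  - by rewrite -[in RHS](mulgKV c x) IHx.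
have type c j : (f (ik j, c)).1 = ik (j + t)%N.
  elim: j => [|j IH]; first by rewrite -[c]gmul1 step add0n ik_ord.
  by rewrite fS IH ordS_ik.
have ex c : exists c', forall j, veq (f (ik j, c)) (ik (j + t)%N, c').
  apply: (directed_face mn0 hig) => [j|j|j]; first exact: type.
    by rewrite ikD.
  exact: (autTheta_arrow _ _).1 (arrow_face _ _ _ _).
exists t, (fun c => sval (constructive_indefinite_description _ (ex c))) => c.
exact: svalP (constructive_indefinite_description _ (ex c)).
Qed.

End OneAut.

Lemma autTheta_rigid f : is_autTheta a f -> exists (t : 'I_k) (fF : G -> G),
  [/\ in_Fsigma m n t,
  forall x y, fF (x * y) = fF x * (fF gone)^-1 * fF y,
  forall j, fF (A j) = fF gone * A (j + t)%N &
  forall v, veq (f v) (oadd v.1 t, fF v.2)].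
Proof.
move=> fT; have [g [gT gf fg]] := inverse_autTheta fT.
have [t [fF fFE]] := autTheta_face fT; have [s [gF gFE]] := autTheta_face gT.
have fVE v w := autTheta_veq v w fT; have gVE v w := autTheta_veq v w gT.
have gK : cancel fF gF.
  move=> c; apply: (face_eq mn0 hig) => j.
  have h1 : veq (g (f (ik j, c))) (ik (j + t + s)%N, gF (fF c)).
    exact: veq_trans ((gVE _ _).1 (fFE c j)) (gFE _ _).
  have h2 := veq_trans (veq_sym h1) (gf _).
  by case: (h2) => /= E _; rewrite E in h2.
have fK : cancel gF fF.
  move=> c; apply: (face_eq mn0 hig) => j.
  have h1 : veq (f (g (ik j, c))) (ik (j + s + t)%N, fF (gF c)).
    exact: veq_trans ((fVE _ _).1 (gFE c j)) (fFE _ _).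
  have h2 := veq_trans (veq_sym h1) (fg _).
  by case: (h2) => /= E _; rewrite E in h2.
have fv x y j : veq (ik j, x) (ik j, y) <-> veq (ik (j + t)%N, fF x) (ik (j + t)%N, fF y).
  rewrite fVE; split=> H.
    exact: veq_trans (veq_sym (fFE _ _)) (veq_trans H (fFE _ _)).
  exact: veq_trans (fFE _ _) (veq_trans H (veq_sym (fFE _ _))).
have fm j : eqv_map a k4 fF j (j + t)%N.
  by move=> x y; rewrite !(eqv_veq k4 mn0 hig) -addSn -!fv.
have [fM [fA tF]] := link_rigid mn0 mn hig gK fK fm.
exists t, fF; split=> //.
  by move=> i; rewrite -(ik_ord k4 i) oadd_ik; apply: tF.
by case=> i c; rewrite /= -{1}(ik_ord k4 i); apply: veq_trans (fFE _ _) _;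
  rewrite -oadd_ik ik_ord; apply: veq_refl.
Qed.

Variable alpha : 'I_k -> G -> G.
Hypothesis alphaP : forall t, in_Fsigma m n t ->
  is_hom (alpha t) /\ forall i, alpha t (a i) = a (oadd i t).

Lemma autTheta_surjective f : is_autTheta a f ->
  exists g t, in_Fsigma m n t /\ forall v, veq (f v) (actV alpha g t v).
Proof.
move=> /autTheta_rigid [t [fF [Ft fM fA ft]]].
exists (fF gone), t; split=> // v; rewrite /actV.
by rewrite -(affine_alpha hig alphaP _ Ft fM fA).
Qed.

(** The type of the image of the vertex (0, 1) gives t; then g and g' index cells with the same
    vertices, and [face_eq] applies. *)
Lemma actV_injective g t g' t' : in_Fsigma m n t -> in_Fsigma m n t' ->
  (forall v, veq (actV alpha g t v) (actV alpha g' t' v)) -> g = g' /\ t = t'.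
Proof.
move=> Ft Ft' H.
have tt : t = t'.
  have [/= + _] := H (ik 0, gone); move/(congr1 val) => /=.
  by rewrite mod0n !add0n !modn_small // => E; apply: val_inj.
split=> //; subst t'; apply: (face_eq mn0 hig) => j.
have := H (oadd (ik j) (oopp k4 t), gone).
by have [hM _] := alphaP Ft; rewrite /actV /= oaddVK (hom1 hM) !mulg1.
Qed.

End ThetaAut.

Theorem theorem4p2 (k : nat) (m n : 'I_k -> int)
  (G : group) (a : 'I_k -> G) (alpha : 'I_k -> G -> G) :
  4 <= k ->
  (forall i, m i != 0%R /\ n i != 0%R) ->
  (forall i, (`|m i| < `|n i|)%N) ->
  is_Hig m n a ->
  (forall t, in_Fsigma m n t ->
     is_hom (alpha t) /\ forall i, alpha t (a i) = a (oadd i t)) ->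
  (* the natural map  Hig_hat -> Aut(X_sigma)  is well defined, injective and surjective *)
  ((forall g t, in_Fsigma m n t ->
      is_autX a (actV alpha g t) (actE alpha g t) (actF alpha g t)) /\
   (forall g t g' t', in_Fsigma m n t -> in_Fsigma m n t' ->
      (forall v, veq a (actV alpha g t v) (actV alpha g' t' v)) ->
      (forall e, eeq a (actE alpha g t e) (actE alpha g' t' e)) ->
      (forall c, feq (actF alpha g t c) (actF alpha g' t' c)) ->
      g = g' /\ t = t') /\
   (forall fV fE fF, is_autX a fV fE fF ->
      exists g t, [/\ in_Fsigma m n t,
        forall v, veq a (fV v) (actV alpha g t v),
        forall e, eeq a (fE e) (actE alpha g t e) &
        forall c, feq (fF c) (actF alpha g t c)])) /\
  (* the natural map  Hig_hat -> Aut(Theta_sigma)  is well defined, injective and surjective *)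
  ((forall g t, in_Fsigma m n t -> is_autTheta a (actV alpha g t)) /\
   (forall g t g' t', in_Fsigma m n t -> in_Fsigma m n t' ->
      (forall v, veq a (actV alpha g t v) (actV alpha g' t' v)) ->
      g = g' /\ t = t') /\
   (forall fV, is_autTheta a fV ->
      exists g t, in_Fsigma m n t /\
        forall v, veq a (fV v) (actV alpha g t v))).
Proof.
move=> k4 mn0 mn hig alphaP; split; split.
- by move=> g t Ft; apply: act_autX k4 hig alphaP _ _ Ft.
- split; last by move=> fV fE fF; apply: (autX_surjective k4 hig alphaP mn0 mn).
  move=> g t g' t' Ft Ft' H _ _.
  exact: (actV_injective k4 mn0 hig alphaP Ft Ft' H).
- by move=> g t Ft; apply: act_autTheta k4 hig alphaP _ _ Ft.
- split=> [g t g' t' Ft Ft' H|fV].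
    exact: (actV_injective k4 mn0 hig alphaP Ft Ft' H).
  exact: (autTheta_surjective k4 mn0 mn hig alphaP).
Qed.
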